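(* Let $s\ge1$ and let $\varphi_{\mu_1\nu_1\dots\mu_s\nu_s}$ be a smooth complex spin-$s$ field strength on $dS_4$ satisfying the free field equations (for $s=1$: $\nabla^\mu\varphi_{\mu\nu}=0$ and $\nabla_{[\rho}\varphi_{\mu\nu]}=0$; for $s\ge2$: $\nabla^{\mu_1}\varphi_{\mu_1\nu_1\mu_2\nu_2\dots\mu_s\nu_s}=0$). Then the limits defining the boundary data $\mathcal E_{i_1\dots i_s}$ and $\mathcal B_{i_1\dots i_s}$ on $\mathcal I^\pm$ exist. The solution space is the direct sum of antipodally even and antipodally odd solutions, and: (1) if $\varphi$ is antipodally even, then $\mathcal E\equiv0$ on $\mathcal I^+$ and $\mathcal I^-$ (purely magnetic); (2) if $\varphi$ is antipodally odd, then $\mathcal B\equiv0$ on $\mathcal I^+$ and $\mathcal I^-$ (purely electric). Conversely, a smooth solution with $\mathcal E\equiv0$ on $\mathcal I^-$ is antipodally even, and one with $\mathcal B\equiv0$ on $\mathcal I^-$ is antipodally odd.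
   Context: Let $\mathbb R^{4,1}$ carry the metric $\eta=\mathrm{diag}(-1,1,1,1,1)$, and let $dS_4=\{x: x\cdot x=1\}$ with induced metric $g$ and Levi-Civita connection $\nabla$. Tensor fields on $dS_4$ are represented as ambient tensors tangent to $dS_4$. A rank-$k$ tensor field $w$ is antipodally even/odd if $w_{\mu_1\dots\mu_k}(-x)=\pm(-1)^k w_{\mu_1\dots\mu_k}(x)$ in ambient components, equivalently if its pullback under $x\mapsto-x$ equals $\pm w$. A spin-$s$ field strength is a rank-$2s$ tensor $\varphi_{\mu_1\nu_1\dots\mu_s\nu_s}$ that is antisymmetric within each pair $\mu_k\nu_k$, symmetric under interchange of any two pairs, totally traceless, and vanishes on antisymmetrization over any three indices. Fix an orientation of $\mathbb R^{4,1}$ with Levi-Civita tensor $\epsilon^{\mu\nu\rho\sigma\lambda}$ and set $\epsilon^{\mu\nu\rho\sigma}=\epsilon^{\mu\nu\rho\sigma\lambda}x_\lambda$ on $dS_4$. Use global coordinates $x=(x^0,\sqrt{1+(x^0)^2}\,\omega)$, $\omega\in S^3$, and $z=1/x^0$; $\mathcal I^\pm$ corresponds to $z\to0^\pm$, with points labelled by $\omega$. Let $n^\mu$ be the future-pointing unit normal to the slices $x^0=\mathrm{const}$. Define $E_{\mu_1\dots\mu_s}=n^{\nu_1}\cdots n^{\nu_s}\varphi_{\mu_1\nu_1\dots\mu_s\nu_s}$ and $B_{\mu_1\dots\mu_s}=\tfrac12\epsilon_{\mu_1\nu_1}{}^{\rho\sigma}n^{\nu_1}n^{\nu_2}\cdots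 n^{\nu_s}\varphi_{\rho\sigma\mu_2\nu_2\dots\mu_s\nu_s}$. With components $E_{i_1\dots i_s}$, $B_{i_1\dots i_s}$ taken with respect to the coordinate vector fields of a chart $(\omega^i)$ on $S^3$ (in coordinates $(z,\omega^i)$), the boundary data are $\mathcal E_{i_1\dots i_s}|_{\mathcal I^\pm}(\omega)=(\pm1)^{s+1}\lim_{z\to0^\pm}E_{i_1\dots i_s}/z$ and $\mathcal B_{i_1\dots i_s}|_{\mathcal I^\pm}(\omega)=(\pm1)^{s}\lim_{z\to0^\pm}B_{i_1\dots i_s}/z$. *)

(* Defs.v *)
From HB Require Import structures.
From mathcomp Require Import all_boot all_order all_algebra.
From mathcomp Require Import all_classical all_reals all_analysis.
Set Implicit Arguments. Unset Strict Implicit. Unset Printing Implicit Defensive.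
Import Order.TTheory GRing.Theory Num.Theory.
Import numFieldNormedType.Exports.
Local Open Scope ring_scope.
Local Open Scope classical_set_scope.

Section DeSitter.
Variable R : realType.

Definition V := 'rV[R]_5.
Definition coord (x : V) (a : 'I_5) : R := x ord0 a.
Definition eta (a : 'I_5) : R := if a == ord0 then -1 else 1.
Definition mdot (x y : V) : R := \sum_(a < 5) eta a * coord x a * coord y a.
Definition xlow (x : V) (a : 'I_5) : R := eta a * coord x a.

Definition dS4 : set V := [set x | mdot x x = 1].

Definition evec (a : 'I_5) : V := delta_mx ord0 a.
Definition partial (a : 'I_5) (f : V -> R) : V -> R := fun x => 'D_(evec a) f x.
Definition iter_partial (l : seq 'I_5) (f : V -> R) : V -> R :=
  foldr partial f l.
Definition smooth (f : V -> R) : Prop :=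
  forall l : seq 'I_5, continuous (iter_partial l f) /\
    forall (a : 'I_5) (x : V), derivable (iter_partial l f) x (evec a).

(* Real tensor fields with index slots labelled by a finite type I; the  *)
(* value T J x is the ambient lower component T_{J}(x).                   *)
Definition field (I : finType) := {ffun I -> 'I_5} -> V -> R.

Definition upd (I : finType) (J : {ffun I -> 'I_5}) (p : I) (a : 'I_5) :
  {ffun I -> 'I_5} := [ffun q => if q == p then a else J q].
Definition swap (I : finType) (J : {ffun I -> 'I_5}) (p q : I) :=
  upd (upd J p (J q)) q (J p).

Definition proj (x : V) (mu beta : 'I_5) : R :=
  (mu == beta)%:R - xlow x mu * coord x beta.

(* Levi-Civita connection of dS_4 on tangent tensor fields (Gauss formula):
   (nabla T)_{rho J} = P_rho^alpha P_{J_1}^{beta_1}...P_{J_k}^{beta_k} d_alpha T_beta *)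
Definition nabla (I : finType) (T : field I) (rho : 'I_5) : field I :=
  fun J x => \sum_(alpha < 5) \sum_(beta : {ffun I -> 'I_5})
     proj x rho alpha * (\prod_(i : I) proj x (J i) (beta i))
       * partial alpha (T beta) x.

Definition smooth_field (I : finType) (T : field I) : Prop :=
  forall J, smooth (T J).

Definition tangent_field (I : finType) (T : field I) : Prop :=
  forall x, dS4 x -> forall (p : I) J,
    \sum_(a < 5) coord x a * T (upd J p a) x = 0.

Definition assign3 (I : finType) (J : {ffun I -> 'I_5}) (p q r : I) (a b c : 'I_5) :=
  upd (upd (upd J p a) q b) r c.
Definition alt3 (I : finType) (T : field I) (J : {ffun I -> 'I_5}) (p q r : I) (x : V) : R :=
  let a := J p in let b := J q in let c := J r in
    T (assign3 J p q r a b c) x + T (assign3 J p q r b c a) x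
  + T (assign3 J p q r c a b) x - T (assign3 J p q r b a c) x
  - T (assign3 J p q r a c b) x - T (assign3 J p q r c b a) x.

Definition antipodally_even (I : finType) (T : field I) : Prop :=
  forall x, dS4 x -> forall J, T J (- x) = (-1) ^+ #|I| * T J x.
Definition antipodally_odd (I : finType) (T : field I) : Prop :=
  forall x, dS4 x -> forall J, T J (- x) = - ((-1) ^+ #|I| * T J x).

(* Spin-s field strengths, s = n.+1: slots are 'I_s * bool, the slot     *)
(* (k,false) is mu_{k+1} and (k,true) is nu_{k+1}.                        *)
Definition slot (n : nat) := ('I_n.+1 * bool)%type.

Definition field_strength (n : nat) (phi : field (slot n)) : Prop :=
  tangent_field phi /\
  forall x, dS4 x ->
  [/\
      forall (k : 'I_n.+1) J, phi (swap J (k, false) (k, true)) x = - phi J x,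
      forall (k l : 'I_n.+1) J,
        phi (swap (swap J (k, false) (l, false)) (k, true) (l, true)) x = phi J x,
      forall (p q : slot n) J, p != q ->
        \sum_(a < 5) eta a * phi (upd (upd J p a) q a) x = 0 &
      forall (p q r : slot n) J, p != q -> q != r -> p != r ->
        alt3 phi J p q r x = 0].

Definition pairJ (mu nu : 'I_5) : {ffun slot 0 -> 'I_5} :=
  [ffun p : slot 0 => if p.2 then nu else mu].

Definition divergence_free (n : nat) (phi : field (slot n)) : Prop :=
  forall x, dS4 x -> forall J,
    \sum_(rho < 5) eta rho * nabla phi rho (upd J (ord0, false) rho) x = 0.

Definition closed1 (phi : field (slot 0)) : Prop :=
  forall x, dS4 x -> forall rho mu nu : 'I_5,
    nabla phi rho (pairJ mu nu) x + nabla phi mu (pairJ nu rho) x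
  + nabla phi nu (pairJ rho mu) x - nabla phi mu (pairJ rho nu) x
  - nabla phi rho (pairJ nu mu) x - nabla phi nu (pairJ mu rho) x = 0.

Definition field_equations (n : nat) (phi : field (slot n)) : Prop :=
  divergence_free phi /\
  (match n return field (slot n) -> Prop with
   | 0 => fun psi => closed1 psi
   | _ => fun _ => True end) phi.

Definition solution (n : nat) (phi : field (slot n)) : Prop :=
  [/\ smooth_field phi, field_strength phi & field_equations phi].

(* Complex fields: phi = phi true + i * phi false.  All the notions used *)
(* (equations, parity, E, B, limits, vanishing) are real-linear with real *)
(* coefficients, hence are imposed componentwise.                          *)
Definition cfield (n : nat) := bool -> field (slot n).
Definition csolution (n : nat) (phi : cfield n) : Prop :=
  forall b, solution (phi b).
Definition cantipodally_even (n : nat) (phi : cfield n) : Prop :=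
  forall b, antipodally_even (phi b).
Definition cantipodally_odd (n : nat) (phi : cfield n) : Prop :=
  forall b, antipodally_odd (phi b).

(* future-pointing unit normal to the slices x^0 = const on dS_4 *)
Definition nvec (x : V) (a : 'I_5) : R :=
  if a == ord0 then Num.sqrt (1 + coord x ord0 ^+ 2)
  else coord x ord0 * coord x a / Num.sqrt (1 + coord x ord0 ^+ 2).

(* Levi-Civita symbol epsilon^{a b c d e}, with epsilon^{01234} = 1 *)
Definition eps5 (a b c d e : 'I_5) : R :=
  let s := [:: val a; val b; val c; val d; val e] in
  if uniq s then
    (-1) ^+ (\sum_(i < 5) \sum_(j < 5 | (i < j)%N)
               (nth 0%N s j < nth 0%N s i)%N)
  else 0.
Definition eps4 (x : V) (mu nu rho sigma : 'I_5) : R :=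
  \sum_(l < 5) eps5 mu nu rho sigma l * xlow x l.
Definition eps4ll (x : V) (mu nu rho sigma : 'I_5) : R :=
  eta mu * eta nu * eps4 x mu nu rho sigma.

Definition efield (n : nat) (phi : field (slot n)) : field ('I_n.+1) :=
  fun J x => \sum_(nu : {ffun 'I_n.+1 -> 'I_5})
    (\prod_(k < n.+1) nvec x (nu k)) *
    phi [ffun p : slot n => if p.2 then nu p.1 else J p.1] x.

Definition bfield (n : nat) (phi : field (slot n)) : field ('I_n.+1) :=
  fun J x => 2^-1 * \sum_(nu : {ffun 'I_n.+1 -> 'I_5}) \sum_(rho < 5) \sum_(sigma < 5)
    eps4ll x (J ord0) (nu ord0) rho sigma * (\prod_(k < n.+1) nvec x (nu k)) *
    phi [ffun p : slot n => if p.1 == ord0 then (if p.2 then sigma else rho)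
                            else (if p.2 then nu p.1 else J p.1)] x.

(* Global coordinates near I^pm: x = (1/z, sqrt(1 + z^-2) omega),        *)
(* omega in S^3, viewed as a vector of V with vanishing 0-th component.   *)
Definition S3 : set V :=
  [set w | coord w ord0 = 0 /\ \sum_(a < 5) coord w a ^+ 2 = 1].
Definition tangentS3 (w u : V) : Prop :=
  coord u ord0 = 0 /\ \sum_(a < 5) coord u a * coord w a = 0.

Definition Xpt (z : R) (w : V) : V :=
  z^-1 *: evec ord0 + Num.sqrt (1 + z^-2) *: w.

(* Component of a rank-s tensor T at the point (z, omega) on the coordinate
   vector fields d/d omega^{i_k} of a chart of S^3, whose value at omega is
   u k = d omega / d omega^{i_k}; the ambient coordinate vector is
   (0, sqrt(1+z^-2) u k). *)
Definition chart_comp (n : nat) (T : field ('I_n.+1))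
    (w : V) (u : 'I_n.+1 -> V) (z : R) : R :=
  \sum_(J : {ffun 'I_n.+1 -> 'I_5})
    (\prod_(k < n.+1) (Num.sqrt (1 + z^-2) * coord (u k) (J k))) * T J (Xpt z w).

Definition Eq (n : nat) (phi : field (slot n)) w u : R -> R :=
  fun z => chart_comp (efield phi) w u z / z.
Definition Bq (n : nat) (phi : field (slot n)) w u : R -> R :=
  fun z => chart_comp (bfield phi) w u z / z.

Definition bdryE_plus (n : nat) (phi : field (slot n)) w u : R :=
  1 ^+ n.+2 * lim (Eq phi w u @ at_right 0).
Definition bdryE_minus (n : nat) (phi : field (slot n)) w u : R :=
  (-1) ^+ n.+2 * lim (Eq phi w u @ at_left 0).
Definition bdryB_plus (n : nat) (phi : field (slot n)) w u : R :=
  1 ^+ n.+1 * lim (Bq phi w u @ at_right 0).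
Definition bdryB_minus (n : nat) (phi : field (slot n)) w u : R :=
  (-1) ^+ n.+1 * lim (Bq phi w u @ at_left 0).

End DeSitter.

(* Main.v *)
(* Freezing all index pairs of [phi] but the first leaves a solution [F] of Maxwell's
   equations; for [s >= 2] the Bianchi identity follows from the divergence equation,
   because in four dimensions a traceless tensor antisymmetric in three and in two indices
   vanishes. Hence every ambient component [f] of [F], and of the three-form [x /\ F],
   satisfies the conformally coupled wave equation [box f = 2 f]. For such a scalar,
   Kirchhoff's formula over the light cone of a point shows that [f / z] has limits on
   I^+ and I^-, that these vanish if [f] is even, and, by comparing the cones of [x] and
   [- x], that [f] is even if they vanish on I^-.
   Up to multiples of [x] and a factor, the unit normal is the constant vector [d/dx^0],
   so the electric part of [phi] consists of the components [phi_(i 0 j 0 ...)] and the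
   magnetic part of the components of the [x /\ F]; the additional factor [x] exchanges the
   parities, which gives (1) and (2). Conversely, if the electric data vanish on I^- then
   the odd part of [phi] has no electric components. Its Maxwell fields then decay like
   [(1 + (x^0)^2)^-1] in time, so their data on I^- vanish and they are even as well as odd,
   hence zero; the remaining components vanish by trace-freeness, one index pair after the
   other. The magnetic case is analogous. *)
Require Import Defs.
From HB Require Import structures.
From mathcomp Require Import all_boot all_order all_algebra.
From mathcomp Require Import all_classical all_reals all_analysis.
From mathcomp Require Import zify ring lra.
(* Imported again: [coord] must not be the one of mathcomp's vector spaces. *)
Require Import Defs.
Import Order.TTheory GRing.Theory Num.Theory.
Import numFieldNormedType.Exports.
Local Open Scope ring_scope.
Local Open Scope classical_set_scope.

Set Implicit Arguments. Unset Strict Implicit. Unset Printing Implicit Defensive.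

(** The fields are smooth on the whole ambient space but constrained on dS_4 only. All calculus
    therefore uses the projected gradient [dl], which depends only on values on dS_4 ([dl_eq]), so
    that identities valid only there can still be differentiated. The obstacle in the scalar
    converse is that the hypothesis controls the size of [f] near the boundary but none of its
    derivatives, while Kirchhoff's formula contains a derivative transverse to the sphere. After the
    comparison of two cones only a derivative within the slice remains, and it combines with the
    undifferentiated term to the derivative in the radius of a spherical integral of [f] alone. The
    mean value theorem in the radius then replaces every estimate of a derivative. The scalar
    results are proved at I^+ and carried to I^- by the substitution of [- x] for [x], which changes
    the sign of [z]. *)

Lemma continuousT_comp (X Y Z : topologicalType) (f : X -> Y) (g : Y -> Z) :
  continuous f -> continuous g -> continuous (fun x => g (f x)).
Proof. by move=> cf cg x; exact: (continuous_comp (cf x) (cg (f x))). Qed.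

Lemma continuousT_pair (X Y Z : topologicalType) (f : X -> Y) (g : X -> Z) :
  continuous f -> continuous g -> continuous (fun x => (f x, g x)).
Proof. by move=> cf cg x; apply: cvg_pair; [exact: cf|exact: cg]. Qed.

Lemma continuousT_fst (X Y : topologicalType) : continuous (fun q : X * Y => q.1).
Proof. by move=> q; exact: cvg_fst. Qed.

Lemma continuousT_snd (X Y : topologicalType) : continuous (fun q : X * Y => q.2).
Proof. by move=> q; exact: cvg_snd. Qed.

Lemma continuousT_id (X : topologicalType) : continuous (fun q : X => q).
Proof. by move=> q; exact: cvg_id. Qed.

Lemma continuousT_cst (X Y : topologicalType) (y : Y) : continuous (fun _ : X => y).
Proof. by move=> q; exact: cvg_cst. Qed.

Lemma continuous_section (U W X : topologicalType) (f : U -> W -> X) (u : U) :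
  continuous (fun q : U * W => f q.1 q.2) -> continuous (f u).
Proof.
move=> cf; apply: (@continuousT_comp _ _ _ (fun x => (u, x)) (fun q : U * W => f q.1 q.2)) => //.
by apply: continuousT_pair; [exact: continuousT_cst|exact: continuousT_id].
Qed.

(** * Integrals over a segment and their dependence on a parameter *)

Section IntervalIntegral.
Variables (R : realType) (a b : R).
Hypothesis ab : a < b.

Definition Int (f : R -> R) : R := (\int[lebesgue_measure]_(x in `[a, b]) f x)%R.

Lemma integrable_continuous (f : R -> R) : continuous f ->
  lebesgue_measure.-integrable `[a, b] (EFin \o f).
Proof.
move=> cf; apply: continuous_compact_integrable; first exact: segment_compact.
exact: continuous_subspaceT.
Qed.

Lemma eq_Int (f g : R -> R) : (forall x, f x = g x) -> Int f = Int g.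
Proof. by move=> fg; apply: eq_Rintegral => x _. Qed.

Lemma IntD (f g : R -> R) : continuous f -> continuous g ->
  Int (fun x => f x + g x) = Int f + Int g.
Proof. by move=> cf cg; rewrite /Int RintegralD//; exact: integrable_continuous. Qed.

Lemma IntZ (k : R) (f : R -> R) : continuous f -> Int (fun x => k * f x) = k * Int f.
Proof. by move=> cf; rewrite /Int RintegralZl//; exact: integrable_continuous. Qed.

Lemma IntB (f g : R -> R) : continuous f -> continuous g ->
  Int (fun x => f x - g x) = Int f - Int g.
Proof. by move=> cf cg; rewrite /Int RintegralB//; exact: integrable_continuous. Qed.

Lemma Int_cst (k : R) : Int (fun=> k) = k * (b - a).
Proof.
rewrite /Int Rintegral_cst//= lebesgue_measure_itv/= lte_fin ab.
by [].
Qed.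

Lemma normr_Int_le (f : R -> R) (M : R) : continuous f ->
  (forall x, a <= x <= b -> `|f x| <= M) -> `|Int f| <= M * (b - a).
Proof.
move=> cf fM; rewrite -Int_cst.
apply: (le_trans (le_normr_Rintegral _ _)) => //; first exact: integrable_continuous.
apply: le_Rintegral => //.
- apply: (@integrable_continuous (fun x => `|f x|)) => x.
  exact: (continuous_comp (cf x) (@norm_continuous _ _ _)).
- by apply: (@integrable_continuous (fun=> M)) => x; exact: cvg_cst.
Qed.

Lemma Int_derive (f df : R -> R) : (forall x : R, is_derive x (1 : R) f (df x)) ->
  continuous df -> Int df = f b - f a.
Proof.
move=> fdf cdf.
have cf : continuous f.
  by move=> x; apply: differentiable_continuous; apply/derivable1_diffP; apply: ex_derive.
rewrite /Int /Rintegral (@continuous_FTC2 _ df f)//.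
- exact: continuous_subspaceT.
- split.
  + by move=> x _; apply: ex_derive.
  + apply: cvg_at_right_filter; exact: cf.
  + apply: cvg_at_left_filter; exact: cf.
- by move=> x _; rewrite derive1E derive_val.
Qed.

(** The tube lemma: by compactness of the segment, neighbourhoods chosen for each [x] have a common
    neighbourhood of [u0]. *)
Lemma near_segment (U : topologicalType) (u0 : U) (P : U -> R -> Prop) :
  (forall x, a <= x <= b -> \forall q \near (u0, x), P q.1 q.2) ->
  \forall u \near u0, forall x, a <= x <= b -> P u x.
Proof.
move=> Pnear.
have /compact_near_coveringP/(_ U (nbhs u0) P _) := @segment_compact R a b.
move=> H.
have {}H : \near u0, `[a, b] `<=` P u0.
  apply: H => x /=; rewrite in_itv/= => /Pnear.
  move=> [[A B]/= [Au0 Bx] AB]; exists (B, A) => //= -[y u]/= [By Au].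
  exact: (AB (u, y)).
by apply: filterS H => u H x xab; apply: H; rewrite /= in_itv.
Qed.

(** Near each point [(u0, x)] both values are within [e / 2] of [f u0 x]; [near_segment] makes this
    uniform along the segment. *)
Lemma near_uniform (U : topologicalType) (f : U -> R -> R) u0 (e : R) :
  continuous (fun q : U * R => f q.1 q.2) -> 0 < e ->
  \forall u \near u0, forall x, a <= x <= b -> `|f u0 x - f u x| <= e.
Proof.
move=> cf e0; apply: near_segment => x _.
have /cvgrPdist_le/(_ (e / 2)) := cf (u0, x).
rewrite divr_gt0// => /(_ isT) H1.
have /cvgrPdist_le/(_ (e / 2)) := @continuous_section _ _ _ _ u0 cf x.
rewrite divr_gt0// => /(_ isT) H2.
near=> q.
have h1 : `|f u0 x - f q.1 q.2| <= e / 2 by near: q.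
have h2 : `|f u0 x - f u0 q.2| <= e / 2.
  near: q; exact: (@cvg_snd _ _ (nbhs u0) (nbhs x) _ _ H2).
rewrite (_ : f u0 q.2 - _ = (f u0 x - f q.1 q.2) - (f u0 x - f u0 q.2)); last by ring.
by rewrite (le_trans (ler_normB _ _))// (splitr e) lerD.
Unshelve. all: by end_near. Qed.

Lemma Int_param_continuous (U : topologicalType) (f : U -> R -> R) :
  continuous (fun q : U * R => f q.1 q.2) -> continuous (fun u => Int (f u)).
Proof.
move=> cf u0.
have cfu u : continuous (f u) by exact: continuous_section cf.
apply/cvgrPdist_le => /= e e0.
have d0 : 0 < e / (b - a) by rewrite divr_gt0// subr_gt0.
apply: filterS (near_uniform u0 cf d0) => u H.
rewrite -IntB//; apply: (le_trans (normr_Int_le _ H)).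
  by move=> x; apply: continuousB; exact: cfu.
by rewrite divfK// gt_eqF// subr_gt0.
Qed.

(** For each [x] the difference quotient is [df c x] with [c] between [s] and [h + s], and
    [near_uniform] brings it close to [df s x] for all [x] at once. *)
Lemma Int_param_derive (f df : R -> R -> R) :
  continuous (fun q : R * R => f q.1 q.2) ->
  continuous (fun q : R * R => df q.1 q.2) ->
  (forall s x : R, is_derive s (1 : R) (f ^~ x) (df s x)) ->
  forall s : R, is_derive s (1 : R) (fun s => Int (f s)) (Int (df s)).
Proof.
move=> cf cdf fdf s.
have sec (g : R -> R -> R) u : continuous (fun q : R * R => g q.1 q.2) -> continuous (g u).
  exact: continuous_section.
have H : h^-1 *: (Int (f (h *: (1 : R) + s)) - Int (f s)) @[h --> 0^'] --> Int (df s).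
  apply/cvgrPdist_le => /= e e0.
  have d0 : 0 < e / (b - a) by rewrite divr_gt0// subr_gt0.
  have := near_uniform s cdf d0.
  move=> /nbhs_ballP[r /= r0 rP].
  near=> h.
  have h0 : h != 0 by near: h; exact: nbhs_dnbhs_neq.
  have hr : `|h| < r.
    near: h; apply: dnbhs0_lt => //.
  rewrite -IntB; [|exact: sec cf|exact: sec cf].
  rewrite /GRing.scale /= mulr1.
  rewrite -IntZ; last by move=> x; apply: continuousB; exact: (sec f).
  rewrite -IntB; [|exact: sec cdf|]; last first.
    by move=> x; apply: cvgM; [exact: cvg_cst|apply: cvgB; exact: (sec f)].
  apply: (@le_trans _ _ (e / (b - a) * (b - a))); last by rewrite divfK// gt_eqF// subr_gt0.
  apply: normr_Int_le.
    move=> x; apply: cvgB; first exact: (sec df).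
    by apply: cvgM; [exact: cvg_cst|apply: cvgB; exact: (sec f)].
  move=> x xab.
  have cfx : continuous (f ^~ x).
    by move=> u; apply: differentiable_continuous; apply/derivable1_diffP; apply: ex_derive.
  have [c cb ->] : exists2 c, ball s r c & h^-1 * (f (h + s) x - f s x) = df c x.
    have [hp|hn] : 0 < h \/ h < 0 by apply/orP; rewrite orbC -neq_lt.
    - have [|c|c] := @MVT_segment R (f ^~ x) (df ^~ x) s (h + s) _ (fun c _ => fdf c x).
      + by rewrite lerDr ltW.
      + exact: continuous_subspaceT.
      + rewrite in_itv/= => /andP[c1 c2] ->; exists c; last by rewrite addrK mulrC mulfK.
        rewrite /ball/= ltr_norml; apply/andP; split; move: hr; rewrite ltr_norml => /andP[]; lra.
    - have [|c|c] := @MVT_segment R (f ^~ x) (df ^~ x) (h + s) s _ (fun c _ => fdf c x).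
      + by rewrite gerDr ltW.
      + exact: continuous_subspaceT.
      + rewrite in_itv/= => /andP[c1 c2] E; exists c.
          rewrite /ball/= ltr_norml; apply/andP; split; move: hr; rewrite ltr_norml => /andP[]; lra.
        have -> : f (h + s) x - f s x = df c x * h by rewrite -opprB E; ring.
        by rewrite mulrC mulfK.
  exact: rP.
have D : derivable (fun s => Int (f s)) s 1 by apply/cvg_ex; exists (Int (df s)).
by apply: DeriveDef => //; apply/cvg_lim.
Unshelve. all: by end_near. Qed.

End IntervalIntegral.

(** * Double integrals in spherical angles *)

Section SphereIntegral.
Variable R : realType.
Notation pi := (@pi R).

(** Integration over spherical angles. The area factor [sin th] is left to the integrand, where it
    kills the boundary terms at the poles. *)
Definition I2 (f : R -> R -> R) : R :=
  Int 0 pi (fun th => Int 0 (2 * pi) (f th)).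

Let pi0 : 0 < pi. Proof. exact: pi_gt0. Qed.
Let pi20 : 0 < 2 * pi. Proof. by rewrite mulr_gt0. Qed.

Definition continuous2 (f : R -> R -> R) := continuous (fun q : R * R => f q.1 q.2).

Lemma continuous_I2_inner (f : R -> R -> R) : continuous2 f ->
  continuous (fun th => Int 0 (2 * pi) (f th)).
Proof. exact: Int_param_continuous. Qed.

Lemma eq_I2 (f g : R -> R -> R) : (forall x y, f x y = g x y) -> I2 f = I2 g.
Proof. by move=> fg; apply: eq_Int => x; apply: eq_Int => y. Qed.

Lemma I2D (f g : R -> R -> R) : continuous2 f -> continuous2 g ->
  I2 (fun x y => f x y + g x y) = I2 f + I2 g.
Proof.
move=> cf cg; rewrite /I2 -IntD//; [|exact: continuous_I2_inner..].
by apply: eq_Int => x; rewrite IntD//; exact: continuous_section.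
Qed.

Lemma I2Z (k : R) (f : R -> R -> R) : continuous2 f ->
  I2 (fun x y => k * f x y) = k * I2 f.
Proof.
move=> cf; rewrite /I2 -IntZ//; last exact: continuous_I2_inner.
by apply: eq_Int => x; rewrite IntZ//; exact: continuous_section.
Qed.

Lemma normr_I2_le (f : R -> R -> R) (M : R) : continuous2 f ->
  (forall x y, `|f x y| <= M) -> `|I2 f| <= M * (2 * pi) * pi.
Proof.
move=> cf fM.
have H x : `|Int 0 (2 * pi) (f x)| <= M * (2 * pi).
  have /(_ M) := @normr_Int_le R 0 (2 * pi) pi20 (f x).
  by rewrite subr0; apply=> //; exact: continuous_section.
have /(_ (M * (2 * pi))) := @normr_Int_le R 0 pi pi0 (fun th => Int 0 (2 * pi) (f th)).
by rewrite subr0; apply=> //; exact: continuous_I2_inner.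
Qed.

Lemma I2_param_continuous (U : topologicalType) (f : U -> R -> R -> R) :
  continuous (fun q : U * R * R => f q.1.1 q.1.2 q.2) -> continuous (fun u => I2 (f u)).
Proof.
move=> cf; apply: Int_param_continuous => //.
exact: (@Int_param_continuous R 0 (2 * pi) pi20 (U * R)%type (fun q y => f q.1 q.2 y)).
Qed.

Lemma I2_param_derive (f df : R -> R -> R -> R) :
  continuous (fun q : R * R * R => f q.1.1 q.1.2 q.2) ->
  continuous (fun q : R * R * R => df q.1.1 q.1.2 q.2) ->
  (forall s x y : R, is_derive s (1 : R) (fun s => f s x y) (df s x y)) ->
  forall s : R, is_derive s (1 : R) (fun s => I2 (f s)) (I2 (df s)).
Proof.
move=> cf cdf fdf s.
have H (g : R -> R -> R -> R) (x : R) : continuous (fun q : R * R * R => g q.1.1 q.1.2 q.2) ->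
    continuous (fun q : R * R => g q.1 x q.2).
  move=> cg; apply: (@continuousT_comp _ _ _ (fun q : R * R => (q.1, x, q.2))
    (fun q : R * R * R => g q.1.1 q.1.2 q.2)) => //.
  apply: continuousT_pair; last exact: continuousT_snd.
  by apply: continuousT_pair; [exact: continuousT_fst|exact: continuousT_cst].
apply: (@Int_param_derive R 0 pi pi0 (fun s x => Int 0 (2 * pi) (f s x))
  (fun s x => Int 0 (2 * pi) (df s x))) => //.
- exact: (@Int_param_continuous R 0 (2 * pi) pi20 (R * R)%type (fun q y => f q.1 q.2 y)).
- exact: (@Int_param_continuous R 0 (2 * pi) pi20 (R * R)%type (fun q y => df q.1 q.2 y)).
- move=> u x; apply: (@Int_param_derive R 0 (2 * pi) pi20 (fun s => f s x) (fun s => df s x)).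
  + exact: H.
  + exact: H.
Qed.

(** With [I2_dphi] this is the divergence theorem on the sphere: the boundary terms vanish at the
    poles and cancel by periodicity in the azimuth. *)
Lemma I2_dtheta (P dP : R -> R -> R) : continuous2 P -> continuous2 dP ->
  (forall x y : R, is_derive x (1 : R) (P ^~ y) (dP x y)) ->
  (forall y, P 0 y = 0) -> (forall y, P pi y = 0) -> I2 dP = 0.
Proof.
move=> cP cdP dPP P0 Ppi.
have H (x : R) : is_derive x (1 : R) (fun th => Int 0 (2 * pi) (P th)) (Int 0 (2 * pi) (dP x)).
  by apply: (@Int_param_derive R 0 (2 * pi) pi20 P dP).
rewrite /I2 (Int_derive pi0 H (continuous_I2_inner cdP)).
rewrite (@eq_Int _ _ _ (P pi) (fun=> 0))// (@eq_Int _ _ _ (P 0) (fun=> 0))//.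
by rewrite subrr.
Qed.

Lemma I2_dphi (Q dQ : R -> R -> R) : continuous2 dQ ->
  (forall x y : R, is_derive y (1 : R) (Q x) (dQ x y)) ->
  (forall x, Q x (2 * pi) = Q x 0) -> I2 dQ = 0.
Proof.
move=> cdQ dQQ Qp.
rewrite /I2 (@eq_Int _ _ _ _ (fun=> 0)); first by rewrite Int_cst// mul0r.
by move=> x; rewrite (Int_derive pi20 (dQQ x) (continuous_section cdQ)) Qp subrr.
Qed.

Lemma I2_sin : I2 (fun th _ => sin th) = 4 * pi.
Proof.
rewrite /I2 (@eq_Int _ _ _ _ (fun th => 2 * pi * sin th)); last first.
  by move=> x; rewrite Int_cst// subr0 mulrC.
rewrite IntZ//; last exact: continuous_sin.
have H (x : R) : is_derive x (1 : R) (fun x => - cos x) (sin x).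
  by apply: is_derive_eq; rewrite opprK.
by rewrite (Int_derive pi0 H (@continuous_sin R)) cospi cos0; ring.
Qed.

End SphereIntegral.

(** * Partial derivatives: the chain rule along curves and the symmetry of second derivatives *)

Lemma cvg_sumr (R : realType) (T : Type) (F : set_system T) (I : finType)
    (f : I -> T -> R) (l : I -> R) : Filter F -> (forall i, f i @ F --> l i) ->
  (fun x => \sum_i f i x) @ F --> \sum_i l i.
Proof.
move=> FF fl; apply: (@cvg_big R I +%R 0 xpredT) => //.
exact: add_continuous.
Qed.

Section Calculus.
Variable R : realType.
Notation V := (V R).
Implicit Types (f g : V -> R) (x y v : V).
Lemma coordD x y a : coord (x + y) a = coord x a + coord y a.
Proof. by rewrite /coord mxE. Qed.
Lemma coordN x a : coord (- x) a = - coord x a.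
Proof. by rewrite /coord mxE. Qed.
Lemma coordB x y a : coord (x - y) a = coord x a - coord y a.
Proof. by rewrite coordD coordN. Qed.
Lemma coordZ (k : R) x a : coord (k *: x) a = k * coord x a.
Proof. by rewrite /coord mxE. Qed.
Lemma coord_evec (b a : 'I_5) : coord (evec R b) a = (a == b)%:R.
Proof. by rewrite /coord mxE eqxx. Qed.
Lemma coord_inj x y : (forall a, coord x a = coord y a) -> x = y.
Proof. by move=> xy; apply/rowP => a; exact: xy. Qed.

Lemma continuous_coord a : continuous (fun x => coord x a).
Proof. by move=> x; exact: coord_continuous. Qed.

Lemma continuous_box f x (e : R) : {for x, continuous f} -> 0 < e ->
  exists2 d, 0 < d & forall y, (forall a, `|coord y a - coord x a| < d) -> `|f y - f x| < e.
Proof.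
move=> /cvgrPdist_lt/(_ e) + e0 => /(_ e0)/nbhs_ballP[d /= d0 H]; exists d => // y yx.
rewrite distrC; apply: H; split => // i a /=.
by rewrite (ord1 i) /ball/= distrC; exact: yx.
Qed.

Lemma is_derive_line f x v (t : R) : derivable f (x + t *: v) v ->
  is_derive t (1 : R) (fun t : R => f (x + t *: v)) ('D_v f (x + t *: v)).
Proof.
move=> D.
have E : (fun h : R => h^-1 *: (f (x + (h *: (1 : R) + t) *: v) - f (x + t *: v))) =
         (fun h : R => h^-1 *: (f (h *: v + (x + t *: v)) - f (x + t *: v))).
  apply/funext => h; do 3 f_equal.
  by rewrite scalerDl addrCA /GRing.scale/= mulr1.
have D' : derivable (fun t : R => f (x + t *: v)) t (1 : R) by rewrite /derivable E.
by apply: DeriveDef => //; rewrite /derive E.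
Qed.

Lemma is_derive_translate f x c v : derivable f (x + c) v ->
  is_derive x v (fun x => f (x + c)) ('D_v f (x + c)).
Proof.
move=> D.
have E : (fun h : R => h^-1 *: (f (h *: v + x + c) - f (x + c))) =
         (fun h : R => h^-1 *: (f (h *: v + (x + c)) - f (x + c))).
  by apply/funext => h; rewrite addrA.
have D' : derivable (fun x => f (x + c)) x v by rewrite /derivable E.
by apply: DeriveDef => //; rewrite /derive E.
Qed.

Lemma mvt_dir f (a : 'I_5) x (d : R) : (forall y, derivable f y (evec R a)) ->
  exists2 t, `|t| <= `|d| & f (x + d *: evec R a) - f x = d * partial a f (x + t *: evec R a).
Proof.
move=> D.
have dl t : is_derive t (1 : R) (fun t : R => f (x + t *: evec R a)) (partial a f (x + t *: evec R a)).
  exact: is_derive_line.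
have cl : continuous (fun t : R => f (x + t *: evec R a)).
  by move=> t; apply: differentiable_continuous; apply/derivable1_diffP; apply: ex_derive.
have [d0|d0] := leP 0 d.
- have [c] := MVT_segment d0 (fun t _ => dl t) (continuous_subspaceT cl).
  rewrite in_itv/= => /andP[c0 cd]; rewrite scale0r addr0 subr0 mulrC => E.
  by exists c => //; rewrite !ger0_norm.
- have [c] := MVT_segment (ltW d0) (fun t _ => dl t) (continuous_subspaceT cl).
  rewrite in_itv/= => /andP[c0 cd]; rewrite scale0r addr0 sub0r => E.
  exists c; first by rewrite !ler0_norm ?lerN2// ltW.
  by rewrite -opprB E mulrN opprK mulrC.
Qed.

Definition C1 f := forall a, continuous (partial a f) /\ forall x, derivable f x (evec R a).

Fact pd_key : unit. Proof. exact: tt. Qed.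

(* Locked, since comparing distinct derivatives up to conversion unfolds limits. *)
Definition pd : 'I_5 -> (V -> R) -> V -> R := locked_with pd_key (@partial R).

Lemma pdE a f : pd a f = partial a f.
Proof. by rewrite /pd unlock. Qed.

Definition D1 f x v : R := \sum_(a < 5) coord v a * pd a f x.

(** The vertices of an axis-parallel path from [x] to [y], along which a difference of values of [f]
    telescopes into increments in one variable. *)
Let mix x y (k : nat) : V := \row_(a < 5) (if (a < k)%N then coord y a else coord x a).

Let mixS x y (k : 'I_5) :
  mix x y k.+1 = mix x y k + (coord y k - coord x k) *: evec R k.
Proof.
apply: coord_inj => a; rewrite coordD coordZ coord_evec /coord !mxE ltnS leq_eqVlt.
have [->|ak] := eqVneq a k; first by rewrite ltnn eqxx/= mulr1 addrC subrK.
by rewrite val_eqE (negbTE ak)/= mulr0 addr0.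
Qed.

(** Continuity of the partial derivatives suffices: the increment of [f] is split along [mix],
    [mvt_dir] turns each piece into a partial derivative at an intermediate point, and these points
    tend to [c s]. *)
Lemma derive_comp_curve f (c : R -> V) (dc : V) (s : R) : C1 f ->
  (forall a, is_derive s (1 : R) (fun s : R => coord (c s) a) (coord dc a)) ->
  is_derive s (1 : R) (fun s => f (c s)) (D1 f (c s) dc).
Proof.
move=> fC1 cdc.
have cc a : (fun s : R => coord (c s) a) @ s --> coord (c s) a.
  have D : derivable (fun s : R => coord (c s) a) s (1 : R) by apply: ex_derive.
  by apply: differentiable_continuous; exact/derivable1_diffP.
have /choice[/= xi] : forall q : R * 'I_5, exists t : R,
    `|t| <= `|coord (c q.1) q.2 - coord (c s) q.2| /\
    f (mix (c s) (c q.1) q.2.+1) - f (mix (c s) (c q.1) q.2) =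
    (coord (c q.1) q.2 - coord (c s) q.2) *
    partial q.2 f (mix (c s) (c q.1) q.2 + t *: evec R q.2).
  move=> [u k] /=; rewrite mixS.
  have [t t1 t2] := mvt_dir (mix (c s) (c u) k) (coord (c u) k - coord (c s) k) (fC1 k).2.
  by exists t.
move=> H.
have shift0 : (h *: (1 : R) + s) @[h --> (0 : R)^'] --> s.
  apply: cvg_within_filter.
  have : (h *: (1 : R) + s) @[h --> (0 : R)] --> 0 *: (1 : R) + s.
    by apply: cvgD; [apply: cvgZr_tmp; exact: cvg_id|exact: cvg_cst].
  by rewrite scale0r add0r.
have L : h^-1 *: (f (c (h *: (1 : R) + s)) - f (c s)) @[h --> (0 : R)^'] --> D1 f (c s) dc.
  have E h : h^-1 *: (f (c (h *: (1 : R) + s)) - f (c s)) = \sum_(k < 5)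
      (h^-1 *: (coord (c (h *: (1 : R) + s)) k - coord (c s) k)) * partial k f
        (mix (c s) (c (h *: (1 : R) + s)) k + xi (h *: (1 : R) + s, k) *: evec R k).
    set u := h *: (1 : R) + s.
    have -> : f (c u) - f (c s) = \sum_(k < 5) (f (mix (c s) (c u) k.+1) - f (mix (c s) (c u) k)).
      rewrite -(big_mkord xpredT (fun k => f (mix (c s) (c u) k.+1) - f (mix (c s) (c u) k))).
      rewrite telescope_sumr//; congr (f _ - f _); apply: coord_inj => a.
        by rewrite /coord !mxE ltn_ord.
      by rewrite /coord !mxE.
    rewrite scaler_sumr; apply: eq_bigr => k _.
    by rewrite (H (u, k)).2 /= scalerAl.
  rewrite (funext E) /D1.
  apply: cvg_sumr => k; rewrite pdE.
  apply: cvgM.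
    have D := cdc k; rewrite -(@derive_val _ _ _ _ _ _ _ D).
    exact: (@ex_derive _ _ _ _ _ _ _ D).
  apply/cvgrPdist_lt => /= e e0.
  have [d d0 fd] := continuous_box ((fC1 k).1 (c s)) e0.
  have : \forall h \near (0 : R)^', forall a, `|coord (c (h *: (1 : R) + s)) a - coord (c s) a| < d.
    apply: filter_forall => a.
    have /cvgrPdist_lt/(_ _ d0) := cvg_comp _ _ shift0 (cc a).
    by apply: filterS => h; rewrite distrC.
  apply: filterS => h hd; rewrite distrC; apply: fd => a.
  rewrite coordD coordZ coord_evec {1}/coord mxE.
  case: ifPn => [ak|_].
    have -> : a == k = false by apply/negP => /eqP E0; rewrite E0 ltnn in ak.
    by rewrite mulr0 addr0.
  have [->|_] := eqVneq a k; last by rewrite mulr0 addr0 subrr normr0.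
  rewrite mulr1 addrAC subrr add0r.
  exact: (le_lt_trans (H (_, k)).1 (hd k)).
have D : derivable (fun s => f (c s)) s (1 : R) by apply/cvg_ex; exists (D1 f (c s) dc).
by apply: DeriveDef => //; apply/cvg_lim.
Qed.

(* The second difference of [f] on a square of side [h] equals [h ^ 2] times
   either mixed derivative at some point of the square. *)
Lemma partialC f (a b : 'I_5) x : C1 f -> C1 (partial a f) -> C1 (partial b f) ->
  partial a (partial b f) x = partial b (partial a f) x.
Proof.
move=> fC faC fbC.
have AC (p q r : R) : p - q - r = p - r - q by ring.
have AB (p q r : R) : p - q = (r - q) - (r - p) by ring.
have sq (p q : 'I_5) (h : R) : C1 (partial p f) -> exists t u : R, [/\ `|t| <= `|h|, `|u| <= `|h| &
    f (x + h *: evec R p + h *: evec R q) - f (x + h *: evec R p) - f (x + h *: evec R q) + f x =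
    h * h * partial q (partial p f) (x + t *: evec R p + u *: evec R q)].
  move=> fpC.
  pose g y := f (y + h *: evec R q) - f y.
  have gd y : is_derive y (evec R p) g (partial p f (y + h *: evec R q) - partial p f y).
    have D1 := derivableP ((fC p).2 y).
    have D2 := is_derive_translate ((fC p).2 (y + h *: evec R q)).
    exact: is_deriveB.
  have [t th Et] := @mvt_dir g p x h (fun y => @ex_derive _ _ _ _ _ _ _ (gd y)).
  have [u uh Eu] := @mvt_dir (partial p f) q (x + t *: evec R p) h (fpC q).2.
  exists t, u; split => //.
  rewrite -mulrA -Eu -[RHS]/(h * (partial p f (x + t *: evec R p + h *: evec R q) - _)).
  have <- : partial p g (x + t *: evec R p) =
      partial p f (x + t *: evec R p + h *: evec R q) - partial p f (x + t *: evec R p).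
    exact: (@derive_val _ _ _ _ _ _ _ (gd _)).
  by rewrite -Et /g; ring.
apply/eqP; rewrite -subr_eq0 -normr_le0; apply/ler_addgt0Pr => e e0; rewrite add0r.
have e20 : 0 < e / 2 by rewrite divr_gt0.
have [d1 d10 H1] := continuous_box ((fbC a).1 x) e20.
have [d2 d20 H2] := continuous_box ((faC b).1 x) e20.
(* The point found by [sq] may move by [h] twice along one axis, and [h + h] has to stay below both
   radii. *)
pose h := Num.min d1 d2 / 4.
have h0 : 0 < h by rewrite divr_gt0// lt_min d10.
have hd1 : h + h < d1.
  have := ge_min d1 d1 d2; rewrite lexx/= /h; lra.
have hd2 : h + h < d2.
  have := ge_min d2 d1 d2; rewrite lexx orbT/= /h; lra.
have box (t u : R) (p q : 'I_5) c : `|t| <= `|h| -> `|u| <= `|h| ->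
    `|coord (x + t *: evec R p + u *: evec R q) c - coord x c| <= h + h.
  rewrite (gtr0_norm h0) => th uh.
  rewrite !coordD !coordZ !coord_evec [X in `|X|](_ : _ = t * (c == p)%:R + u * (c == q)%:R); last by ring.
  rewrite (le_trans (ler_normD _ _))// lerD//.
    by case: (c == p); rewrite ?mulr1 ?mulr0// normr0 ltW.
  by case: (c == q); rewrite ?mulr1 ?mulr0// normr0 ltW.
have [t1 [u1 [t1h u1h E1]]] := sq b a h fbC.
have [t2 [u2 [t2h u2h E2]]] := sq a b h faC.
have E : partial a (partial b f) (x + t1 *: evec R b + u1 *: evec R a) =
         partial b (partial a f) (x + t2 *: evec R a + u2 *: evec R b).
  apply: (@mulfI _ (h * h)); first by rewrite mulf_neq0// gt_eqF.
  rewrite (addrAC x (h *: evec R a)) in E2.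
  apply: (etrans (esym E1)); apply: (etrans _ E2).
  by congr (_ + f x); exact: AC.
have B1 := H1 _ (fun c => le_lt_trans (box _ _ b a c t1h u1h) hd1).
have B2 := H2 _ (fun c => le_lt_trans (box _ _ a b c t2h u2h) hd2).
rewrite E in B1.
set A := partial a (partial b f) x in B1 *; set B := partial b (partial a f) x in B2 *.
set C := partial b (partial a f) _ in B1 B2.
rewrite (AB A B C).
apply: (le_trans (ler_normB _ _)); rewrite (splitr e).
exact: (lerD (ltW B2) (ltW B1)).
Qed.

End Calculus.

(** * Closure properties of smooth functions *)

Section SmoothFunctions.
Variable R : realType.
Notation V := (V R).
Implicit Types (f g : V -> R) (x y v : V) (a b c : 'I_5).

Lemma is_derive_coord b a x : is_derive x (evec R a) (fun x => coord x b) ((a == b)%:R : R).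
Proof.
have E : (fun h : R => h^-1 *: (coord (h *: evec R a + x) b - coord x b)) @ (0 : R)^' -->
         ((a == b)%:R : R).
  apply: (@cvg_trans _ (((fun=> (a == b)%:R) : R -> R) @ (0 : R)^')); last exact: cvg_cst.
  apply: near_eq_cvg; near=> h.
  have h0 : h != 0 by near: h; exact: nbhs_dnbhs_neq.
  rewrite coordD coordZ coord_evec addrK eq_sym /GRing.scale/= mulrA mulVf//.
  by rewrite mul1r.
have D : derivable (fun x => coord x b) x (evec R a) by apply/cvg_ex; exists (a == b)%:R.
by apply: DeriveDef => //; apply/cvg_lim.
Unshelve. all: by end_near. Qed.

(** An inductive reformulation of [smooth]: the derivative of a product is a sum of products, so
    closure under products calls for an induction on the order, not on a list of directions. *)
Fixpoint Ck (n : nat) f : Prop :=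
  [/\ continuous f, forall a x, derivable f x (evec R a) &
      if n is m.+1 then forall a, Ck m (partial a f) else True].

Lemma smoothP f : smooth f <-> forall n, Ck n f.
Proof.
split=> [sf n|Cf l].
  have : forall l, Ck n (iter_partial l f); last by move=> /(_ [::]).
  elim: n => [|n IH] l; have [cl dl] := sf l; split => //.
  by move=> a; exact: (IH (a :: l)).
suff H n : Ck (n + size l)%N f -> Ck n (iter_partial l f) by have [] := H 0%N (Cf _).
elim: l n => [|a l IH] n /=; first by rewrite addn0.
by rewrite addnS -addSn => /IH[_ _]; apply.
Qed.

Lemma Ck_leq n m f : (m <= n)%N -> Ck n f -> Ck m f.
Proof.
elim: n m f => [|n IH] [|m] f //= mn [cf df pf]; split => // a.
exact: IH.
Qed.

Lemma CkD n f g : Ck n f -> Ck n g -> Ck n (fun x => f x + g x).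
Proof.
elim: n f g => [|n IH] f g [cf df pf] [cg dg pg]; split => //;
  try by [move=> x; exact: (cvgD (cf x) (cg x))|move=> a x; exact: derivableD].
move=> a; rewrite (_ : partial _ _ = fun x => partial a f x + partial a g x).
  exact: (IH _ _ (pf a) (pg a)).
by apply/funext => x; exact: deriveD.
Qed.

Lemma CkM n f g : Ck n f -> Ck n g -> Ck n (fun x => f x * g x).
Proof.
elim: n f g => [|n IH] f g Cf Cg; have [cf df pf] := Cf; have [cg dg pg] := Cg; split => //;
  try by [move=> x; exact: (cvgM (cf x) (cg x))|move=> a x; exact: derivableM].
move=> a; rewrite (_ : partial _ _ = fun x => f x * partial a g x + g x * partial a f x).
  exact: (CkD (IH _ _ (Ck_leq (leqnSn n) Cf) (pg a)) (IH _ _ (Ck_leq (leqnSn n) Cg) (pf a))).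
by apply/funext => x; exact: deriveM.
Qed.

Lemma Ck_cst n (k : R) : Ck n (fun=> k).
Proof.
elim: n k => [|n IH] k; split => //; try exact: continuousT_cst.
move=> a; rewrite (_ : partial _ _ = fun=> 0)//; apply/funext => x.
exact: derive_cst.
Qed.

Lemma smoothD f g : smooth f -> smooth g -> smooth (fun x => f x + g x).
Proof. by move=> /smoothP sf /smoothP sg; apply/smoothP => n; exact: CkD. Qed.

Lemma smoothM f g : smooth f -> smooth g -> smooth (fun x => f x * g x).
Proof. by move=> /smoothP sf /smoothP sg; apply/smoothP => n; exact: CkM. Qed.

Lemma smooth_cst (k : R) : smooth (fun _ : V => k).
Proof. by apply/smoothP => n; exact: Ck_cst. Qed.

Lemma smooth_coord b : smooth (fun x : V => coord x b).
Proof.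
apply/smoothP => -[|n]; split => //; try exact: continuous_coord;
  try by move=> a x; exact: (@ex_derive _ _ _ _ _ _ _ (is_derive_coord b a x)).
move=> a; rewrite (_ : partial _ _ = fun=> (a == b)%:R); first exact: Ck_cst.
by apply/funext => x; exact: (@derive_val _ _ _ _ _ _ _ (is_derive_coord b a x)).
Qed.

Lemma smoothZ (k : R) f : smooth f -> smooth (fun x => k * f x).
Proof. by move=> sf; apply: smoothM => //; exact: smooth_cst. Qed.

Lemma smoothN f : smooth f -> smooth (fun x => - f x).
Proof.
move=> sf; rewrite (_ : (fun x => - f x) = fun x => -1 * f x); first exact: smoothZ.
by apply/funext => x; rewrite mulN1r.
Qed.

Lemma smoothB f g : smooth f -> smooth g -> smooth (fun x => f x - g x).
Proof. by move=> sf sg; apply: smoothD => //; exact: smoothN. Qed.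

Lemma smooth_sum (I : Type) (r : seq I) (F : I -> V -> R) :
  (forall i, smooth (F i)) -> smooth (fun x => \sum_(i <- r) F i x).
Proof.
move=> sF; elim: r => [|i r IH].
  by under eq_fun do rewrite big_nil; exact: smooth_cst.
by under eq_fun do rewrite big_cons; exact: smoothD.
Qed.

Lemma smooth_partial f a : smooth f -> smooth (partial a f).
Proof. by move=> sf l; have := sf (rcons l a); rewrite /iter_partial foldr_rcons. Qed.

Lemma smooth_derivable f x a : smooth f -> derivable f x (evec R a).
Proof. by move=> sf; apply: (sf [::]).2. Qed.

Lemma smooth_continuous f : smooth f -> continuous f.
Proof. by move=> sf; exact: (sf [::]).1. Qed.

Lemma smooth_C1 f : smooth f -> C1 f.
Proof.
move=> sf a; split; first exact: smooth_continuous (smooth_partial _ sf).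
by move=> x; exact: smooth_derivable.
Qed.

Lemma is_derive_opp f a x : derivable f (- x) (evec R a) ->
  is_derive x (evec R a) (fun x => f (- x)) (- partial a f (- x)).
Proof.
move=> D.
have D0 : derivable f (- x + (0 : R) *: evec R a) (evec R a) by rewrite scale0r addr0.
have L := is_derive_line D0; rewrite scale0r addr0 in L.
have N : is_derive (0 : R) (1 : R) (fun t : R => - t) (- 1) by exact: is_deriveNid.
have C : is_derive (0 : R) (1 : R) ((fun t : R => f (- x + t *: evec R a)) \o (fun t : R => - t))
    (- partial a f (- x)).
  rewrite -[- partial a f (- x)]mulrN1.
  have L' : is_derive (- (0 : R)) (1 : R) (fun t : R => f (- x + t *: evec R a)) (partial a f (- x)).
    by rewrite oppr0.
  exact: is_derive1_comp.
have E : (fun h : R => h^-1 *: (f (- (h *: evec R a + x)) - f (- x))) =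
    (fun h : R => h^-1 *: (((fun t : R => f (- x + t *: evec R a)) \o (fun t : R => - t)) (h *: (1 : R) + 0)
      - ((fun t : R => f (- x + t *: evec R a)) \o (fun t : R => - t)) 0)).
  apply/funext => h /=; rewrite oppr0 scale0r !addr0; congr (_ *: (f _ - _)).
  by rewrite [h *: (1 : R)]mulr1 opprD scaleNr addrC.
have D' : derivable (fun x => f (- x)) x (evec R a).
  by rewrite /derivable E; exact: (@ex_derive _ _ _ _ _ _ _ C).
apply: DeriveDef => //; rewrite /derive E.
exact: (@derive_val _ _ _ _ _ _ _ C).
Qed.

Lemma smooth_opp f : smooth f -> smooth (fun x => f (- x)).
Proof.
move=> /smoothP sf; apply/smoothP => n; elim: n f sf => [|n IH] f sf;
  have [cf df _] := sf 0%N; split => //; try by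
  [apply: continuousT_comp => //; exact: opp_continuous
  |move=> a x; exact: (@ex_derive _ _ _ _ _ _ _ (is_derive_opp (df a (- x))))].
move=> a; rewrite (_ : partial _ _ = fun x => -1 * partial a f (- x)).
  apply: CkM; first exact: Ck_cst.
  by apply: IH => m; have [_ _ +] := sf m.+1; apply.
apply/funext => x; rewrite mulN1r.
exact: (@derive_val _ _ _ _ _ _ _ (is_derive_opp (df a (- x)))).
Qed.

Lemma smooth_pd f a : smooth f -> smooth (pd a f).
Proof. by rewrite pdE; exact: smooth_partial. Qed.

Lemma pdD f g a x : smooth f -> smooth g ->
  pd a (fun x => f x + g x) x = pd a f x + pd a g x.
Proof. by move=> sf sg; rewrite !pdE; apply: deriveD; exact: smooth_derivable. Qed.

Lemma pdM f g a x : smooth f -> smooth g ->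
  pd a (fun x => f x * g x) x = f x * pd a g x + g x * pd a f x.
Proof. by move=> sf sg; rewrite !pdE; apply: deriveM; exact: smooth_derivable. Qed.

Lemma pd_cst (k : R) a x : pd a (fun=> k) x = 0.
Proof. by rewrite pdE; exact: derive_cst. Qed.

Lemma pd_coord b a x : pd a (fun x => coord x b) x = (a == b)%:R.
Proof. by rewrite pdE; exact: (@derive_val _ _ _ _ _ _ _ (is_derive_coord b a x)). Qed.

Lemma pdC f a b x : smooth f -> pd a (pd b f) x = pd b (pd a f) x.
Proof.
by move=> sf; rewrite !pdE; apply: partialC; apply: smooth_C1 => //; exact: smooth_partial.
Qed.

Lemma pdZ (k : R) f a x : smooth f -> pd a (fun x => k * f x) x = k * pd a f x.
Proof. by move=> sf; rewrite pdM ?pd_cst ?mulr0 ?addr0//; exact: smooth_cst. Qed.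

Lemma pd_opp f a x : smooth f -> pd a (fun x => f (- x)) x = - pd a f (- x).
Proof.
move=> sf; rewrite !pdE.
exact: (@derive_val _ _ _ _ _ _ _ (is_derive_opp (smooth_derivable sf))).
Qed.

End SmoothFunctions.

Opaque smooth.

(** * The tangential gradient and the wave operator of dS_4 *)

Section TangentialDerivative.
Variable R : realType.
Notation V := (V R).
Implicit Types (f g : V -> R) (x y v : V) (a b c : 'I_5).

Lemma sum_delta (F : 'I_5 -> R) a : \sum_(c < 5) (c == a)%:R * F c = F a.
Proof.
rewrite (bigD1 a)//= eqxx mul1r big1 ?addr0// => c /negbTE->.
by rewrite mul0r.
Qed.

Lemma coord_row (F : 'I_5 -> R) a : coord (\row_b F b) a = F a.
Proof. by rewrite /coord mxE. Qed.

Lemma eta_sqr a : eta R a * eta R a = 1.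
Proof. by rewrite /eta; case: ifP; rewrite ?mulrNN mulr1. Qed.

Lemma eta_cases a : eta R a = 1 \/ eta R a = -1.
Proof. by rewrite /eta; case: ifP; [right|left]. Qed.

Opaque coord eta.

Lemma mdotE x y : mdot x y = \sum_(a < 5) coord x a * xlow y a.
Proof. by apply: eq_bigr => a _; rewrite /xlow; ring. Qed.

Lemma mdotC x y : mdot x y = mdot y x.
Proof. by apply: eq_bigr => a _; ring. Qed.

Lemma mdotDl x y v : mdot (x + y) v = mdot x v + mdot y v.
Proof. by rewrite -big_split; apply: eq_bigr => a _; rewrite coordD /=; ring. Qed.

Lemma mdotZl (k : R) x v : mdot (k *: x) v = k * mdot x v.
Proof. by rewrite mulr_sumr; apply: eq_bigr => a _; rewrite coordZ; ring. Qed.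

Lemma mdotDr x y v : mdot v (x + y) = mdot v x + mdot v y.
Proof. by rewrite mdotC mdotDl !(mdotC v). Qed.

Lemma mdotZr (k : R) x v : mdot v (k *: x) = k * mdot v x.
Proof. by rewrite mdotC mdotZl (mdotC v). Qed.

Lemma dS4_low x : dS4 x -> \sum_(a < 5) coord x a * xlow x a = 1.
Proof. by rewrite -mdotE. Qed.

Lemma dS4_opp x : dS4 x -> dS4 (- x).
Proof. by rewrite /dS4 /= -scaleN1r mdotZl mdotZr => ->; rewrite mulr1 mulrNN mulr1. Qed.

(** The ambient gradient contracted with [proj] (see [dl_pd]), written with the radial derivative so
    that it expands without sums over projections. *)
Definition dl a f : V -> R := fun x => pd a f x - xlow x a * D1 f x x.

Lemma smooth_low a : smooth (fun x => xlow x a).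
Proof. exact/smoothZ/smooth_coord. Qed.

Lemma smooth_D1 f : smooth f -> smooth (fun x => D1 f x x).
Proof.
move=> sf; apply: smooth_sum => a; apply: smoothM; first exact: smooth_coord.
exact: smooth_pd.
Qed.

Lemma smooth_dl a f : smooth f -> smooth (dl a f).
Proof.
move=> sf; apply: smoothB; first exact: smooth_pd.
by apply: smoothM; [exact: smooth_low|exact: smooth_D1].
Qed.

Lemma D1D f g x v : smooth f -> smooth g ->
  D1 (fun x => f x + g x) x v = D1 f x v + D1 g x v.
Proof.
move=> sf sg; rewrite -big_split; apply: eq_bigr => a _.
by rewrite pdD ?mulrDr.
Qed.

Lemma D1M f g x v : smooth f -> smooth g ->
  D1 (fun x => f x * g x) x v = f x * D1 g x v + g x * D1 f x v.
Proof.
move=> sf sg; rewrite !mulr_sumr -big_split /=; apply: eq_bigr => a _.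
by rewrite pdM; [ring|..].
Qed.

Lemma dlD a f g x : smooth f -> smooth g ->
  dl a (fun x => f x + g x) x = dl a f x + dl a g x.
Proof.
by move=> sf sg; rewrite /dl D1D// pdD//; ring.
Qed.

Lemma dlM a f g x : smooth f -> smooth g ->
  dl a (fun x => f x * g x) x = f x * dl a g x + g x * dl a f x.
Proof.
by move=> sf sg; rewrite /dl D1M// pdM//; ring.
Qed.

Lemma dl_cst a (k : R) x : dl a (fun=> k) x = 0.
Proof.
rewrite /dl /D1 big1 ?pd_cst ?mulr0 ?subr0// => c _.
by rewrite pd_cst mulr0.
Qed.

Lemma dlZ a (k : R) f x : smooth f -> dl a (fun x => k * f x) x = k * dl a f x.
Proof.
by move=> sf; rewrite dlM; [rewrite dl_cst mulr0 addr0|exact: smooth_cst|exact: sf].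
Qed.

Lemma dlN a f x : smooth f -> dl a (fun x => - f x) x = - dl a f x.
Proof.
move=> sf; rewrite -mulN1r -dlZ//; congr (dl a _ x).
by apply/funext => y; rewrite mulN1r.
Qed.
Lemma dl_sum a (I : Type) (r : seq I) (F : I -> V -> R) x : (forall i, smooth (F i)) ->
  dl a (fun x => \sum_(i <- r) F i x) x = \sum_(i <- r) dl a (F i) x.
Proof.
move=> sF; elim: r => [|i r IH].
  by under eq_fun do rewrite big_nil; rewrite big_nil dl_cst.
under eq_fun do rewrite big_cons.
by rewrite dlD; [rewrite big_cons IH|exact: sF|exact: smooth_sum].
Qed.

Lemma dl_coord a b x : dl a (fun x => coord x b) x = proj x a b.
Proof.
rewrite /dl /D1 pd_coord /proj; congr (_ - _ * _).
under eq_bigr do rewrite pd_coord mulrC.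
exact: (sum_delta (coord x)).
Qed.

Lemma dl_low a b x : dl a (fun x => xlow x b) x = (a == b)%:R * eta R b - xlow x a * xlow x b.
Proof. by rewrite dlZ ?dl_coord; [rewrite /proj /xlow; ring|exact: smooth_coord]. Qed.

Lemma sum_coord_dl f x : dS4 x -> \sum_(a < 5) coord x a * dl a f x = 0.
Proof.
move=> xdS; under eq_bigr do rewrite mulrBr mulrA.
by rewrite sumrB -mulr_suml dS4_low// mul1r subrr.
Qed.
Lemma dl_D1 a f x : dl a f x = D1 f x (\row_b proj x a b).
Proof.
rewrite /dl /D1 [RHS](eq_bigr (fun b => (b == a)%:R * pd b f x -
  xlow x a * (coord x b * pd b f x))); last first.
  by move=> b _; rewrite coord_row /proj eq_sym; ring.
by rewrite sumrB sum_delta mulr_sumr.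
Qed.

Lemma mdot_proj a x : dS4 x -> mdot x (\row_b proj x a b) = 0.
Proof.
move=> xdS; rewrite mdotC mdotE.
rewrite (eq_bigr (fun b => (b == a)%:R * xlow x b - xlow x a * (coord x b * xlow x b))).
  by rewrite sumrB sum_delta -mulr_sumr dS4_low// mulr1 subrr.
by move=> b _; rewrite coord_row /proj eq_sym; ring.
Qed.

(* The curve is the inverse stereographic projection of a line, which
   parametrizes a conic in the hyperboloid without square roots. *)
Lemma D1_eq0 g x v : smooth g -> (forall y, dS4 y -> g y = 0) -> dS4 x -> mdot x v = 0 ->
  D1 g x v = 0.
Proof.
move=> sg g0 xdS xv.
(* With [mdot v v = 4 * m] the identity (1 - m s^2)^2 + 4 m s^2 = (1 + m s^2)^2 keeps the curve on
   dS_4, whatever the causal type of [v]. *)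
pose m := mdot v v / 4.
pose q (s : R) := 1 + m * (s * s).
pose c (s : R) : V := ((q s)^-1 * (1 - m * (s * s))) *: x + ((q s)^-1 * s) *: v.
have q0 : q 0 = 1 by rewrite /q !mulr0 addr0.
have dq : is_derive (0 : R) (1 : R) q 0.
  by apply: is_derive_eq; rewrite /GRing.scale/=; ring.
have dqV : is_derive (0 : R) (1 : R) (fun s => (q s)^-1) 0.
  have qn0 : q 0 != 0 by rewrite q0 oner_neq0.
  have D : derivable q 0 (1 : R) by exact: (@ex_derive _ _ _ _ _ _ _ dq).
  apply: DeriveDef; first exact: derivableV.
  by rewrite (deriveV qn0 D) (@derive_val _ _ _ _ _ _ _ dq) scaler0.
have dc a : is_derive (0 : R) (1 : R) (fun s => coord (c s) a) (coord v a).
  have -> : (fun s => coord (c s) a) = fun s => (q s)^-1 * ((1 - m * (s * s)) * coord x a + s * coord v a).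
    by apply/funext => s; rewrite /c coordD !coordZ; ring.
  apply: is_derive_eq; rewrite /GRing.scale/= q0 invr1; ring.
have c0 : c 0 = x by rewrite /c q0 !mulr0 subr0 invr1 mulr1 scale1r scale0r addr0.
have D := derive_comp_curve (smooth_C1 sg) dc.
rewrite c0 in D; rewrite -(@derive_val _ _ _ _ _ _ _ D).
have qnear : \forall s \near (0 : R), q s != 0.
  have cq : {for 0, continuous q}.
    apply: differentiable_continuous; apply/derivable1_diffP.
    exact: (@ex_derive _ _ _ _ _ _ _ dq).
  have /cvgrPdist_lt/(_ _ ltr01) := cq.
  rewrite q0; apply: filterS => s; apply: contraTneq => ->.
  by rewrite subr0 normr1 ltxx.
rewrite (@near_eq_derive _ _ _ _ (cst 0)) ?derive_cst//.
apply: filterS qnear => s qs; apply: g0.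
rewrite /dS4/= /c !(mdotDl, mdotDr, mdotZl, mdotZr) (mdotC v) xv xdS.
have E : mdot v v = 4 * m by rewrite /m; field.
rewrite E; move: qs; rewrite /q => qs; field.
by [].
Qed.

Lemma D1_eq f g x v : smooth f -> smooth g -> (forall y, dS4 y -> f y = g y) ->
  dS4 x -> mdot x v = 0 -> D1 f x v = D1 g x v.
Proof.
move=> sf sg fg xdS xv.
have /(_ x v) H := @D1_eq0 (fun x => f x - g x) _ _ (smoothB sf sg).
apply/eqP; rewrite -subr_eq0 -H//; last by move=> y ydS; rewrite fg// subrr.
rewrite D1D; [|exact: sf|exact: smoothN].
rewrite -sumrN; apply/eqP; congr (_ + _); apply: eq_bigr => a _.
rewrite (_ : (fun x => - g x) = fun x => -1 * g x); last by apply/funext => y; rewrite mulN1r.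
by rewrite pdZ// mulN1r mulrN.
Qed.

(** This lets relations that hold on dS_4 only, such as antisymmetry, tangency and the field
    equations, be differentiated. *)
Lemma dl_eq a f g x : smooth f -> smooth g -> (forall y, dS4 y -> f y = g y) ->
  dS4 x -> dl a f x = dl a g x.
Proof. by move=> sf sg fg xdS; rewrite !dl_D1; apply: D1_eq => //; exact: mdot_proj. Qed.

Definition D2 f x u v : R :=
  \sum_(a < 5) \sum_(b < 5) coord u a * coord v b * pd a (pd b f) x.

Lemma pd_D1 a f x : smooth f ->
  pd a (fun x => D1 f x x) x = pd a f x + \sum_(c < 5) coord x c * pd a (pd c f) x.
Proof.
move=> sf; have pc c : smooth (pd c f) by exact: smooth_pd.
have sc c : smooth (fun x : V => coord x c) by exact: smooth_coord.
transitivity (\sum_(c < 5) pd a (fun x => coord x c * pd c f x) x).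
  rewrite /D1; elim: (index_enum _) => [|i r IH].
    by under eq_fun do rewrite big_nil; rewrite big_nil pd_cst.
  under eq_fun do rewrite big_cons.
  have s1 : smooth (fun x => coord x i * pd i f x) by exact: (smoothM (sc i) (pc i)).
  have s2 : smooth (fun x => \sum_(j <- r) coord x j * pd j f x).
    by apply: smooth_sum => j; exact: (smoothM (sc j) (pc j)).
  by rewrite pdD; [rewrite big_cons IH|exact: s1|exact: s2].
rewrite (eq_bigr (fun c => (c == a)%:R * pd c f x + coord x c * pd a (pd c f) x)).
  by rewrite big_split/= sum_delta.
move=> c _; rewrite pdM; [|exact: sc|exact: pc].
by rewrite pd_coord eq_sym; ring.
Qed.

Lemma dl_dl a b f x : smooth f ->
  dl a (dl b f) x = pd a (pd b f) x - (a == b)%:R * eta R b * D1 f x x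
    - xlow x b * pd a f x
    - xlow x b * (\sum_(c < 5) coord x c * pd c (pd a f) x)
    - xlow x a * (\sum_(c < 5) coord x c * pd c (pd b f) x)
    + xlow x a * xlow x b * (2 * D1 f x x + D2 f x x x).
Proof.
move=> sf.
have pdl c : pd c (dl b f) x = pd c (pd b f) x - (c == b)%:R * eta R b * D1 f x x
    - xlow x b * pd c f x - xlow x b * (\sum_(d < 5) coord x d * pd d (pd c f) x).
  have sE := smooth_D1 sf; have sl := smooth_low b.
  have -> : dl b f = fun x => pd b f x + -1 * (xlow x b * D1 f x x).
    by apply/funext => y; rewrite mulN1r.
  have s1 : smooth (fun x => xlow x b * D1 f x x) by exact: smoothM.
  have s2 := smoothZ (-1) s1.
  rewrite pdD; [|exact: smooth_pd|exact: s2].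
  rewrite pdZ; last exact: s1.
  rewrite pdM; [|exact: sl|exact: sE].
  rewrite pd_D1; last exact: sf.
  rewrite pdZ; last exact: smooth_coord.
  rewrite pd_coord.
  have Es : \sum_(d < 5) coord x d * pd c (pd d f) x =
      \sum_(d < 5) coord x d * pd d (pd c f) x.
    by apply: eq_bigr => d _; rewrite pdC.
  by rewrite Es /xlow; ring.
have ED : D1 (dl b f) x x = (\sum_(c < 5) coord x c * pd c (pd b f) x)
    - eta R b * D1 f x x * coord x b - xlow x b * D1 f x x - xlow x b * D2 f x x x.
  rewrite /D1 (eq_bigr (fun c => coord x c * pd c (pd b f) x
    - (c == b)%:R * (eta R b * D1 f x x * coord x c)
    - xlow x b * (coord x c * pd c f x)
    - xlow x b * (\sum_(d < 5) coord x c * coord x d * pd c (pd d f) x))).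
    by rewrite !sumrB sum_delta -!mulr_sumr.
  move=> c _; have Es : \sum_(d < 5) coord x d * pd d (pd c f) x =
      \sum_(d < 5) coord x d * pd c (pd d f) x by apply: eq_bigr => d _; rewrite pdC.
  have Em : \sum_(d < 5) coord x c * coord x d * pd c (pd d f) x =
      coord x c * \sum_(d < 5) coord x d * pd c (pd d f) x.
    by rewrite mulr_sumr; apply: eq_bigr => d _; rewrite mulrA.
  by rewrite pdl Es Em; ring.
rewrite /dl -/(dl b f) ED pdl /xlow.
ring.
Qed.

(** The projected coordinate fields do not commute; their bracket comes from the derivative of the
    normal [x]. *)
Lemma dlC a b f x : smooth f ->
  dl a (dl b f) x = dl b (dl a f) x + xlow x a * dl b f x - xlow x b * dl a f x.
Proof.
move=> sf; rewrite !dl_dl// (@pdC _ f a b)// /dl (eq_sym b a).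
by case: eqVneq => [->|_] /=; ring.
Qed.

(** This is the d'Alembertian of dS_4: the divergence of the tangential gradient requires no further
    projection, because [coord x a * dl a] sums to 0. *)
Definition box f x : R := \sum_(a < 5) eta R a * dl a (dl a f) x.

(** The radial part of the ambient operator is split off; 4 is the tangential divergence of the
    position field. *)
Lemma boxE f x : smooth f -> dS4 x ->
  box f x = \sum_(a < 5) eta R a * pd a (pd a f) x - D2 f x x x - 4 * D1 f x x.
Proof.
move=> sf xdS.
rewrite /box (eq_bigr (fun a => eta R a * pd a (pd a f) x - D1 f x x
   - coord x a * pd a f x
   - 2 * (\sum_(c < 5) coord x a * coord x c * pd a (pd c f) x)
   + coord x a * xlow x a * (2 * D1 f x x + D2 f x x x))); last first.
  move=> a _; rewrite dl_dl// eqxx /=.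
  have -> : \sum_(c < 5) coord x a * coord x c * pd a (pd c f) x =
      coord x a * \sum_(c < 5) coord x c * pd c (pd a f) x.
    by rewrite mulr_sumr; apply: eq_bigr => c _; rewrite pdC// mulrA.
  rewrite /xlow.
  by case: (eta_cases a) => ->; ring.
rewrite big_split/= !sumrB -mulr_suml dS4_low// -mulr_sumr -/(D1 f x x) -/(D2 f x x x).
rewrite sumr_const card_ord -mulr_natl; ring.
Qed.

(** Conformally coupled scalars: 2 is one sixth of the scalar curvature 12 of dS_4. *)
Definition cs f := smooth f /\ forall x, dS4 x -> box f x = 2 * f x.

End TangentialDerivative.

(** * Syntax-directed proofs of continuity *)

Lemma cvg_vec (R : realType) (T : Type) (F : set_system T) (X : T -> V R) (x : V R) : Filter F ->
  (forall a, coord (X q) a @[q --> F] --> coord x a) -> X q @[q --> F] --> x.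
Proof.
move=> FF cX A /nbhs_ballP[e /= ep eA].
have : \forall q \near F, forall a, `|coord x a - coord (X q) a| < e.
  by apply: filter_forall => a; have /cvgrPdist_lt/(_ e ep) := cX a.
apply: filterS => q H; apply: eA; split => // i a; rewrite (ord1 i).
exact: H.
Qed.

Section ContinuityTools.
Variables (R : realType) (T : topologicalType).
Implicit Types (f g : T -> R).

Lemma ctD f g : continuous f -> continuous g -> continuous (fun x => f x + g x).
Proof. by move=> cf cg x; exact: (cvgD (cf x) (cg x)). Qed.

Lemma ctN f : continuous f -> continuous (fun x => - f x).
Proof. by move=> cf x; exact: (cvgN (cf x)). Qed.

Lemma ctM f g : continuous f -> continuous g -> continuous (fun x => f x * g x).
Proof. by move=> cf cg x; exact: (cvgM (cf x) (cg x)). Qed.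

Lemma ct_sum (I : finType) (F : I -> T -> R) : (forall i, continuous (F i)) ->
  continuous (fun x => \sum_i F i x).
Proof. by move=> cF x; apply: cvg_sumr => i; exact: cF. Qed.

Lemma ct_sin f : continuous f -> continuous (fun x => sin (f x)).
Proof. by move=> cf; apply: (continuousT_comp cf); exact: continuous_sin. Qed.

Lemma ct_cos f : continuous f -> continuous (fun x => cos (f x)).
Proof. by move=> cf; apply: (continuousT_comp cf); exact: continuous_cos. Qed.

Lemma ctV f : (forall x, f x != 0) -> continuous f -> continuous (fun x => (f x)^-1).
Proof. by move=> f0 cf x; exact: (cvgV (f0 x) (cf x)). Qed.

Lemma ct_vec (X : T -> V R) : (forall a, continuous (fun q => coord (X q) a)) -> continuous X.
Proof. by move=> cX q; apply: cvg_vec => a; exact: cX. Qed.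

Lemma ct_D1 (f : V R -> R) (X v : T -> V R) : smooth f ->
  (forall a, continuous (fun q => coord (X q) a)) ->
  (forall a, continuous (fun q => coord (v q) a)) ->
  continuous (fun q => D1 f (X q) (v q)).
Proof.
move=> sf cX cv; apply: ct_sum => a; apply: ctM; first exact: cv.
apply: (continuousT_comp (ct_vec cX)); exact: smooth_continuous (smooth_pd a sf).
Qed.

Lemma ct_smooth (f : V R -> R) (X : T -> V R) : smooth f ->
  (forall a, continuous (fun q => coord (X q) a)) -> continuous (fun q => f (X q)).
Proof. by move=> sf cX; apply: (continuousT_comp (ct_vec cX)); exact: smooth_continuous. Qed.

Lemma ct_D2 (f : V R -> R) (X u v : T -> V R) : smooth f ->
  (forall a, continuous (fun q => coord (X q) a)) ->
  (forall a, continuous (fun q => coord (u q) a)) ->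
  (forall a, continuous (fun q => coord (v q) a)) ->
  continuous (fun q => D2 f (X q) (u q) (v q)).
Proof.
move=> sf cX cu cv; apply: ct_sum => a; apply: ct_sum => b.
apply: ctM; first by apply: ctM.
apply: (continuousT_comp (ct_vec cX)).
exact: smooth_continuous (smooth_pd a (smooth_pd b sf)).
Qed.

Lemma ct_coordZ (k : T -> R) (X : T -> V R) a : continuous k ->
  continuous (fun q => coord (X q) a) -> continuous (fun q => coord (k q *: X q) a).
Proof. by move=> ck cX; under eq_fun do rewrite coordZ; exact: ctM. Qed.

Lemma ct_coordD (X Y : T -> V R) a : continuous (fun q => coord (X q) a) ->
  continuous (fun q => coord (Y q) a) -> continuous (fun q => coord (X q + Y q) a).
Proof. by move=> cX cY; under eq_fun do rewrite coordD; exact: ctD. Qed.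

Lemma ct_coordN (X : T -> V R) a : continuous (fun q => coord (X q) a) ->
  continuous (fun q => coord (- X q) a).
Proof. by move=> cX; under eq_fun do rewrite coordN; exact: ctN. Qed.

End ContinuityTools.

(** The most general pattern comes last; it takes an ambient function to be smooth, which [ct] then
    finds by [assumption]. *)
Ltac ct1 :=
  lazymatch goal with
  | |- forall _ : ordinal _, _ => intro
  | |- continuous (fun _ => ?c) => exact: continuousT_cst
  | |- continuous (fun q => q) => exact: continuousT_id
  | |- continuous (fun q => q.1) => exact: continuousT_fst
  | |- continuous (fun q => q.2) => exact: continuousT_snd
  | |- continuous (fun q => (@?X q).1) => apply: (@continuousT_comp _ _ _ X fst _ (@continuousT_fst _ _))
  | |- continuous (fun q => (@?X q).2) => apply: (@continuousT_comp _ _ _ X snd _ (@continuousT_snd _ _))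
  | |- continuous (fun q => D1 ?f (@?X q) (@?v q)) => apply: (@ct_D1 _ _ f X v)
  | |- continuous (fun q => D2 ?f (@?X q) (@?u q) (@?v q)) => apply: (@ct_D2 _ _ f X u v)
  | |- continuous (fun q => coord (@?X q + @?Y q) ?a) => apply: (@ct_coordD _ _ X Y)
  | |- continuous (fun q => coord (- @?X q) ?a) => apply: (@ct_coordN _ _ X)
  | |- continuous (fun q => coord (@?k q *: @?X q) ?a) => apply: (@ct_coordZ _ _ k X)
  | |- continuous (fun q => coord (@?X q) ?a) => apply: (@continuousT_comp _ _ _ X _ _ (@continuous_coord _ a))
  | |- continuous (fun q => @?f q + @?g q) => apply: (@ctD _ _ f g)
  | |- continuous (fun q => - @?f q) => apply: (@ctN _ _ f)
  | |- continuous (fun q => @?f q * @?g q) => apply: (@ctM _ _ f g)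
  | |- continuous (fun q => sin (@?f q)) => apply: (@ct_sin _ _ f)
  | |- continuous (fun q => cos (@?f q)) => apply: (@ct_cos _ _ f)
  | |- continuous (fun q => ?f (@?X q)) => apply: (@ct_smooth _ _ f X)
  end.
Ltac ct := repeat first [assumption | ct1].

(** * First and second derivatives as multilinear forms *)

Section Multilinear.
Variable R : realType.
Notation V := (V R).
Implicit Types (f : V -> R) (x y u v w p n : V) (k : R).

Lemma D1Dr f x u v : D1 f x (u + v) = D1 f x u + D1 f x v.
Proof. by rewrite -big_split; apply: eq_bigr => a _; rewrite coordD mulrDl. Qed.

Lemma D1Zr f x k v : D1 f x (k *: v) = k * D1 f x v.
Proof. by rewrite mulr_sumr; apply: eq_bigr => a _; rewrite coordZ mulrA. Qed.

Lemma D1Nr f x v : D1 f x (- v) = - D1 f x v.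
Proof. by rewrite -scaleN1r D1Zr mulN1r. Qed.

Lemma D2Dl f x u v w : D2 f x (u + v) w = D2 f x u w + D2 f x v w.
Proof.
rewrite -big_split; apply: eq_bigr => a _; rewrite -big_split; apply: eq_bigr => b _.
by rewrite coordD /= !mulrDl.
Qed.

Lemma D2Zl f x k v w : D2 f x (k *: v) w = k * D2 f x v w.
Proof.
rewrite mulr_sumr; apply: eq_bigr => a _; rewrite mulr_sumr; apply: eq_bigr => b _.
by rewrite coordZ !mulrA.
Qed.

Lemma D2C f x u v : smooth f -> D2 f x u v = D2 f x v u.
Proof.
move=> sf; rewrite /D2 exchange_big; apply: eq_bigr => a _; apply: eq_bigr => b _.
by rewrite pdC// (mulrC (coord u b)).
Qed.

Lemma D2Nl f x v w : D2 f x (- v) w = - D2 f x v w.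
Proof. by rewrite -scaleN1r D2Zl mulN1r. Qed.

Lemma D2Dr f x u v w : smooth f -> D2 f x w (u + v) = D2 f x w u + D2 f x w v.
Proof. by move=> sf; rewrite D2C// D2Dl !(D2C _ w). Qed.

Lemma D2Zr f x k v w : smooth f -> D2 f x w (k *: v) = k * D2 f x w v.
Proof. by move=> sf; rewrite D2C// D2Zl (D2C _ w). Qed.

Lemma D2Nr f x v w : smooth f -> D2 f x w (- v) = - D2 f x w v.
Proof. by move=> sf; rewrite D2C// D2Nl (D2C _ w). Qed.

Lemma mdotNl u v : mdot (- u) v = - mdot u v.
Proof. by rewrite -scaleN1r mdotZl mulN1r. Qed.

Lemma mdotNr u v : mdot v (- u) = - mdot v u.
Proof. by rewrite -scaleN1r mdotZr mulN1r. Qed.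

Lemma is_derive_sumr (I : finType) (F : I -> R -> R) (dF : I -> R) (s : R) :
  (forall i, is_derive s (1 : R) (F i) (dF i)) ->
  is_derive s (1 : R) (fun s => \sum_i F i s) (\sum_i dF i).
Proof.
move=> FdF; elim: (index_enum I) => [|i r IH].
  by under eq_fun do rewrite big_nil; rewrite big_nil; exact: is_derive_cst.
by under eq_fun do rewrite big_cons; rewrite big_cons; exact: is_deriveD.
Qed.

Lemma is_derive_mul (f g : R -> R) (df dg s : R) : is_derive s (1 : R) f df ->
  is_derive s (1 : R) g dg -> is_derive s (1 : R) (fun s => f s * g s) (f s * dg + g s * df).
Proof. exact: is_deriveM. Qed.

Lemma is_derive_D1 f (c v : R -> V) (dc dv : V) (s : R) : smooth f ->
  (forall a, is_derive s (1 : R) (fun s => coord (c s) a) (coord dc a)) ->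
  (forall a, is_derive s (1 : R) (fun s => coord (v s) a) (coord dv a)) ->
  is_derive s (1 : R) (fun s => D1 f (c s) (v s)) (D2 f (c s) dc (v s) + D1 f (c s) dv).
Proof.
move=> sf cdc vdv.
have H a : is_derive s (1 : R) (fun s => coord (v s) a * pd a f (c s))
    (coord (v s) a * D1 (pd a f) (c s) dc + pd a f (c s) * coord dv a).
  exact: (is_derive_mul (vdv a) (derive_comp_curve (smooth_C1 (smooth_pd a sf)) cdc)).
have := is_derive_sumr H; rewrite big_split /=.
congr is_derive; congr (_ + _); last by apply: eq_bigr => a _; rewrite mulrC.
rewrite /D2 exchange_big; apply: eq_bigr => a _; rewrite mulr_sumr.
by apply: eq_bigr => b _; rewrite mulrA (mulrC (coord (v s) a)).
Qed.

End Multilinear.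

(** * Orthonormal frames of the ambient space *)

Section Frame.
Variable R : realType.
Notation V := (V R).

(** The field [frame_compl] resolves the inverse metric along the frame; it rewrites the ambient
    d'Alembertian as second derivatives in frame directions. *)
Record frame (p n0 e1 e2 e3 : V) : Prop := Frame {
  frame_dot : [/\ mdot p p = 1, mdot n0 n0 = -1, mdot e1 e1 = 1, mdot e2 e2 = 1 & mdot e3 e3 = 1];
  frame_orth_p : [/\ mdot p n0 = 0, mdot p e1 = 0, mdot p e2 = 0 & mdot p e3 = 0];
  frame_orth_n : [/\ mdot n0 e1 = 0, mdot n0 e2 = 0 & mdot n0 e3 = 0];
  frame_orth_e : [/\ mdot e1 e2 = 0, mdot e1 e3 = 0 & mdot e2 e3 = 0];
  frame_compl : forall a b : 'I_5, (a == b)%:R * eta R a =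
    coord p a * coord p b - coord n0 a * coord n0 b + coord e1 a * coord e1 b
      + coord e2 a * coord e2 b + coord e3 a * coord e3 b }.

Lemma frame_laplacian (f : V -> R) x p n0 e1 e2 e3 : frame p n0 e1 e2 e3 ->
  \sum_(a < 5) eta R a * pd a (pd a f) x =
  D2 f x p p - D2 f x n0 n0 + D2 f x e1 e1 + D2 f x e2 e2 + D2 f x e3 e3.
Proof.
case=> _ _ _ _ H.
rewrite /D2 -sumrB -!big_split; apply: eq_bigr => a _ /=.
rewrite -sumrB -!big_split /= -(sum_delta (fun b => eta R a * pd a (pd b f) x)).
apply: eq_bigr => b _.
by rewrite mulrA eq_sym H; ring.
Qed.

Lemma frameNn p n0 e1 e2 e3 : frame p n0 e1 e2 e3 -> frame p (- n0) e1 e2 e3.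
Proof.
case=> -[? ? ? ? ?] [pn ? ? ?] [n1 n2 n3] ? C; split => //.
- by split => //; rewrite mdotNl mdotNr opprK.
- by split => //; rewrite mdotNr pn oppr0.
- by split => //; rewrite mdotNl ?n1 ?n2 ?n3 oppr0.
- by move=> a b; rewrite C !coordN; ring.
Qed.

Lemma frameNe p n0 e1 e2 e3 : frame p n0 e1 e2 e3 -> frame p n0 (- e1) (- e2) (- e3).
Proof.
case=> -[? ? ? ? ?] [? p1 p2 p3] [n1 n2 n3] [? ? ?] C; split.
- by split => //; rewrite mdotNl mdotNr opprK.
- by split => //; rewrite mdotNr ?p1 ?p2 ?p3 oppr0.
- by split => //; rewrite mdotNr ?n1 ?n2 ?n3 oppr0.
- by split => //; rewrite mdotNr mdotNl opprK.
- by move=> a b; rewrite C !coordN; ring.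
Qed.

Lemma frameNp p n0 e1 e2 e3 : frame p n0 e1 e2 e3 -> frame (- p) n0 e1 e2 e3.
Proof.
case=> -[? ? ? ? ?] [pn p1 p2 p3] ? ? C; split => //.
- by split => //; rewrite mdotNl mdotNr opprK.
- by split => //; rewrite mdotNl ?pn ?p1 ?p2 ?p3 oppr0.
- by move=> a b; rewrite C !coordN; ring.
Qed.

(** A boost in the plane of [p] and [n0], with [t] and [s] as hyperbolic sine and cosine. From a
    frame at [w] in S^3 with [n0] equal to [e0] it yields a frame at the point over [w] at time
    [t]. *)
Lemma frame_boost p n0 e1 e2 e3 (t s : R) : frame p n0 e1 e2 e3 -> s * s = 1 + t * t ->
  frame (t *: n0 + s *: p) (s *: n0 + t *: p) e1 e2 e3.
Proof.
case=> -[pp nn ? ? ?] [pn p1 p2 p3] [n1 n2 n3] ? C ts.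
have np := pn; rewrite mdotC in np.
split => //.
- by split => //; rewrite !(mdotDl, mdotDr, mdotZl, mdotZr) pp nn pn np; lra.
- by split; rewrite !(mdotDl, mdotDr, mdotZl, mdotZr) ?pp ?nn ?pn ?np ?n1 ?n2 ?n3 ?p1 ?p2 ?p3; ring.
- by split; rewrite !(mdotDl, mdotDr, mdotZl, mdotZr) ?n1 ?n2 ?n3 ?p1 ?p2 ?p3; ring.
- move=> a b; rewrite C !(coordD, coordZ).
  transitivity ((s * s - t * t) * (coord p a * coord p b - coord n0 a * coord n0 b)
    + coord e1 a * coord e1 b + coord e2 a * coord e2 b + coord e3 a * coord e3 b); last by ring.
  by rewrite ts addrK mul1r addrC; ring.
Qed.

Definition sphere_n (e1 e2 e3 : V) (th ph : R) : V :=
  (sin th * cos ph) *: e1 + (sin th * sin ph) *: e2 + cos th *: e3.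
Definition sphere_th (e1 e2 e3 : V) (th ph : R) : V :=
  (cos th * cos ph) *: e1 + (cos th * sin ph) *: e2 - sin th *: e3.
Definition sphere_ph (e1 e2 : V) (ph : R) : V :=
  (- sin ph) *: e1 + cos ph *: e2.

End Frame.

(** * Kirchhoff's formula on light cones *)

Section Kirchhoff.
Variables (R : realType) (f : V R -> R) (p n0 e1 e2 e3 : V R).
Hypotheses (csf : cs f) (fr : frame p n0 e1 e2 e3).
Notation V := (V R).
Notation pi := (@pi R).
Notation n := (sphere_n e1 e2 e3).
Notation nt := (sphere_th e1 e2 e3).
Notation np := (sphere_ph e1 e2).

Let sf : smooth f. Proof. by case: csf. Qed.

Let trig (x : R) : cos x * cos x + sin x * sin x = 1.
Proof. by have := cos2Dsin2 x; rewrite !expr2. Qed.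

(** Light rays of dS_4 are straight lines of the ambient space, since [n - n0] is null and
    orthogonal to [p]. *)
Definition cone (l th ph : R) : V := p + l *: (n th ph - n0).

(** The other null normal of the sphere of parameter [l]: tangent to dS_4 at [cone l th ph],
    orthogonal to the sphere, and of product 2 with the ray direction [n - n0]. *)
Definition cone_tr (l th ph : R) : V :=
  (1 - l * l) *: n th ph + (1 + l * l) *: n0 - (2 * l) *: p.

(** The spherical integrand in Kirchhoff's formula, normalized to become [sin th * f p] at the
    vertex [l = 0]. *)
Definition kir (l th ph : R) : R := sin th *
  ((1 - l * l) * f (cone l th ph) + l * D1 f (cone l th ph) (cone_tr l th ph)).

Lemma mdot_sphere_n th ph :
  [/\ mdot (n th ph) (n th ph) = 1, mdot p (n th ph) = 0 & mdot n0 (n th ph) = 0].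
Proof.
case: fr => -[_ _ e11 e22 e33] [_ p1 p2 p3] [n1 n2 n3] [e12 e13 e23] _.
have e21 := e12; have e31 := e13; have e32 := e23.
rewrite mdotC in e21; rewrite mdotC in e31; rewrite mdotC in e32.
rewrite /sphere_n !(mdotDl, mdotDr, mdotZl, mdotZr) p1 p2 p3 n1 n2 n3
  e11 e22 e33 e12 e13 e23 e21 e31 e32; split; [|by ring..].
have ct := trig th; have cp := trig ph.
move: (cos th) (sin th) (cos ph) (sin ph) ct cp => C S c s ct cp.
transitivity (S * S * (c * c + s * s) + C * C); first by ring.
by rewrite cp mulr1 addrC ct.
Qed.

Lemma dS4_cone l th ph : dS4 (cone l th ph).
Proof.
have [nn pn n0n] := mdot_sphere_n th ph.
case: fr => -[pp n0n0 _ _ _] [pn0 _ _ _] _ _ _.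
rewrite /dS4/= /cone; move: (n th ph) nn pn n0n => v nn pn n0n.
rewrite !(mdotDl, mdotDr, mdotZl, mdotZr, mdotNl, mdotNr).
rewrite (mdotC n0 p) (mdotC v p) (mdotC v n0) nn pn n0n pp n0n0 pn0.
ring.
Qed.

Lemma D2_rotation x th ph : D2 f x e1 e1 + D2 f x e2 e2 + D2 f x e3 e3 =
  D2 f x (n th ph) (n th ph) + D2 f x (nt th ph) (nt th ph) + D2 f x (np ph) (np ph).
Proof.
rewrite /sphere_n /sphere_th /sphere_ph.
rewrite !(D2Dl, D2Zl, D2Nl) !(D2Dr, D2Zr, D2Nr)//.
rewrite (D2C _ e2 e1)// (D2C _ e3 e1)// (D2C _ e3 e2)//.
have ct := trig th; have cp := trig ph.
move: (cos th) (sin th) (cos ph) (sin ph) ct cp => C S c s ct cp.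
move: (D2 f x e1 e1) (D2 f x e2 e2) (D2 f x e3 e3) (D2 f x e1 e2) (D2 f x e1 e3) (D2 f x e2 e3).
move=> x11 x22 x33 x12 x13 x23.
transitivity (x11 * (c * c * (C * C + S * S) + s * s) + x22 * (s * s * (C * C + S * S) + c * c)
  + x33 * (C * C + S * S) + x12 * (2 * c * s * ((C * C + S * S) - 1))); last by ring.
by rewrite ct subrr !mulr1 (addrC (s * s)) cp; ring.
Qed.

Let dphi_np ph : V := (- cos ph) *: e1 - sin ph *: e2.

Lemma dphi_npE x th ph :
  D1 f x (dphi_np ph) = - (sin th * D1 f x (n th ph) + cos th * D1 f x (nt th ph)).
Proof.
rewrite /dphi_np /sphere_n /sphere_th !(D1Dr, D1Zr, D1Nr).
have ct := trig th.
move: (cos th) (sin th) (cos ph) (sin ph) ct => C S c s ct.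
move: (D1 f x e1) (D1 f x e2) (D1 f x e3) => a b d.
transitivity (- ((C * C + S * S) * (c * a + s * b))); last by ring.
by rewrite ct; ring.
Qed.

(* [dkir], [dP] and [dQ] are the derivatives of [kir], [P] and [Q] in [l], [th] and [ph];
   the conformal wave equation turns the second derivative of [f] in the two null
   directions, which occurs in [dkir], into those in the directions [nt] and [np]. *)
Let dkir (l th ph : R) : R := sin th * (- (2 * l) * f (cone l th ph)
  + (1 - l * l) * D1 f (cone l th ph) (n th ph - n0)
  + D1 f (cone l th ph) (cone_tr l th ph)
  + l * (D2 f (cone l th ph) (n th ph - n0) (cone_tr l th ph)
    + D1 f (cone l th ph) (- (2 * l) *: n th ph + (2 * l) *: n0 - 2 *: p))).
Let P (l th ph : R) : R := sin th * D1 f (cone l th ph) (nt th ph).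
Let dP (l th ph : R) : R := sin th * (D2 f (cone l th ph) (l *: nt th ph) (nt th ph)
  + D1 f (cone l th ph) (- n th ph)) + cos th * D1 f (cone l th ph) (nt th ph).
Let Q (l th ph : R) : R := D1 f (cone l th ph) (np ph).
Let dQ (l th ph : R) : R := D2 f (cone l th ph) ((l * sin th) *: np ph) (np ph)
  + D1 f (cone l th ph) (dphi_np ph).

Lemma kir_identity (l th ph : R) : dkir l th ph + dP l th ph + dQ l th ph = 0.
Proof.
rewrite /dkir /dP /dQ; set x := cone l th ph.
have := csf.2 x (dS4_cone l th ph); rewrite boxE//; last exact: dS4_cone.
rewrite (frame_laplacian _ _ fr).
(* After [boxE] the point [x] is both base point and direction of differentiation; only the
   direction is expanded in [p], [v] and [n0]. *)
have E : forall y v, y = p + l *: (v - n0) -> D2 f x y y = D2 f x p p + 2 * l * (D2 f x p v - D2 f x p n0)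
    + l * l * (D2 f x v v - 2 * D2 f x v n0 + D2 f x n0 n0) /\ D1 f x y =
    D1 f x p + l * (D1 f x v - D1 f x n0).
  move=> y v ->; split; last by rewrite !(D1Dr, D1Zr, D1Nr).
  rewrite !(D2Dl, D2Zl, D2Nl) !(D2Dr, D2Zr, D2Nr)//.
  by rewrite (D2C _ n0 p)// (D2C _ v p)// (D2C _ n0 v)//; ring.
have [-> ->] := E x (n th ph) erefl.
have := D2_rotation x th ph.
rewrite (dphi_npE x th) /cone_tr; clearbody x.
move: (n th ph) (nt th ph) (np ph) (sin th) (cos th) => v a b S C.
rewrite !(D1Dr, D1Zr, D1Nr) !(D2Dl, D2Zl, D2Nl) !(D2Dr, D2Zr, D2Nr)//.
rewrite (D2C _ n0 p)// (D2C _ v p)// (D2C _ n0 v)//.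
move: (D2 f x e1 e1) (D2 f x e2 e2) (D2 f x e3 e3) => q1 q2 q3.
move: (D2 f x v v) (D2 f x a a) (D2 f x b b) (D2 f x p p) (D2 f x n0 n0) (D2 f x p n0)
  (D2 f x p v) (D2 f x v n0) (D1 f x v) (D1 f x a) (D1 f x p) (D1 f x n0) (f x).
move=> vv aa bb pp nn pn pv vn v1 a1 p1 n1 F rot pde.
have {}pde : 2 * F = pp - nn + (q1 + q2 + q3) - (pp + 2 * l * (pv - pn) +
  l * l * (vv - 2 * vn + nn)) - 4 * (p1 + l * (v1 - n1)) by rewrite -pde; ring.
rewrite rot in pde.
transitivity (S * l * ((pp - nn + (vv + aa + bb) - (pp + 2 * l * (pv - pn) +
  l * l * (vv - 2 * vn + nn)) - 4 * (p1 + l * (v1 - n1))) - 2 * F)); first by ring.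
by rewrite -pde; ring.
Qed.

Let coord_n th ph a : coord (n th ph) a =
  sin th * cos ph * coord e1 a + sin th * sin ph * coord e2 a + cos th * coord e3 a.
Proof. by rewrite /sphere_n !(coordD, coordZ). Qed.
Let coord_nt th ph a : coord (nt th ph) a =
  cos th * cos ph * coord e1 a + cos th * sin ph * coord e2 a - sin th * coord e3 a.
Proof. by rewrite /sphere_th !(coordD, coordZ, coordN). Qed.
Let coord_np ph a : coord (np ph) a = - sin ph * coord e1 a + cos ph * coord e2 a.
Proof. by rewrite /sphere_ph !(coordD, coordZ). Qed.

Let coord_cone l th ph a :
  coord (cone l th ph) a = coord p a + l * coord (n th ph - n0) a.
Proof. by rewrite /cone; move: (n th ph) => v; rewrite !(coordD, coordZ). Qed.

(** By [kir_identity] the derivative in [l] of the integral is minus the integral of a divergence on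
    the sphere, so the integral keeps its value at the vertex. *)
Theorem kirchhoff l : I2 (kir l) = 4 * pi * f p.
Proof.
have ckir : continuous (fun q : R * R * R => kir q.1.1 q.1.2 q.2).
  rewrite /kir /cone /cone_tr /sphere_n; ct.
have cdkir : continuous (fun q : R * R * R => dkir q.1.1 q.1.2 q.2).
  rewrite /dkir /cone /cone_tr /sphere_n; ct.
have cP k : continuous2 (P k).
  rewrite /continuous2 /P /cone /sphere_th /sphere_n; ct.
have cdP k : continuous2 (dP k).
  rewrite /continuous2 /dP /cone /sphere_th /sphere_n; ct.
have cdQ k : continuous2 (dQ k).
  rewrite /continuous2 /dQ /cone /sphere_ph /dphi_np /sphere_n; ct.
have dcone (k th ph : R) a : is_derive k (1 : R) (fun k => coord (cone k th ph) a)
    (coord (n th ph - n0) a).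
  rewrite (_ : (fun k => _) = fun k => coord p a + k * coord (n th ph - n0) a).
    by apply: is_derive_eq; rewrite /GRing.scale/=; ring.
  by apply/funext => k'; rewrite coord_cone.
have dtr (k th ph : R) a : is_derive k (1 : R) (fun k => coord (cone_tr k th ph) a)
    (coord (- (2 * k) *: n th ph + (2 * k) *: n0 - 2 *: p) a).
  rewrite (_ : (fun k => _) = fun k => (1 - k * k) * coord (n th ph) a
      + (1 + k * k) * coord n0 a - 2 * k * coord p a).
    apply: is_derive_eq; rewrite /GRing.scale/=; move: (n th ph) => v.
    by rewrite !(coordD, coordZ, coordN); ring.
  by apply/funext => k'; rewrite /cone_tr; move: (n th ph) => v; rewrite !(coordD, coordZ, coordN).
have ddk (k th ph : R) : is_derive k (1 : R) (fun k => kir k th ph) (dkir k th ph).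
  have i1 := derive_comp_curve (smooth_C1 sf) (dcone k th ph).
  have i2 := is_derive_D1 sf (dcone k th ph) (dtr k th ph).
  by apply: is_derive_eq; rewrite /GRing.scale/= /dkir; ring.
have dn_th (k th ph : R) a : is_derive th (1 : R) (fun th => coord (cone k th ph) a)
    (coord (k *: nt th ph) a).
  rewrite (_ : (fun k => _) = fun th => coord p a + k * (sin th * cos ph * coord e1 a
      + sin th * sin ph * coord e2 a + cos th * coord e3 a - coord n0 a)).
    by apply: is_derive_eq; rewrite /GRing.scale/= coordZ coord_nt; ring.
  by apply/funext => k'; rewrite coord_cone coordB coord_n.
have dnt_th (th ph : R) a : is_derive th (1 : R) (fun th => coord (nt th ph) a)
    (coord (- n th ph) a).
  rewrite (_ : (fun k => _) = fun th => cos th * cos ph * coord e1 a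
      + cos th * sin ph * coord e2 a - sin th * coord e3 a).
    by apply: is_derive_eq; rewrite /GRing.scale/= coordN coord_n; ring.
  by apply/funext => k'; rewrite coord_nt.
have dn_ph (k th ph : R) a : is_derive ph (1 : R) (fun ph => coord (cone k th ph) a)
    (coord ((k * sin th) *: np ph) a).
  rewrite (_ : (fun k => _) = fun ph => coord p a + k * (sin th * cos ph * coord e1 a
      + sin th * sin ph * coord e2 a + cos th * coord e3 a - coord n0 a)).
    by apply: is_derive_eq; rewrite /GRing.scale/= coordZ coord_np; ring.
  by apply/funext => k'; rewrite coord_cone coordB coord_n.
have dnp_ph (ph : R) a : is_derive ph (1 : R) (fun ph => coord (np ph) a)
    (coord (dphi_np ph) a).
  rewrite (_ : (fun k => _) = fun ph => - sin ph * coord e1 a + cos ph * coord e2 a).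
    by apply: is_derive_eq; rewrite /GRing.scale/= coordB !coordZ; ring.
  by apply/funext => k'; rewrite coord_np.
have IP k : I2 (dP k) = 0.
  apply: (I2_dtheta (cP k) (cdP k)) => [th ph|ph|ph]; last 2 first.
  - by rewrite /P sin0 mul0r.
  - by rewrite /P sinpi mul0r.
  have i := is_derive_D1 sf (dn_th k th ph) (dnt_th th ph).
  by apply: is_derive_eq; rewrite /GRing.scale/= /dP; ring.
have IQ k : I2 (dQ k) = 0.
  apply: (@I2_dphi _ (Q k) (dQ k)) => // [th ph|th].
    exact: (is_derive_D1 sf (dn_ph k th ph) (dnp_ph ph)).
  by rewrite /Q /cone /sphere_n /sphere_ph !mulr_natl sin2pi cos2pi sin0 cos0.
have Idkir k : I2 (dkir k) = 0.
  rewrite (@eq_I2 _ _ (fun th ph => -1 * (dP k th ph + dQ k th ph))); last first.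
    move=> th ph; have H := kir_identity k th ph.
    by rewrite mulN1r; apply/eqP; rewrite -addr_eq0 addrA H.
  rewrite I2Z; last first.
    by apply: (@ctD _ _ (fun q => dP k q.1 q.2) (fun q => dQ k q.1 q.2)); [exact: cdP|exact: cdQ].
  by rewrite (I2D (cdP k) (cdQ k)) IP IQ addr0 mulr0.
have -> : I2 (kir l) = I2 (kir 0).
  apply: (@is_derive_0_is_cst _ (fun k => I2 (kir k))) => k; rewrite -(Idkir k).
  exact: (I2_param_derive ckir cdkir ddk).
rewrite (@eq_I2 _ _ (fun th _ => f p * sin th)).
  rewrite I2Z ?I2_sin; first by ring.
  by apply: ct_sin; exact: continuousT_fst.
move=> th ph; rewrite /kir mulr0 subr0 mul1r mul0r addr0 mulrC /cone.
by rewrite scale0r addr0.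
Qed.

End Kirchhoff.

(** * Explicit coordinates and a global frame on S^3 *)

Section SphereFrame.
Variable R : realType.
Notation V := (V R).

Definition o0 : 'I_5 := @Ordinal 5 0 isT.
Definition o1 : 'I_5 := @Ordinal 5 1 isT.
Definition o2 : 'I_5 := @Ordinal 5 2 isT.
Definition o3 : 'I_5 := @Ordinal 5 3 isT.
Definition o4 : 'I_5 := @Ordinal 5 4 isT.

Lemma ord0E : (ord0 : 'I_5) = o0.
Proof. exact: val_inj. Qed.

Lemma ord5P (P : 'I_5 -> Prop) : P o0 -> P o1 -> P o2 -> P o3 -> P o4 -> forall a, P a.
Proof.
move=> p0 p1 p2 p3 p4 [[|[|[|[|[|//]]]]] a5].
- by rewrite (_ : Ordinal a5 = o0)//; exact: val_inj.
- by rewrite (_ : Ordinal a5 = o1)//; exact: val_inj.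
- by rewrite (_ : Ordinal a5 = o2)//; exact: val_inj.
- by rewrite (_ : Ordinal a5 = o3)//; exact: val_inj.
- by rewrite (_ : Ordinal a5 = o4)//; exact: val_inj.
Qed.

Lemma sum5 (F : 'I_5 -> R) : \sum_(a < 5) F a = F o0 + F o1 + F o2 + F o3 + F o4.
Proof.
rewrite !big_ord_recl big_ord0 addr0 !addrA.
by congr (_ + _ + _ + _ + _); congr F; apply: val_inj.
Qed.

Lemma eta5 : [/\ eta R o0 = -1, eta R o1 = 1, eta R o2 = 1, eta R o3 = 1 & eta R o4 = 1].
Proof. by rewrite /eta. Qed.

Definition qvec (a b c d : R) : V := \row_(k < 5) nth 0 [:: 0; a; b; c; d] k.

Lemma coord_qvec a b c d : [/\ coord (qvec a b c d) o0 = 0, coord (qvec a b c d) o1 = a,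
  coord (qvec a b c d) o2 = b, coord (qvec a b c d) o3 = c & coord (qvec a b c d) o4 = d].
Proof. by rewrite /coord !mxE. Qed.

(* The products of the unit quaternion [w] with the imaginary units. *)
Definition quat1 (w : V) : V := qvec (- coord w o2) (coord w o1) (- coord w o4) (coord w o3).
Definition quat2 (w : V) : V := qvec (- coord w o3) (coord w o4) (coord w o1) (- coord w o2).
Definition quat3 (w : V) : V := qvec (- coord w o4) (- coord w o3) (coord w o2) (coord w o1).

Definition e0 : V := evec R ord0.

Lemma coord_e0 : [/\ coord e0 o0 = 1, coord e0 o1 = 0, coord e0 o2 = 0, coord e0 o3 = 0
  & coord e0 o4 = 0].
Proof. by rewrite /e0 !coord_evec. Qed.

Lemma S3E (w : V) : S3 w -> coord w o0 = 0 /\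
  coord w o1 * coord w o1 + coord w o2 * coord w o2 + coord w o3 * coord w o3
    + coord w o4 * coord w o4 = 1.
Proof.
case; rewrite ord0E => w0; rewrite sum5 w0 => <-; split => //; ring.
Qed.

Lemma mdot5 (x y : V) : mdot x y = - (coord x o0 * coord y o0) + coord x o1 * coord y o1
  + coord x o2 * coord y o2 + coord x o3 * coord y o3 + coord x o4 * coord y o4.
Proof. by rewrite /mdot sum5; have [-> -> -> -> ->] := eta5; ring. Qed.

Lemma mdot_S3 (w : V) : S3 w -> mdot w w = 1.
Proof. by move=> /S3E[w0 w1]; rewrite mdot5 w0 -w1; ring. Qed.

Lemma mdot_e0 (x : V) : mdot e0 x = - coord x o0.
Proof. by rewrite mdot5; have [-> -> -> -> ->] := coord_e0; ring. Qed.

(** Since S^3 is parallelizable, this frame depends continuously on [w] over the whole sphere, as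
    needed for the compactness argument in [uniform_decay]. *)
Lemma quat_frame (w : V) : S3 w -> frame w e0 (quat1 w) (quat2 w) (quat3 w).
Proof.
move=> wS; have [w0 w1] := S3E wS.
have [a0 a1 a2 a3 a4] := coord_qvec (- coord w o2) (coord w o1) (- coord w o4) (coord w o3).
have [b0 b1 b2 b3 b4] := coord_qvec (- coord w o3) (coord w o4) (coord w o1) (- coord w o2).
have [c0 c1 c2 c3 c4] := coord_qvec (- coord w o4) (- coord w o3) (coord w o2) (coord w o1).
have e00 := coord_e0; have [e1 e2 e3 e4 e5] := e00.
have [h0 h1 h2 h3 h4] := eta5.
split; rewrite /quat1 /quat2 /quat3.
- split; try by rewrite mdot5 ?(a0, a1, a2, a3, a4, b0, b1, b2, b3, b4, c0, c1, c2, c3, c4); lra.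
    exact: mdot_S3.
  by rewrite mdot_e0 e1.
- split; try by rewrite mdot5 ?(a0, a1, a2, a3, a4, b0, b1, b2, b3, b4, c0, c1, c2, c3, c4) ?w0; lra.
  by rewrite mdotC mdot_e0 w0 oppr0.
- by split; rewrite mdot_e0 ?a0 ?b0 ?c0 oppr0.
- by split; rewrite mdot5 ?(a0, a1, a2, a3, a4, b0, b1, b2, b3, b4, c0, c1, c2, c3, c4); lra.
- by apply: ord5P; apply: ord5P;
  rewrite ?(a0, a1, a2, a3, a4, b0, b1, b2, b3, b4, c0, c1, c2, c3, c4) ?w0 ?(e1, e2, e3, e4, e5)
    ?(h0, h1, h2, h3, h4) /=; lra.
Qed.

Lemma frame_S3 w e1 e2 e3 : frame w e0 e1 e2 e3 -> S3 w.
Proof.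
case=> -[ww _ _ _ _] [we _ _ _] _ _ _.
have w0 : coord w o0 = 0 by apply/eqP; rewrite -oppr_eq0 -mdot_e0 mdotC we.
by split; rewrite ?ord0E// -[RHS]ww mdot5 sum5 w0; ring.
Qed.

Lemma S3N (w : V) : S3 w -> S3 (- w).
Proof.
case=> w0 w1; split; first by rewrite coordN w0 oppr0.
by rewrite -w1; apply: eq_bigr => a _; rewrite coordN sqrrN.
Qed.

Lemma compact_S3 : compact (@S3 R).
Proof.
pose B : set V := [set v | forall i, (`[(-1 : R), 1]%classic) (v ord0 i)].
apply: (@subclosed_compact _ _ B).
- have -> : @S3 R = (fun w => coord w ord0) @^-1` [set x | x = 0] `&`
      (fun w : V => \sum_(a < 5) coord w a * coord w a) @^-1` [set x | x = 1].
    by rewrite predeqE => w; split.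
  have cs2 : continuous (fun w : V => \sum_(a < 5) coord w a * coord w a).
    by apply: ct_sum => a; apply: ctM; exact: continuous_coord.
  have cl (g : V -> R) (y : R) : continuous g -> closed (g @^-1` [set x | x = y]).
    by move=> cg; apply: (@preimage_closed V R g); [move=> w _; exact: cg|exact: closed_eq].
  exact: (closedI (cl _ 0 (@continuous_coord R ord0)) (cl _ 1 cs2)).
- by apply: (@rV_compact _ _ (fun=> `[(-1 : R), 1]%classic)) => _; exact: segment_compact.
- move=> w [_ w1] i /=; rewrite in_itv/= -ler_norml -ler_sqr ?nnegrE//.
  rewrite expr1n -[leRHS]w1 -normrX ger0_norm ?sqr_ge0// (bigD1 i)//= lerDl.
  by apply: sumr_ge0 => a _; exact: sqr_ge0.
Qed.

End SphereFrame.

(** * Limits of conformal scalars at I^+ *)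

Section Asymptotics.
Variables (R : realType) (f : V R -> R).
Hypothesis csf : cs f.
Notation V := (V R).
Notation pi := (@pi R).
Notation e0 := (e0 R).

Let sf : smooth f. Proof. by case: csf. Qed.

(** Kirchhoff's integrand on the sphere in which the past cone of the point over [w] meets the slice
    of time 0. It stays regular as the vertex goes to I^+, where [c = 0], [s = 1] and the sphere
    becomes the equator orthogonal to [w]. *)
Definition scri_kernel (c s : R) (w e1 e2 e3 : V) (th ph : R) : R :=
  sin th * (c * f (c *: w + s *: sphere_n e1 e2 e3 th ph)
    + s * D1 f (c *: w + s *: sphere_n e1 e2 e3 th ph)
        (c *: sphere_n e1 e2 e3 th ph + e0 - s *: w)).

Lemma continuous_scri_kernel (T : topologicalType) (c s : T -> R) (w e1 e2 e3 : T -> V) :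
  continuous c -> continuous s -> continuous w ->
  continuous e1 -> continuous e2 -> continuous e3 ->
  continuous (fun u => I2 (scri_kernel (c u) (s u) (w u) (e1 u) (e2 u) (e3 u))).
Proof.
move=> cc cs cw c1 c2 c3.
apply: (@I2_param_continuous R T (fun u => scri_kernel (c u) (s u) (w u) (e1 u) (e2 u) (e3 u))).
have proj1 (Y : topologicalType) (g : T -> Y) : continuous g -> continuous (fun q : T * R * R => g q.1.1).
  by move=> cg; apply: (@continuousT_comp _ _ _ (fun q : T * R * R => q.1.1) g) => //; ct.
have ? := proj1 _ _ cc; have ? := proj1 _ _ cs; have ? := proj1 _ _ cw.
have ? := proj1 _ _ c1; have ? := proj1 _ _ c2; have ? := proj1 _ _ c3.
rewrite /scri_kernel /sphere_n; ct.
Qed.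

Lemma scri_kernelE w e1 e2 e3 (t s : R) : frame w e0 e1 e2 e3 -> s != 0 -> s * s = 1 + t * t ->
  I2 (scri_kernel s^-1 (t / s) w e1 e2 e3) = s * (4 * pi * f (t *: e0 + s *: w)).
Proof.
move=> tr s0 ts; have fr := frame_boost tr ts.
have st : s * s - t * t = 1 by rewrite ts addrK.
rewrite -(kirchhoff csf fr (t / s)) -I2Z; last first.
  rewrite /continuous2 /kir /cone /cone_tr /sphere_n; ct.
apply: eq_I2 => th ph; rewrite /scri_kernel /kir.
have -> : cone (t *: e0 + s *: w) (s *: e0 + t *: w) e1 e2 e3 (t / s) th ph =
    s^-1 *: w + (t / s) *: sphere_n e1 e2 e3 th ph.
  rewrite /cone; move: (sphere_n _ _ _ _ _) => v; apply: coord_inj => a.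
  rewrite !(coordD, coordZ, coordN).
  transitivity ((s * s - t * t) / s * coord w a + t / s * coord v a); first by field.
  by rewrite st mul1r.
have -> : cone_tr (t *: e0 + s *: w) (s *: e0 + t *: w) e1 e2 e3 (t / s) th ph =
    s^-1 *: (s^-1 *: sphere_n e1 e2 e3 th ph + e0 - (t / s) *: w).
  rewrite /cone_tr; move: (sphere_n _ _ _ _ _) => v; apply: coord_inj => a.
  rewrite !(coordD, coordZ, coordN).
  transitivity ((s * s - t * t) / (s * s) * coord v a + (s * s - t * t) / s * coord e0 a
    - (s * s - t * t) * t / (s * s) * coord w a); first by field.
  by rewrite st; field.
rewrite D1Zr.
have -> : 1 - t / s * (t / s) = s^-1 * s^-1.
  transitivity ((s * s - t * t) / (s * s)); first by field.
  by rewrite st; field.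
by field.
Qed.

(** At [x^0 = 1 / z] with [z > 0] the radius of the slice is [(z * rz z)^-1]; unlike that radius,
    [rz] is continuous at 0. *)
Definition rz (z : R) : R := (Num.sqrt (1 + z * z))^-1.

Lemma rz_gt0 z : 0 < rz z.
Proof. by rewrite invr_gt0 sqrtr_gt0 ltr_pwDl// -expr2 sqr_ge0. Qed.

Lemma rz0 : rz 0 = 1. Proof. by rewrite /rz mulr0 addr0 sqrtr1 invr1. Qed.

Lemma continuous_rz : continuous rz.
Proof.
apply: ctV => [z|]; first by rewrite -invr_eq0 gt_eqF// rz_gt0.
by apply: (@continuousT_comp _ _ _ (fun z : R => 1 + z * z) _ _ (@sqrt_continuous R)); ct.
Qed.

Lemma sqrt_invE (z : R) : 0 < z -> Num.sqrt (1 + z ^- 2) = (z * rz z)^-1.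
Proof.
move=> z0; rewrite /rz [RHS]invfM invrK.
have -> : 1 + z ^- 2 = (z^-1) ^+ 2 * (1 + z * z) by rewrite expr2; field; rewrite gt_eqF.
by rewrite sqrtrM ?sqr_ge0// sqrtr_sqr gtr0_norm// invr_gt0.
Qed.

(** Kirchhoff's formula solved for [f (Xpt z w) / z] with [z > 0]; in this form it is continuous at
    [z = 0]. *)
Definition scri_value (z : R) (w e1 e2 e3 : V) : R :=
  rz z * I2 (scri_kernel (z * rz z) (rz z) w e1 e2 e3) / (4 * pi).

Lemma scri_valueE w e1 e2 e3 (z : R) : frame w e0 e1 e2 e3 -> 0 < z ->
  f (Xpt z w) / z = scri_value z w e1 e2 e3.
Proof.
move=> tr z0; have zn0 : z != 0 by rewrite gt_eqF.
have rn0 : rz z != 0 by rewrite gt_eqF// rz_gt0.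
have pn0 : pi != 0 by rewrite gt_eqF// pi_gt0.
have szn0 : (z * rz z)^-1 != 0 by rewrite invr_neq0// mulf_neq0.
have sE : (z * rz z)^-1 * (z * rz z)^-1 = 1 + z^-1 * z^-1.
  rewrite -sqrt_invE// -expr2 sqr_sqrtr; first by rewrite expr2 invfM.
  by rewrite ltW// ltr_pwDl// invr_ge0 sqr_ge0.
have := scri_kernelE tr szn0 sE; rewrite invrK.
have -> : z^-1 * (z * rz z) = rz z by rewrite mulrA mulVf// mul1r.
rewrite /scri_value => ->; rewrite /Xpt sqrt_invE//.
rewrite -/e0; move: (f _) pi pn0 => F P pn0; field.
by rewrite zn0 rn0 pn0.
Qed.

Lemma continuous_scri_value w e1 e2 e3 : continuous (fun z => scri_value z w e1 e2 e3).
Proof.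
have cr := continuous_rz.
have := @continuous_scri_kernel R (fun z => z * rz z) rz (fun=> w) (fun=> e1) (fun=> e2) (fun=> e3).
move=> H; have {}H : continuous (fun z : R => I2 (scri_kernel (z * rz z) (rz z) w e1 e2 e3)).
  by apply: H; try exact: continuousT_cst; ct.
rewrite /scri_value; ct.
Qed.

Lemma cvg_scri_right w e1 e2 e3 : frame w e0 e1 e2 e3 ->
  f (Xpt z w) / z @[z --> 0^'+] --> scri_value 0 w e1 e2 e3.
Proof.
move=> tr.
have H : scri_value z w e1 e2 e3 @[z --> 0^'+] --> scri_value 0 w e1 e2 e3.
  by apply: cvg_at_right_filter; exact: continuous_scri_value.
apply: cvg_trans H; apply: near_eq_cvg; near=> z.
rewrite (scri_valueE tr)//.
Unshelve. all: by end_near. Qed.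

(* The right-hand side is computed both with a frame and with its opposite; for even
   [f] the integrands at [z = 0] are opposite. *)
Lemma scri_value_even w e1 e2 e3 : frame w e0 e1 e2 e3 ->
  (forall x, dS4 x -> f (- x) = f x) -> scri_value 0 w e1 e2 e3 = 0.
Proof.
move=> tr fev.
have tr' := frameNe tr.
have E : scri_value 0 w e1 e2 e3 = scri_value 0 w (- e1) (- e2) (- e3).
  have := cvg_lim (@Rhausdorff R) (cvg_scri_right tr).
  by rewrite (cvg_lim (@Rhausdorff R) (cvg_scri_right tr')) => ->.
suff E' : scri_value 0 w (- e1) (- e2) (- e3) = - scri_value 0 w e1 e2 e3.
  apply/eqP; move: E; rewrite E' => /eqP; rewrite -addr_eq0 -mulr2n -mulr_natl.
  by rewrite mulf_eq0 pnatr_eq0.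
have ck e1' e2' e3' : continuous2 (scri_kernel 0 1 w e1' e2' e3').
  rewrite /continuous2 /scri_kernel /sphere_n; ct.
suff E2 : I2 (scri_kernel 0 1 w (- e1) (- e2) (- e3)) = - I2 (scri_kernel 0 1 w e1 e2 e3).
  by rewrite /scri_value mul0r rz0 E2 mulrN mulNr.
rewrite -mulN1r -I2Z; last exact: ck.
apply: eq_I2 => th ph.
rewrite /scri_kernel !mul0r !add0r !scale0r !mul1r !scale1r !add0r.
have -> : sphere_n (- e1) (- e2) (- e3) th ph = - sphere_n e1 e2 e3 th ph.
  by rewrite /sphere_n !scalerN !opprD.
have [nn wn e0n] := mdot_sphere_n tr th ph.
rewrite mulN1r -mulrN.
move: (sphere_n e1 e2 e3 th ph) nn wn e0n => x nn wn e0n.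
(* At [z = 0] the kernel is a derivative at [x] in the direction [e0 - w], which is tangent to dS_4
   there, so evenness on dS_4 can be differentiated. *)
have D : D1 (fun x => f (- x)) x (e0 - w) = D1 f x (e0 - w).
  apply: (D1_eq (smooth_opp sf) sf fev nn).
  by rewrite mdotDr mdotNr (mdotC x e0) (mdotC x w) e0n wn subr0.
suff -> : D1 f (- x) (e0 - w) = - D1 f x (e0 - w) by [].
rewrite -D /D1 -sumrN; apply: eq_bigr => a _.
by rewrite (@pd_opp _ f a x sf) mulrN opprK.
Qed.

End Asymptotics.

(** * Kirchhoff's formula on spheres within a slice of constant time *)

Section Slices.
Variables (R : realType) (f : V R -> R).
Hypothesis csf : cs f.
Notation V := (V R).
Notation pi := (@pi R).
Notation e0 := (e0 R).

Let sf : smooth f. Proof. by case: csf. Qed.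

Variables (w e1 e2 e3 : V).
Hypothesis tr : frame w e0 e1 e2 e3.
Notation n := (sphere_n e1 e2 e3).

(* The sphere of radius [r] about [w] in the slice [x^0 = T], with
   [S = sqrt (1 + T ^ 2)], [C = cos r], [Sn = sin r]. *)
Definition slice_pt (T S C Sn th ph : R) (w : V) : V :=
  T *: e0 + S *: (C *: w + Sn *: n th ph).

(** In conformal time tau, with [x^0] equal to the tangent of tau, light covers the angle r on S^3
    in time r. The vertex of the cone through the sphere thus has time tan(arctan T - r), which is
    [(T * C - Sn) / (C + T * Sn)]. *)
Lemma slice_kirchhoff (T S C Sn : R) (v : V) : frame v e0 e1 e2 e3 ->
  S != 0 -> C + T * Sn != 0 -> S * S = 1 + T * T -> C * C + Sn * Sn = 1 ->
  I2 (fun th ph => sin th * (S * (C - T * Sn) * f (slice_pt T S C Sn th ph v)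
    + S * S * Sn * D1 f (slice_pt T S C Sn th ph v)
       ((- Sn - T * C) *: v + (C - T * Sn) *: n th ph - S *: e0))) =
  4 * pi * (S / (C + T * Sn) *
    f (((T * C - Sn) / (C + T * Sn)) *: e0 + (S / (C + T * Sn)) *: v)).
Proof.
move=> trv S0 D0 TS CS.
set D := C + T * Sn in D0 *.
pose t1 := (T * C - Sn) / D; pose s1 := S / D.
have ts1 : s1 * s1 = 1 + t1 * t1.
  rewrite /s1 /t1.
  transitivity ((S * S) * (C * C + Sn * Sn) / (D * D)); first by rewrite CS; field.
  rewrite TS; transitivity (((C + T * Sn) * (C + T * Sn) + (T * C - Sn) * (T * C - Sn)) / (D * D)).
    by congr (_ / _); ring.
  by rewrite -/D; field.
(* The time direction is reversed, so that the cone opens to the future. *)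
have fr := frameNn (frame_boost trv ts1).
(* The parameter at which the cone reaches the slice [x^0 = T], as checked in [x0] and [xw]. *)
pose l := S * Sn.
have C2 : C * C = 1 - Sn * Sn by rewrite -CS addrK.
have Dt : D * t1 = T * C - Sn by rewrite /t1 mulrC divfK.
have Ds : D * s1 = S by rewrite /s1 mulrC divfK.
have x0 : t1 + l * s1 = T.
  apply: (mulfI D0); rewrite mulrDr Dt /l mulrCA Ds.
  transitivity (T * C - Sn + Sn * (S * S)); first by ring.
  by rewrite TS /D; ring.
have xw : s1 + l * t1 = S * C.
  apply: (mulfI D0); rewrite mulrDr Ds /l mulrCA Dt.
  transitivity (S * ((1 - Sn * Sn) + T * C * Sn)); first by ring.
  by rewrite -C2 /D; ring.
have ll : 1 - l * l = (C - T * Sn) * D.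
  rewrite /l; transitivity (1 - (S * S) * (Sn * Sn)); first by ring.
  rewrite TS /D; transitivity ((1 - Sn * Sn) - T * T * (Sn * Sn)); first by ring.
  by rewrite -C2; ring.
have Le : - (1 + l * l) * s1 - 2 * l * t1 = - (S * D).
  apply: (mulfI D0).
  transitivity (- (1 + (S * S) * (Sn * Sn)) * (D * s1) - 2 * S * Sn * (D * t1)); first by rewrite /l; ring.
  rewrite Ds Dt TS /D.
  transitivity (- S * ((1 - Sn * Sn) + 2 * T * C * Sn + T * T * (Sn * Sn))); first by ring.
  by rewrite -C2; ring.
have Lw : - (1 + l * l) * t1 - 2 * l * s1 = D * (- Sn - T * C).
  apply: (mulfI D0).
  transitivity (- (1 + (S * S) * (Sn * Sn)) * (D * t1) - 2 * (S * Sn) * (D * s1)); first by rewrite /l; ring.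
  rewrite Ds Dt.
  transitivity (- (1 + (S * S) * (Sn * Sn)) * (T * C - Sn) - 2 * (S * S) * Sn); first by ring.
  have SnS : Sn * Sn = 1 - C * C by rewrite -CS addrC addKr.
  rewrite TS /D.
  transitivity ((T * C - Sn) * (- (1 + (1 + T * T) * (Sn * Sn))) - 2 * (1 + T * T) * Sn * (C * C + Sn * Sn)).
    by rewrite CS; ring.
  transitivity ((T * C - Sn) * (- (C * C + Sn * Sn + (1 + T * T) * (Sn * Sn))) - 2 * (1 + T * T) * Sn * (C * C + Sn * Sn)).
    by rewrite CS.
  ring.
have := kirchhoff csf fr l.
rewrite -/t1 -/s1 => K; rewrite mulrCA -K -I2Z; last first.
  rewrite /continuous2 /kir /cone /cone_tr /sphere_n; ct.
apply: eq_I2 => th ph; rewrite /kir.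
have -> : cone (t1 *: e0 + s1 *: v) (- (s1 *: e0 + t1 *: v)) e1 e2 e3 l th ph =
    slice_pt T S C Sn th ph v.
  rewrite /cone /slice_pt; move: (n th ph) => m; apply: coord_inj => a.
  rewrite !(coordD, coordZ, coordN).
  transitivity ((t1 + l * s1) * coord e0 a + ((s1 + l * t1) * coord v a + l * coord m a)).
    by ring.
  by rewrite x0 xw /l; ring.
have -> : cone_tr (t1 *: e0 + s1 *: v) (- (s1 *: e0 + t1 *: v)) e1 e2 e3 l th ph =
    D *: ((- Sn - T * C) *: v + (C - T * Sn) *: n th ph - S *: e0).
  rewrite /cone_tr; move: (n th ph) => m; apply: coord_inj => a.
  rewrite !(coordD, coordZ, coordN).
  transitivity ((1 - l * l) * coord m a + (- (1 + l * l) * s1 - 2 * l * t1) * coord e0 a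
    + (- (1 + l * l) * t1 - 2 * l * s1) * coord v a); first by ring.
  by rewrite ll Le Lw; ring.
rewrite D1Zr ll.
transitivity (sin th * ((C - T * Sn) * (D * s1) * f (slice_pt T S C Sn th ph v) +
  l * (D * s1) * D1 f (slice_pt T S C Sn th ph v)
     ((- Sn - T * C) *: v + (C - T * Sn) *: n th ph - S *: e0))); last by ring.
by rewrite Ds /l; ring.
Qed.

(* The spheres of radius [r] about [w] and [pi - r] about [- w] coincide, and the
   derivatives transverse to the slice cancel in the difference. *)
Lemma slice_difference (T S C Sn : R) : S != 0 -> C + T * Sn != 0 -> - C + T * Sn != 0 ->
  S * S = 1 + T * T -> C * C + Sn * Sn = 1 ->
  2 * I2 (fun th ph => sin th * (S * C * f (slice_pt T S C Sn th ph w)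
    + S * S * Sn * D1 f (slice_pt T S C Sn th ph w) (C *: n th ph - Sn *: w))) =
  4 * pi * (S / (C + T * Sn) *
    f (((T * C - Sn) / (C + T * Sn)) *: e0 + (S / (C + T * Sn)) *: w)
   - S / (- C + T * Sn) *
    f (((- (T * C) - Sn) / (- C + T * Sn)) *: e0 - (S / (- C + T * Sn)) *: w)).
Proof.
move=> S0 D0 D0' TS CS.
have CS' : - C * - C + Sn * Sn = 1 by rewrite mulrNN.
have K1 := slice_kirchhoff tr S0 D0 TS CS.
have K2 := slice_kirchhoff (frameNp tr) S0 D0' TS CS'.
rewrite (mulrN T C) !scalerN in K2.
rewrite mulrBr -K1 -K2 -I2Z; last by rewrite /continuous2 /slice_pt /sphere_n; ct.
rewrite -mulN1r -I2Z; last by rewrite /continuous2 /slice_pt /sphere_n; ct.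
rewrite -I2D; [|by rewrite /continuous2 /slice_pt /sphere_n; ct..].
apply: eq_I2 => th ph.
have -> : slice_pt T S (- C) Sn th ph (- w) = slice_pt T S C Sn th ph w.
  by rewrite /slice_pt scalerN scaleNr opprK.
move: (slice_pt _ _ _ _ _ _ _) => x.
by rewrite !(D1Dr, D1Zr, D1Nr); ring.
Qed.

(** The radius [S * sin r] of the sphere is the weight for which the derivative in [r] is half of
    the left-hand side of [slice_difference]. *)
Definition slice_mean (T S r : R) : R :=
  I2 (fun th ph => S * sin r * (sin th * f (slice_pt T S (cos r) (sin r) th ph w))).

Lemma is_derive_slice_mean (T S r : R) : is_derive r (1 : R) (slice_mean T S)
  (I2 (fun th ph => sin th * (S * cos r * f (slice_pt T S (cos r) (sin r) th ph w)
    + S * S * sin r * D1 f (slice_pt T S (cos r) (sin r) th ph w)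
       (cos r *: n th ph - sin r *: w)))).
Proof.
pose g (r th ph : R) := S * sin r * (sin th * f (slice_pt T S (cos r) (sin r) th ph w)).
pose dg (r th ph : R) := sin th * (S * cos r * f (slice_pt T S (cos r) (sin r) th ph w)
    + S * S * sin r * D1 f (slice_pt T S (cos r) (sin r) th ph w)
       (cos r *: n th ph - sin r *: w)).
apply: (@I2_param_derive R g dg).
- by rewrite /g /slice_pt /sphere_n; ct.
- by rewrite /dg /slice_pt /sphere_n; ct.
move=> s th ph.
have dpt a : is_derive s (1 : R) (fun s => coord (slice_pt T S (cos s) (sin s) th ph w) a)
    (coord (S *: (cos s *: n th ph - sin s *: w)) a).
  rewrite /slice_pt; move: (n th ph) => m.
  rewrite (_ : (fun s => _) = fun s => T * coord e0 a + S * (cos s * coord w a + sin s * coord m a)).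
    by apply: is_derive_eq; rewrite /GRing.scale/= !(coordZ, coordD, coordN); ring.
  by apply/funext => u; rewrite !(coordD, coordZ).
have i1 := derive_comp_curve (smooth_C1 sf) dpt.
by apply: is_derive_eq; rewrite /GRing.scale/= /dg D1Zr; ring.
Qed.

End Slices.

(** * Conformal scalars with vanishing data are even *)

Section ScalarParity.
Variables (R : realType) (f : V R -> R).
Hypothesis csf : cs f.
Notation V := (V R).
Notation pi := (@pi R).
Notation e0 := (e0 R).

Let sf : smooth f. Proof. by case: csf. Qed.

Lemma ct_qvec (T : topologicalType) (a b c d : T -> R) (k : 'I_5) :
  continuous a -> continuous b -> continuous c -> continuous d ->
  continuous (fun u => coord (qvec (a u) (b u) (c u) (d u)) k).
Proof.
move=> ca cb cc cd.
have [h0 h1 h2 h3 h4] : [/\ forall u, coord (qvec (a u) (b u) (c u) (d u)) o0 = 0,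
  forall u, coord (qvec (a u) (b u) (c u) (d u)) o1 = a u,
  forall u, coord (qvec (a u) (b u) (c u) (d u)) o2 = b u,
  forall u, coord (qvec (a u) (b u) (c u) (d u)) o3 = c u &
  forall u, coord (qvec (a u) (b u) (c u) (d u)) o4 = d u].
  by split=> u; have [] := coord_qvec (a u) (b u) (c u) (d u).
move: k; apply: ord5P; [rewrite (funext h0)|rewrite (funext h1)|rewrite (funext h2)
  |rewrite (funext h3)|rewrite (funext h4)] => //; exact: continuousT_cst.
Qed.

Definition scri (z : R) (w : V) : R := scri_value f z w (quat1 w) (quat2 w) (quat3 w).

Lemma scriE z w : S3 w -> 0 < z -> f (Xpt z w) / z = scri z w.
Proof. by move=> wS z0; apply: scri_valueE => //; exact: quat_frame. Qed.

Lemma cvg_scri w : S3 w -> f (Xpt z w) / z @[z --> 0^'+] --> scri 0 w.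
Proof. by move=> wS; apply: cvg_scri_right => //; exact: quat_frame. Qed.

Lemma continuous_scri : continuous (fun u : R * V => scri u.1 u.2).
Proof.
have cr : continuous (fun u : R * V => rz u.1).
  by apply: (continuousT_comp (@continuousT_fst _ _)); exact: continuous_rz.
have cz : continuous (fun u : R * V => u.1 * rz u.1) by ct.
have cq (g : V -> V) : (forall k, continuous (fun w => coord (g w) k)) ->
    continuous (fun u : R * V => g u.2).
  by move=> cg; apply: (continuousT_comp (@continuousT_snd _ _)); exact: ct_vec.
have q1 : forall k, continuous (fun w : V => coord (quat1 w) k).
  by move=> k; apply: ct_qvec; try apply: ctN; exact: continuous_coord.
have q2 : forall k, continuous (fun w : V => coord (quat2 w) k).
  by move=> k; apply: ct_qvec; try apply: ctN; exact: continuous_coord.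
have q3 : forall k, continuous (fun w : V => coord (quat3 w) k).
  by move=> k; apply: ct_qvec; try apply: ctN; exact: continuous_coord.
have cI := continuous_scri_kernel csf cz cr (@continuousT_snd R V) (cq _ q1) (cq _ q2) (cq _ q3).
rewrite /scri /scri_value; apply: ctM; last exact: continuousT_cst.
by apply: ctM.
Qed.

Hypothesis f0 : forall w : V, S3 w -> f (Xpt z w) / z @[z --> 0^'+] --> (0 : R).

Let scri0 w : S3 w -> scri 0 w = 0.
Proof.
by move=> wS; exact: (cvg_unique _ (cvg_scri wS) (f0 wS)).
Qed.

(** Pointwise limits are enough, because [scri] is jointly continuous in [z] and [w] and S^3 is
    compact. *)
Lemma uniform_decay e : 0 < e ->
  \forall z \near (0 : R), 0 < z -> forall w, S3 w -> `|f (Xpt z w)| < e * z.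
Proof.
move=> ep; have /compact_near_coveringP/(_ R (nbhs (0 : R)) (fun z w => `|scri z w| < e) _) H :=
  @compact_S3 R.
have {}H : \forall z \near (0 : R), @S3 R `<=` (fun w => `|scri z w| < e).
  apply: H => w wS.
  have /cvgrPdist_lt/(_ e ep) := @continuous_scri ((0 : R), w).
  rewrite /= scri0// => -[[A B]/= [Az Bw] AB]; exists (B, A) => //= -[y u]/= [By Au].
  by have := AB (u, y) (conj Au By); rewrite /= sub0r normrN.
apply: filterS H => z H z0 w wS.
by rewrite -ltr_pdivrMr// -[in X in _ / X](gtr0_norm z0) -normf_div scriE//; exact: H.
Qed.

(* The value at [p] and at its antipode are compared along the slices [x^0 = 1 / z];
   as [z] tends to [0] the apexes of the two cones tend to [p] and [- p]. *)
Let diff_apex (w : V) (z r : R) : R := (rz z)^-1 *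
  (f (((cos r - z * sin r) / (z * cos r + sin r)) *: e0
      + ((rz z)^-1 / (z * cos r + sin r)) *: w) / (z * cos r + sin r)
   - f (((- cos r - z * sin r) / (- (z * cos r) + sin r)) *: e0
      - ((rz z)^-1 / (- (z * cos r) + sin r)) *: w) / (- (z * cos r) + sin r)).

Let cvg_diff_apex (w : V) (r : R) : 0 < sin r ->
  diff_apex w q.1 q.2 @[q --> ((0 : R), r)] -->
  (sin r)^-1 * (f ((cos r / sin r) *: e0 + (sin r)^-1 *: w)
     - f (- ((cos r / sin r) *: e0 + (sin r)^-1 *: w))).
Proof.
move=> s0.
have cz : (q : R * R).1 @[q --> ((0 : R), r)] --> (0 : R) by exact: cvg_fst.
have cr : (q : R * R).2 @[q --> ((0 : R), r)] --> r by exact: cvg_snd.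
have cC : cos (q : R * R).2 @[q --> ((0 : R), r)] --> cos r.
  exact: (cvg_comp _ _ cr (@continuous_cos R r)).
have cS : sin (q : R * R).2 @[q --> ((0 : R), r)] --> sin r.
  exact: (cvg_comp _ _ cr (@continuous_sin R r)).
have cs1 : (rz (q : R * R).1)^-1 @[q --> ((0 : R), r)] --> (1 : R).
  rewrite -[X in _ --> X]invr1 -rz0; apply: cvgV; first by rewrite rz0 oner_neq0.
  exact: (cvg_comp _ _ cz (@continuous_rz R 0)).
have sn0 : sin r != 0 by rewrite gt_eqF.
pose proof (cvgM cz cC) as czC; pose proof (cvgM cz cS) as czS; rewrite mul0r in czC; rewrite mul0r in czS.
pose proof (cvgD czC cS) as cD; rewrite add0r in cD.
pose proof (cvgD (cvgN czC) cS) as cD'; rewrite oppr0 add0r in cD'.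
pose proof (cvgV sn0 cD) as cDV; pose proof (cvgV sn0 cD') as cDV'.
pose proof (cvgM (cvgB cC czS) cDV) as cA; rewrite subr0 in cA.
pose proof (cvgM (cvgB (cvgN cC) czS) cDV') as cA'; rewrite subr0 in cA'.
pose proof (cvgM cs1 cDV) as cB; pose proof (cvgM cs1 cDV') as cB'; rewrite mul1r in cB; rewrite mul1r in cB'.
have cf := smooth_continuous sf.
set x := _ *: _ + _ *: _.
have cX : (((cos (q : R * R).2 - q.1 * sin q.2) / (q.1 * cos q.2 + sin q.2)) *: e0
    + ((rz q.1)^-1 / (q.1 * cos q.2 + sin q.2)) *: w) @[q --> ((0 : R), r)] --> x.
  apply: cvg_vec => a; rewrite /x coordD !coordZ.
  under eq_fun do rewrite coordD !coordZ.
  exact: (cvgD (cvgM cA (cvg_cst _)) (cvgM cB (cvg_cst _))).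
have cX' : (((- cos (q : R * R).2 - q.1 * sin q.2) / (- (q.1 * cos q.2) + sin q.2)) *: e0
    - ((rz q.1)^-1 / (- (q.1 * cos q.2) + sin q.2)) *: w) @[q --> ((0 : R), r)] --> - x.
  apply: cvg_vec => a.
  have -> : coord (- x) a = - cos r / sin r * coord e0 a - (sin r)^-1 * coord w a.
    by rewrite /x coordN coordD !coordZ; ring.
  under eq_fun do rewrite coordD coordN !coordZ.
  exact: (cvgB (cvgM cA' (cvg_cst _)) (cvgM cB' (cvg_cst _))).
pose proof (cvgM cs1 (cvgB (cvgM (cvg_comp _ _ cX (cf x)) cDV) (cvgM (cvg_comp _ _ cX' (cf (- x))) cDV'))) as H.
by move: H; rewrite mul1r -mulrBl mulrC.
Qed.

(** The sphere has radius at most [2 / z] and [f] is below [e * z] on it, so the powers of [z]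
    cancel; the other factors are the lengths of the ranges of the angles. *)
Let slice_mean_bound (w e1 e2 e3 : V) (z r e : R) : frame w e0 e1 e2 e3 -> 0 < z -> z < 1 ->
  (forall w, S3 w -> `|f (Xpt z w)| < e * z) ->
  `|slice_mean f w e1 e2 e3 z^-1 ((rz z)^-1 / z) r| <= 2 * e * (2 * pi) * pi.
Proof.
move=> tr z0 z1 H.
apply: normr_I2_le.
  by rewrite /continuous2 /slice_pt /sphere_n; ct.
move=> th ph; rewrite !normrM.
set y := cos r *: w + sin r *: sphere_n e1 e2 e3 th ph.
have yS : S3 y.
  have [nn wn e0n] := mdot_sphere_n tr th ph.
  have [w0 _] := S3E (frame_S3 tr).
  have ww := mdot_S3 (frame_S3 tr).
  have n0 : coord (sphere_n e1 e2 e3 th ph) o0 = 0.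
    by apply/eqP; rewrite -oppr_eq0 -mdot_e0 e0n.
  rewrite /y; move: (sphere_n e1 e2 e3 th ph) nn wn e0n n0 => m mm wm e0m m0.
  have y0 : coord (cos r *: w + sin r *: m) o0 = 0 by rewrite coordD !coordZ w0 m0 !mulr0 addr0.
  split; first by rewrite ord0E.
  have : mdot (cos r *: w + sin r *: m) (cos r *: w + sin r *: m) = 1.
    rewrite !(mdotDl, mdotDr, mdotZl, mdotZr) (mdotC m w) ww mm wm.
    by rewrite -[RHS](cos2Dsin2 r); ring.
  rewrite mdot5 y0 => <-; rewrite sum5 y0; ring.
have -> : slice_pt e1 e2 e3 z^-1 ((rz z)^-1 / z) (cos r) (sin r) th ph w = Xpt z y.
  rewrite /slice_pt /Xpt sqrt_invE// -/y; congr (_ + _ *: _).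
  by rewrite invfM mulrC.
have sle1 (x : R) : `|sin x| <= 1 by rewrite ler_norml sin_geN1 sin_le1.
have rle : (rz z)^-1 <= 2.
  rewrite /rz invrK -[leRHS]ger0_norm// -sqrtr_sqr ler_wsqrtr//.
  have : z * z <= 1 by rewrite mulr_ile1// ltW.
  by rewrite expr2; lra.
have r0 : 0 < (rz z)^-1 by rewrite invr_gt0 rz_gt0.
have z'0 : 0 <= z^-1 by rewrite invr_ge0 ltW.
rewrite (gtr0_norm r0) (ger0_norm z'0).
have A0 : 0 <= (rz z)^-1 * z^-1 by rewrite mulr_ge0// ltW.
have hB := ler_pM A0 (normr_ge0 (sin r)) (ler_wpM2r z'0 rle) (sle1 r).
have hC := ler_pM (normr_ge0 (sin th)) (normr_ge0 _) (sle1 th) (ltW (H y yS)).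
have := ler_pM (mulr_ge0 A0 (normr_ge0 _)) (mulr_ge0 (normr_ge0 _) (normr_ge0 _)) hB hC.
move=> /le_trans; apply.
rewrite mulr1 mul1r; have z0' : z != 0 by rewrite gt_eqF.
by rewrite (_ : 2 / z * (e * z) = 2 * e)//; field.
Qed.

(** If [f (- x)] differed from [f x], then [diff_apex], which by [slice_difference] is the
    derivative of [slice_mean] up to the factor [2 * pi], would stay away from 0 near [(0, r)]. Over
    a fixed interval of radii the integral would change by a fixed amount, although it is
    arbitrarily small as [z] tends to 0. *)
Theorem scalar_even x : dS4 x -> f (- x) = f x.
Proof.
move=> xdS; apply/eqP; apply: contraT => fx.
pose t := coord x o0; pose s := Num.sqrt (1 + t * t).
have tt0 : 0 <= t * t by rewrite -expr2 sqr_ge0.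
have s0 : 0 < s by rewrite sqrtr_gt0; lra.
have ss : s * s = 1 + t * t by rewrite -expr2 sqr_sqrtr//; lra.
pose w := s^-1 *: (x - t *: e0).
have [h0 h1 h2 h3 h4] := coord_e0 R.
have wS : S3 w.
  split; first by rewrite ord0E /w coordZ coordB coordZ h0 mulr1 subrr mulr0.
  rewrite sum5 /w !coordZ !coordB !coordZ h0 h1 h2 h3 h4 -/t.
  have := xdS; rewrite /dS4/= mdot5 -/t => H.
  transitivity ((s * s)^-1 * (coord x o1 * coord x o1 + coord x o2 * coord x o2
     + coord x o3 * coord x o3 + coord x o4 * coord x o4)).
    by rewrite invfM; ring.
  have -> : coord x o1 * coord x o1 + coord x o2 * coord x o2
     + coord x o3 * coord x o3 + coord x o4 * coord x o4 = s * s by rewrite ss -H; ring.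
  by rewrite mulVf// mulf_neq0// gt_eqF.
(* The radius of the sphere in which the future cone of [x] meets I^+; its cotangent is [t]. *)
pose r := acos (t / s).
have ts1 : -1 <= t / s <= 1.
  rewrite ler_pdivlMr// ler_pdivrMr// mulN1r mul1r -ler_norml.
  by rewrite -ler_sqr ?nnegrE// ?ltW// real_normK ?num_real// !expr2 ss; lra.
have cr : cos r = t / s by rewrite /r acosK// in_itv.
have sr : sin r = s^-1.
  rewrite /r sin_acos//.
  have -> : 1 - (t / s) ^+ 2 = (s^-1) ^+ 2.
    rewrite !expr2; transitivity ((s * s - t * t) / (s * s)); first by field; rewrite gt_eqF.
    by rewrite ss addrK -ss invfM mul1r.
  by rewrite sqrtr_sqr gtr0_norm// invr_gt0.
have sr0 : 0 < sin r by rewrite sr invr_gt0.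
have xE : (cos r / sin r) *: e0 + (sin r)^-1 *: w = x.
  apply: coord_inj => a; rewrite coordD /w !coordZ coordB coordZ cr sr invrK.
  by field; rewrite gt_eqF.
have Hc := @cvg_diff_apex w r sr0; rewrite xE in Hc.
set h0' := _ * (f x - f (- x)) in Hc.
have h00 : 0 < `|h0'|.
  by rewrite normr_gt0 /h0' mulf_eq0 negb_or invr_eq0 gt_eqF//= subr_eq0 eq_sym.
have cD : continuous (fun q : R * R => q.1 * cos q.2 + sin q.2) by ct.
have cD' : continuous (fun q : R * R => - (q.1 * cos q.2) + sin q.2) by ct.
have h02 : 0 < `|h0'| / 2 by rewrite divr_gt0.
have N1 : \forall q \near ((0 : R), r), 0 < q.1 * cos q.2 + sin q.2.
  have /cvgrPdist_lt/(_ _ sr0) := cD ((0 : R), r).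
  by rewrite /= mul0r add0r; apply: filterS => q; rewrite ltr_norml => /andP[_]; lra.
have N2 : \forall q \near ((0 : R), r), 0 < - (q.1 * cos q.2) + sin q.2.
  have /cvgrPdist_lt/(_ _ sr0) := cD' ((0 : R), r).
  by rewrite /= mul0r oppr0 add0r; apply: filterS => q; rewrite ltr_norml => /andP[_]; lra.
have N3 : \forall q \near ((0 : R), r), `|h0'| / 2 < `|diff_apex w q.1 q.2|.
  move/cvgrPdist_lt : Hc => /(_ _ h02); apply: filterS => q Hq.
  have := ler_normB h0' (h0' - diff_apex w q.1 q.2).
  by rewrite opprB addrCA subrr addr0 => _; have := lerB_dist h0' (diff_apex w q.1 q.2); lra.
have N : \forall q \near ((0 : R), r), 0 < q.1 * cos q.2 + sin q.2 /\
    (0 < - (q.1 * cos q.2) + sin q.2 /\ `|h0'| / 2 < `|diff_apex w q.1 q.2|).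
  by apply: filterI => //; exact: filterI.
move: N => /nbhs_ballP[e /= ep eP].
pose d := e / 2.
have d0 : 0 < d by rewrite divr_gt0.
have pi0 := pi_gt0 R.
(* With this value, twice the bound of [slice_mean_bound] is half of the change over length [d] that
   the lower bound on [diff_apex] forces. *)
pose e' := `|h0'| * d / (16 * pi).
have e'0 : 0 < e' by rewrite divr_gt0 ?mulr_gt0.
have /nbhs_ballP[d2 /= d20 d2P] := uniform_decay e'0.
pose z := Num.min (Num.min e d2) 1 / 2.
have m0 : 0 < Num.min (Num.min e d2) 1 by rewrite !lt_min ep d20 ltr01.
have z0 : 0 < z by rewrite divr_gt0.
have zlt : z < Num.min (Num.min e d2) 1 by rewrite /z; lra.
move: zlt; rewrite !lt_min => /andP[/andP[ze zd2] z1].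
have zn0 : z != 0 by rewrite gt_eqF.
have rn0 : rz z != 0 by rewrite gt_eqF// rz_gt0.
have dec : forall w, S3 w -> `|f (Xpt z w)| < e' * z.
  by apply: (d2P z) => //; rewrite /ball/= sub0r normrN gtr0_norm.
have tr := quat_frame wS.
pose S := (rz z)^-1 / z.
pose U := slice_mean f w (quat1 w) (quat2 w) (quat3 w) z^-1 S.
have B u : `|U u| <= 2 * e' * (2 * pi) * pi by exact: slice_mean_bound.
have dU u := is_derive_slice_mean csf w (quat1 w) (quat2 w) (quat3 w) z^-1 S u.
have cU : continuous U.
  by move=> u; apply: differentiable_continuous; apply/derivable1_diffP; apply: ex_derive.
have rd : r < r + d by rewrite ltrDl.
have [c cin Uc] := MVT rd (fun u _ => dU u) (continuous_subspaceT cU).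
move: cin; rewrite in_itv/= => /andP[rc crd].
have /eP[] : ball ((0 : R), r) e (z, c).
  split; rewrite /ball/=; first by rewrite sub0r normrN gtr0_norm.
  rewrite distrC gtr0_norm ?subr_gt0// ltrBlDl (lt_trans crd)// ltrD2l.
  by rewrite /d ltr_pdivrMr// ltr_pMr// ltr1n.
rewrite /= => D1p [D2p D3p].
have Sn0 : S != 0 by rewrite mulf_neq0// invr_neq0.
have T1 : cos c + z^-1 * sin c = (z * cos c + sin c) / z by field.
have T2 : - cos c + z^-1 * sin c = (- (z * cos c) + sin c) / z by field.
have F1 : cos c + z^-1 * sin c != 0 by rewrite T1 mulf_neq0 ?invr_neq0// gt_eqF.
have F2 : - cos c + z^-1 * sin c != 0 by rewrite T2 mulf_neq0 ?invr_neq0// gt_eqF.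
have SS : S * S = 1 + z^-1 * z^-1.
  rewrite /S -invfM (mulrC (rz z)) -sqrt_invE// -expr2 sqr_sqrtr; first by rewrite expr2 invfM.
  by rewrite ltW// ltr_pwDl// invr_ge0 sqr_ge0.
have CS : cos c * cos c + sin c * sin c = 1 by have := cos2Dsin2 c; rewrite !expr2.
have K := slice_difference csf tr Sn0 F1 F2 SS CS.
have D1n : z * cos c + sin c != 0 by rewrite gt_eqF.
have D2n : - (z * cos c) + sin c != 0 by rewrite gt_eqF.
have A1 : (z^-1 * cos c - sin c) / (cos c + z^-1 * sin c) =
    (cos c - z * sin c) / (z * cos c + sin c) by rewrite T1; field; rewrite ?D1n ?zn0.
have A2 : (- (z^-1 * cos c) - sin c) / (- cos c + z^-1 * sin c) =
    (- cos c - z * sin c) / (- (z * cos c) + sin c) by rewrite T2; field; rewrite ?D2n ?zn0.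
have A3 : S / (cos c + z^-1 * sin c) = (rz z)^-1 / (z * cos c + sin c).
  by rewrite T1 /S; field; rewrite ?D1n ?zn0 ?rn0.
have A4 : S / (- cos c + z^-1 * sin c) = (rz z)^-1 / (- (z * cos c) + sin c).
  by rewrite T2 /S; field; rewrite ?D2n ?zn0 ?rn0.
rewrite A1 A2 A3 A4 in K.
set I := I2 _ in K Uc.
have IE : I = 2 * pi * diff_apex w z c.
  apply: (@mulfI _ 2); first by rewrite pnatr_eq0.
  rewrite K /diff_apex; ring.
have : `|U (r + d) - U r| <= 2 * (2 * e' * (2 * pi) * pi).
  by rewrite (le_trans (ler_normB _ _))// mulr_natl mulr2n lerD.
rewrite Uc addrAC subrr add0r normrM (gtr0_norm d0) IE normrM gtr0_norm ?mulr_gt0//.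
rewrite leNgt => /negP[].
have -> : 2 * (2 * e' * (2 * pi) * pi) = 2 * pi * (`|h0'| / 2) * d / 2.
  rewrite /e'; move: (`|h0'|) pi pi0 => h P P0; have Pn0 : P != 0 by rewrite gt_eqF.
  by field.
apply: (@lt_trans _ _ (2 * pi * (`|h0'| / 2) * d)).
  by rewrite ltr_pdivrMr// ltr_pMr ?ltr1n// !mulr_gt0.
by rewrite ltr_pM2r// ltr_pM2l// mulr_gt0.
Qed.

End ScalarParity.

(** * Conformal scalars: linearity, data on I^-, static solutions *)

Section ConformalScalars.
Variable R : realType.
Notation V := (V R).
Implicit Types (f g : V -> R) (x w : V) (a b c l : 'I_5).
Lemma box_eq f g x : smooth f -> smooth g -> (forall y, dS4 y -> f y = g y) -> dS4 x ->
  box f x = box g x.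
Proof.
move=> sf sg fg xdS; apply: eq_bigr => a _; congr (_ * _).
apply: (dl_eq a (smooth_dl a sf) (smooth_dl a sg) _ xdS) => y ydS.
exact: (dl_eq a sf sg fg ydS).
Qed.

Lemma boxD f g x : smooth f -> smooth g -> box (fun x => f x + g x) x = box f x + box g x.
Proof.
move=> sf sg; rewrite /box -big_split; apply: eq_bigr => a _ /=.
rewrite (_ : dl a (fun x => f x + g x) = fun x => dl a f x + dl a g x).
  by rewrite (dlD a x (smooth_dl a sf) (smooth_dl a sg)) mulrDr.
by apply/funext => y; exact: dlD.
Qed.

Lemma boxZ (k : R) f x : smooth f -> box (fun x => k * f x) x = k * box f x.
Proof.
move=> sf; rewrite /box mulr_sumr; apply: eq_bigr => a _ /=.
rewrite (_ : dl a (fun x => k * f x) = fun x => k * dl a f x).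
  by rewrite (dlZ a k x (smooth_dl a sf)) mulrCA.
by apply/funext => y; exact: dlZ.
Qed.

Lemma csD f g : cs f -> cs g -> cs (fun x => f x + g x).
Proof.
move=> [sf bf] [sg bg]; split; first exact: smoothD.
by move=> x xdS; rewrite (boxD x sf sg) bf// bg// mulrDr.
Qed.

Lemma csZ (k : R) f : cs f -> cs (fun x => k * f x).
Proof.
move=> [sf bf]; split; first exact: smoothZ.
by move=> x xdS; rewrite (boxZ k x sf) bf// mulrCA.
Qed.

Lemma cs0 : cs (fun _ : V => 0 : R).
Proof.
split; first exact: smooth_cst.
move=> x _; rewrite mulr0 /box big1// => a _.
rewrite (_ : dl a (fun _ : V => 0 : R) = fun=> 0) ?dl_cst ?mulr0//.
by apply/funext => y; rewrite dl_cst.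
Qed.

Lemma cs_sum (I : Type) (r : seq I) (F : I -> V -> R) : (forall i, cs (F i)) ->
  cs (fun x => \sum_(i <- r) F i x).
Proof.
move=> sF; elim: r => [|i r IH].
  by under eq_fun do rewrite big_nil; exact: cs0.
by under eq_fun do rewrite big_cons; exact: csD.
Qed.

Lemma cs_eq f g : smooth g -> (forall y, dS4 y -> f y = g y) -> cs f -> cs g.
Proof.
move=> sg fg [sf bf]; split => // x xdS.
by rewrite -(box_eq sf sg fg xdS) bf// fg.
Qed.

Lemma dl_opp a f x : smooth f -> dl a (fun x => f (- x)) x = - dl a f (- x).
Proof.
move=> sf; rewrite /dl pd_opp//.
have -> : xlow (- x) a = - xlow x a by rewrite /xlow coordN mulrN.
have -> : D1 (fun x => f (- x)) x x = D1 f (- x) (- x).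
  by apply: eq_bigr => b _; rewrite (@pd_opp _ f b x sf) coordN mulrN mulNr.
by ring.
Qed.

Lemma cs_opp f : cs f -> cs (fun x => f (- x)).
Proof.
move=> [sf bf]; split; first exact: smooth_opp.
move=> x xdS; rewrite -bf; last exact: dS4_opp.
apply: eq_bigr => a _; congr (_ * _).
rewrite (_ : dl a (fun x => f (- x)) = fun x => -1 * dl a f (- x)).
  rewrite (dlZ a (-1) x (smooth_opp (smooth_dl a sf))).
  by rewrite (@dl_opp a (dl a f) x (smooth_dl a sf)) mulN1r opprK.
by apply/funext => y; rewrite mulN1r; exact: dl_opp.
Qed.

Lemma XptN (z : R) w : Xpt (- z) (- w) = - Xpt z w.
Proof.
by rewrite /Xpt invrN sqrrN scaleNr scalerN opprD.
Qed.

(** The antipodal map exchanges I^+ and I^- and changes the sign of [z]; every statement at I^- is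
    obtained through this equivalence. *)
Lemma cvg_left_opp f w (l : R) :
  (fun x => f (- x)) (Xpt z (- w)) / z @[z --> 0^'+] --> - l <->
  f (Xpt z w) / z @[z --> 0^'-] --> l.
Proof.
rewrite (@cvg_at_leftNP _ _ (fun z => f (Xpt z w) / z)) oppr0.
have -> : (fun z => f (Xpt z w) / z) \o -%R = fun z => - (f (- Xpt z (- w)) / z).
  by apply/funext => z /=; rewrite -XptN opprK invrN mulrN.
split=> [H|H]; first by rewrite -[l]opprK; exact: cvgN.
rewrite (_ : (fun z => _) = fun z => - - (f (- Xpt z (- w)) / z)); first exact: cvgN.
by apply/funext => z; rewrite opprK.
Qed.

Lemma cs_cvg_right f w : cs f -> S3 w -> cvg (f (Xpt z w) / z @[z --> 0^'+]).
Proof. by move=> csf wS; apply/cvg_ex; exists (scri f 0 w); exact: cvg_scri. Qed.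

Lemma cs_cvg_left f w : cs f -> S3 w -> cvg (f (Xpt z w) / z @[z --> 0^'-]).
Proof.
move=> csf wS; apply/cvg_ex; exists (- scri (fun x => f (- x)) 0 (- w)).
apply/cvg_left_opp; rewrite opprK.
exact: (@cvg_scri _ (fun x => f (- x)) (cs_opp csf) (- w) (S3N wS)).
Qed.

Lemma cs_even_right f w : cs f -> (forall x, dS4 x -> f (- x) = f x) -> S3 w ->
  f (Xpt z w) / z @[z --> 0^'+] --> (0 : R).
Proof.
move=> csf fe wS; have tr := quat_frame wS.
by have := cvg_scri csf wS; rewrite /scri (scri_value_even csf tr fe).
Qed.

Lemma cs_even_left f w : cs f -> (forall x, dS4 x -> f (- x) = f x) -> S3 w ->
  f (Xpt z w) / z @[z --> 0^'-] --> (0 : R).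
Proof.
move=> csf fe wS; apply/cvg_left_opp; rewrite oppr0.
apply: (@cs_even_right (fun x => f (- x)) (- w) (cs_opp csf) _ (S3N wS)) => x xdS.
by rewrite opprK fe.
Qed.

Lemma cs_even_of_left f : cs f ->
  (forall w, S3 w -> f (Xpt z w) / z @[z --> 0^'-] --> (0 : R)) ->
  forall x, dS4 x -> f (- x) = f x.
Proof.
move=> csf f0 x xdS.
have := @scalar_even R (fun x => f (- x)) (cs_opp csf) _ x xdS.
rewrite opprK => -> // w wS; have := f0 _ (S3N wS).
by move=> /cvg_left_opp; rewrite opprK oppr0.
Qed.

(* A solution of [dl o0 h = 2 * xlow o0 * h] is [h (x) = h (0, w) / (1 + (x^0)^2)]. *)
Lemma static_cvg h w : smooth h ->
  (forall x, dS4 x -> dl o0 h x = 2 * xlow x o0 * h x) -> S3 w ->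
  h (Xpt z w) / z @[z --> 0^'-] --> (0 : R).
Proof.
move=> sh dh wS; have [w0 _] := S3E wS.
pose s (t : R) := Num.sqrt (1 + t * t).
have s1 (t : R) : 0 < 1 + t * t by rewrite ltr_pwDl// -expr2 sqr_ge0.
have s0 (t : R) : 0 < s t by rewrite sqrtr_gt0.
have ss (t : R) : s t * s t = 1 + t * t by rewrite -expr2 sqr_sqrtr// ltW.
pose c (t : R) : V := t *: e0 R + s t *: w.
pose dc (t : R) : V := e0 R + (t / s t) *: w.
have cdS t : dS4 (c t) by have [[]] := frame_boost (quat_frame wS) (ss t).
have ds t : is_derive t (1 : R) s (t / s t).
  have i1 : is_derive t (1 : R) (fun t => 1 + t * t) (2 * t).
    by apply: is_derive_eq; rewrite /GRing.scale/=; ring.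
  have H := @is_derive1_comp _ Num.sqrt (fun t => 1 + t * t) t _ _ (is_derive1_sqrt (s1 t)) i1.
  have -> : t / s t = (2 * Num.sqrt (1 + t * t))^-1 * (2 * t); last exact: H.
  by rewrite -/(s t); field; rewrite gt_eqF.
have dcc t a : is_derive t (1 : R) (fun t => coord (c t) a) (coord (dc t) a).
  rewrite (_ : (fun t => _) = fun t => t * coord (e0 R) a + s t * coord w a).
    by apply: is_derive_eq; rewrite /GRing.scale/= /dc coordD coordZ; ring.
  by apply/funext => u; rewrite coordD !coordZ.
have E t : D1 h (c t) (dc t) = - (2 * t) / (1 + t * t) * h (c t).
  have s1n : 1 + t * t != 0 by rewrite gt_eqF.
  apply: (mulfI s1n); rewrite -D1Zr.
  (* Up to the factor [1 + t * t] the velocity of the curve is the tangential part of [e0], so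
     [dl o0] is the derivative along the curve up to that factor. *)
  have -> : (1 + t * t) *: dc t = e0 R + t *: c t.
    apply: coord_inj => a; rewrite /dc /c !(coordD, coordZ).
    have : (1 + t * t) * (t / s t * coord w a) = t * s t * coord w a.
      by rewrite -ss; field; rewrite gt_eqF.
    by move=> H; rewrite mulrDr H; ring.
  have ct0 : coord (c t) o0 = t.
    by have [h0 _ _ _ _] := coord_e0 R; rewrite /c coordD !coordZ w0 h0; ring.
  have x0 : xlow (c t) o0 = - t.
    by rewrite /xlow ct0; have [-> _ _ _ _] := eta5 R; rewrite mulN1r.
  have := dh _ (cdS t); rewrite /dl x0 => H.
  rewrite D1Dr D1Zr (_ : D1 h (c t) (e0 R) = pd o0 h (c t)).
    have {}H : pd o0 h (c t) = 2 * - t * h (c t) - t * D1 h (c t) (c t) by rewrite -H; ring.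
    by rewrite H; field.
  by rewrite /D1 sum5; have [-> -> -> -> ->] := coord_e0 R; ring.
have K t : (1 + t * t) * h (c t) = h (c 0).
  have -> : h (c 0) = (1 + 0 * 0) * h (c 0) by rewrite mulr0 addr0 mul1r.
  apply: (@is_derive_0_is_cst _ (fun t => (1 + t * t) * h (c t))) => u.
  have i1 := derive_comp_curve (smooth_C1 sh) (dcc u).
  apply: is_derive_eq; rewrite /GRing.scale/= E.
  by field; rewrite gt_eqF.
have H : (fun z => h (c 0) * z * (1 + z * z)^-1) z @[z --> 0^'-] --> (0 : R).
  apply: cvg_at_left_filter.
  have ci : continuous (fun z : R => (1 + z * z)^-1).
    by apply: ctV => [z|]; [rewrite gt_eqF|ct].
  have cz : continuous (fun z => h (c 0) * z * (1 + z * z)^-1).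
    apply: (@ctM _ _ (fun z => h (c 0) * z) (fun z => (1 + z * z)^-1)); last exact: ci.
    by apply: ctM; [exact: continuousT_cst|exact: continuousT_id].
  by have := cz 0; rewrite /continuous_at mulr0 mul0r.
apply: cvg_trans H; apply: near_eq_cvg; near=> z.
have z0 : z < 0 by near: z; exact: nbhs_left_lt.
have zn0 : z != 0 by rewrite lt_eqF.
have -> : Xpt z w = c z^-1 by rewrite /Xpt /c /s -/(e0 R) expr2 invfM.
have k0 : 1 + z^-1 * z^-1 != 0 by rewrite gt_eqF.
have zz : 1 + z * z != 0 by rewrite gt_eqF.
rewrite -(K z^-1); move: (h _) => k.
by field; rewrite zn0 zz.
Unshelve. all: by end_near. Qed.

Lemma sum_eta_delta (F : 'I_5 -> R) b : \sum_(a < 5) eta R a * ((a == b)%:R * eta R b) * F a = F b.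
Proof.
rewrite (eq_bigr (fun a => (a == b)%:R * (eta R a * eta R b * F a))); last by move=> a _; ring.
by rewrite sum_delta eta_sqr mul1r.
Qed.

(** The tangential gradient of the function [xlow x l] gives the first term, and since its [box] is
    -4 times itself the coefficient of [f] is 2 - 4. *)
Lemma box_low_mul f l x : cs f -> dS4 x ->
  box (fun x => xlow x l * f x) x = 2 * dl l f x - 2 * xlow x l * f x.
Proof.
move=> [sf bf] xdS; have sl := @smooth_low R l.
have E a : dl a (dl a (fun x => xlow x l * f x)) x =
    xlow x l * dl a (dl a f) x + 2 * (((a == l)%:R * eta R l - xlow x a * xlow x l) * dl a f x)
    - f x * (xlow x a * ((a == l)%:R * eta R l - xlow x a * xlow x l)
       + xlow x l * (eta R a - xlow x a * xlow x a)).
  have sa := @smooth_low R a.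
  rewrite (_ : dl a (fun x => xlow x l * f x) = fun x => xlow x l * dl a f x +
      f x * ((a == l)%:R * eta R l + -1 * (xlow x a * xlow x l))); last first.
    by apply/funext => y; rewrite (dlM a y sl sf) dl_low mulN1r.
  have s3 := smoothM sa sl; have s2 := smoothZ (-1) s3.
  have s1 := smoothD (smooth_cst ((a == l)%:R * eta R l)) s2.
  rewrite (dlD a x (smoothM sl (smooth_dl a sf)) (smoothM sf s1)).
  rewrite (dlM a x sl (smooth_dl a sf)) (dlM a x sf s1).
  rewrite (dlD a x (smooth_cst _) s2) dl_cst (dlZ a (-1) x s3) (dlM a x sa sl) !dl_low eqxx /=.
  by ring.
rewrite /box (eq_bigr (fun a => xlow x l * (eta R a * dl a (dl a f) x)
   + 2 * (eta R a * ((a == l)%:R * eta R l) * dl a f x)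
   - 2 * xlow x l * (coord x a * dl a f x)
   - f x * (eta R a * ((a == l)%:R * eta R l) * xlow x a)
   + f x * xlow x l * (coord x a * xlow x a)
   - f x * xlow x l + f x * xlow x l * (coord x a * xlow x a))); last first.
  by move=> a _; rewrite E /xlow; case: (eta_cases R a) => ->; ring.
rewrite !(sumrB, big_split) /= -!mulr_sumr !sum_eta_delta (sum_coord_dl f xdS) (dS4_low xdS).
rewrite -/(box f x) bf// sumr_const card_ord.
by rewrite -[coord x l *+ 5]mulr_natl /xlow; ring.
Qed.

End ConformalScalars.

(** * Maxwell fields and their duals as conformal scalars *)

Section Maxwell.
Variable R : realType.
Notation V := (V R).
Implicit Types (x w : V) (a b c l : 'I_5).

(** Differentiating the factor [coord x a] gives [proj x c a], which acts as the identity on the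
    tangential [T]. *)
Lemma dl_tangent (T : 'I_5 -> V -> R) c x : (forall a, smooth (T a)) ->
  (forall y, dS4 y -> \sum_(a < 5) coord y a * T a y = 0) -> dS4 x ->
  \sum_(a < 5) coord x a * dl c (T a) x = - T c x.
Proof.
move=> sT T0 xdS.
have s1 a : smooth (fun x => coord x a * T a x) by exact: (smoothM (@smooth_coord R a) (sT a)).
have s2 : smooth (fun x => \sum_(a < 5) coord x a * T a x) by exact: smooth_sum.
have : dl c (fun x => \sum_(a < 5) coord x a * T a x) x = dl c (fun=> 0) x.
  by apply: (dl_eq c s2 (smooth_cst 0) _ xdS) => y ydS; exact: T0.
rewrite dl_cst (dl_sum c _ x s1) => H.
have E : \sum_(a < 5) T a x * proj x c a = T c x.
  rewrite (eq_bigr (fun a => (a == c)%:R * T a x - xlow x c * (coord x a * T a x))).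
    by rewrite sumrB sum_delta -mulr_sumr T0// mulr0 subr0.
  by move=> a _; rewrite /proj eq_sym; ring.
apply/eqP; rewrite -addr_eq0; apply/eqP; rewrite -E -big_split -[RHS]H.
apply: eq_bigr => a _ /=.
by rewrite (dlM c x (@smooth_coord R a) (sT a)) dl_coord.
Qed.

(* The right-hand side of [mx_bianchi] comes from differentiating [mx_tan]. *)
Record maxwell (F : 'I_5 -> 'I_5 -> V -> R) : Prop := MaxwellField {
  mx_smooth : forall a b, smooth (F a b);
  mx_anti : forall x, dS4 x -> forall a b, F a b x = - F b a x;
  mx_tan : forall x, dS4 x -> forall b, \sum_(a < 5) coord x a * F a b x = 0;
  mx_div : forall x, dS4 x -> forall b, \sum_(a < 5) eta R a * dl a (F a b) x = 0;
  mx_bianchi : forall x, dS4 x -> forall a b c,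
    dl a (F b c) x + dl b (F c a) x + dl c (F a b) x =
    2 * (xlow x a * F b c x + xlow x b * F c a x + xlow x c * F a b x) }.

Variable F : 'I_5 -> 'I_5 -> V -> R.
Hypothesis mF : maxwell F.

Let sF := mx_smooth mF.
Let aF := mx_anti mF.

Lemma dl_anti c a b x : dS4 x -> dl c (F a b) x = - dl c (F b a) x.
Proof.
move=> xdS; rewrite -(dlN c x (sF b a)).
by apply: (dl_eq c (sF a b) (smoothN (sF b a)) _ xdS) => y ydS; exact: aF.
Qed.

Lemma sum_coord_F x a : dS4 x -> \sum_(b < 5) coord x b * F a b x = 0.
Proof.
move=> xdS; transitivity (- \sum_(b < 5) coord x b * F b a x).
  by rewrite -sumrN; apply: eq_bigr => b _; rewrite (aF xdS) mulrN.
by rewrite (mx_tan mF xdS) oppr0.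
Qed.

Lemma dl_tan x c b : dS4 x -> \sum_(a < 5) coord x a * dl c (F a b) x = - F c b x.
Proof.
by move=> xdS; apply: (dl_tangent c (fun a => sF a b) _ xdS) => y ydS; exact: (mx_tan mF).
Qed.

Lemma sum_proj (f : 'I_5 -> R) x b : dS4 x -> \sum_(a < 5) coord x a * f a = 0 ->
  \sum_(a < 5) eta R a * ((a == b)%:R * eta R b - xlow x a * xlow x b) * f a = f b.
Proof.
move=> xdS f0.
rewrite (eq_bigr (fun a => eta R a * ((a == b)%:R * eta R b) * f a - xlow x b * (coord x a * f a))).
  by rewrite sumrB sum_eta_delta -mulr_sumr f0 mulr0 subr0.
by move=> a _; rewrite /xlow; case: (eta_cases R a) => ->; ring.
Qed.

(** By [dlC] the derivative [dl b] is moved outside, where it acts on a divergence that vanishes on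
    dS_4; the commutator leaves another divergence and a contraction with [x]. *)
Lemma sum_dl_dl x b c : dS4 x ->
  \sum_(a < 5) eta R a * dl a (dl b (F c a)) x = F b c x.
Proof.
move=> xdS.
have sD : smooth (fun x => \sum_(a < 5) eta R a * dl a (F a c) x).
  by apply: smooth_sum => a; apply: smoothZ; exact: smooth_dl.
have D0 : \sum_(a < 5) eta R a * dl b (dl a (F a c)) x = 0.
  have : dl b (fun x => \sum_(a < 5) eta R a * dl a (F a c) x) x = dl b (fun=> 0) x.
    by apply: (dl_eq b sD (smooth_cst 0) _ xdS) => y ydS; exact: (mx_div mF).
  rewrite dl_cst dl_sum; last by move=> a; apply: smoothZ; exact: smooth_dl.
  move=> H; rewrite -[RHS]H; apply: eq_bigr => a _.
  by rewrite (dlZ b _ x (smooth_dl a (sF a c))).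
rewrite (eq_bigr (fun a => - (eta R a * dl b (dl a (F a c)) x)
   - coord x a * dl b (F a c) x + xlow x b * (eta R a * dl a (F a c) x))); last first.
  move=> a _; rewrite (dlC a b x (sF c a)).
  have -> : dl b (dl a (F c a)) x = - dl b (dl a (F a c)) x.
    rewrite -(dlN b x (smooth_dl a (sF a c))).
    apply: (dl_eq b (smooth_dl a (sF c a)) (smoothN (smooth_dl a (sF a c))) _ xdS) => y ydS.
    exact: dl_anti.
  rewrite (dl_anti b c a xdS) (dl_anti a c a xdS).
  by rewrite /xlow /=; case: (eta_cases R a) => ->; ring.
rewrite big_split sumrB sumrN D0 oppr0 sub0r /= -mulr_sumr (mx_div mF)// mulr0 addr0.
by rewrite (dl_tan b c xdS) opprK.
Qed.

(** The divergence of the Bianchi identity: its cyclic terms are evaluated by [sum_dl_dl], and only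
    multiples of [F b c] remain. *)
Lemma maxwell_cs b c : cs (F b c).
Proof.
split; first exact: sF.
move=> x xdS.
have sl a := @smooth_low R a.
have s3 a d e : smooth (fun x => xlow x a * F d e x) by exact: smoothM.
(* This is [dl a (F b c)] as expressed by the Bianchi identity. *)
pose g a x := 2 * (xlow x a * F b c x + xlow x b * F c a x + xlow x c * F a b x)
  + -1 * dl b (F c a) x + -1 * dl c (F a b) x.
have sg a : smooth (g a).
  apply: smoothD; [apply: smoothD|]; try by apply: smoothZ; exact: smooth_dl.
  by apply: smoothZ; apply: smoothD => //; exact: smoothD.
have E a : dl a (dl a (F b c)) x = dl a (g a) x.
  apply: (dl_eq a (smooth_dl a (sF b c)) (sg a) _ xdS) => y ydS.
  by rewrite /g -(mx_bianchi mF ydS); ring.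
have E2 a : dl a (g a) x = 2 * (xlow x a * dl a (F b c) x
     + F b c x * ((a == a)%:R * eta R a - xlow x a * xlow x a)
     + xlow x b * dl a (F c a) x + F c a x * ((a == b)%:R * eta R b - xlow x a * xlow x b)
     + xlow x c * dl a (F a b) x + F a b x * ((a == c)%:R * eta R c - xlow x a * xlow x c))
     - dl a (dl b (F c a)) x - dl a (dl c (F a b)) x.
  rewrite /g.
  have t1 := s3 a b c; have t2 := s3 b c a; have t3 := s3 c a b.
  have t4 := smooth_dl b (sF c a); have t5 := smooth_dl c (sF a b).
  rewrite (dlD a x (smoothD (smoothZ 2 (smoothD (smoothD t1 t2) t3)) (smoothZ (-1) t4)) (smoothZ (-1) t5)).
  rewrite (dlD a x (smoothZ 2 (smoothD (smoothD t1 t2) t3)) (smoothZ (-1) t4)).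
  rewrite (dlZ a 2 x (smoothD (smoothD t1 t2) t3)) (dlD a x (smoothD t1 t2) t3) (dlD a x t1 t2).
  rewrite (dlZ a (-1) x t4) (dlZ a (-1) x t5).
  rewrite (dlM a x (sl a) (sF b c)) (dlM a x (sl b) (sF c a)) (dlM a x (sl c) (sF a b)) !dl_low.
  by ring.
rewrite /box (eq_bigr (fun a => 2 * (coord x a * dl a (F b c) x)
   + 2 * F b c x * (1 - coord x a * xlow x a)
   + - (2 * xlow x b * (eta R a * dl a (F a c) x))
   + 2 * (eta R a * ((a == b)%:R * eta R b - xlow x a * xlow x b) * F c a x)
   + 2 * xlow x c * (eta R a * dl a (F a b) x)
   + - (2 * (eta R a * ((a == c)%:R * eta R c - xlow x a * xlow x c) * F b a x))
   - eta R a * dl a (dl b (F c a)) x + eta R a * dl a (dl c (F b a)) x)); last first.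
  move=> a _; rewrite E E2 eqxx (dl_anti a c a xdS) (aF xdS a b).
  have -> : dl a (dl c (F a b)) x = - dl a (dl c (F b a)) x.
    rewrite -(dlN a x (smooth_dl c (sF b a))).
    apply: (dl_eq a (smooth_dl c (sF a b)) (smoothN (smooth_dl c (sF b a))) _ xdS) => y ydS.
    exact: dl_anti.
  by rewrite /xlow /=; case: (eta_cases R a) => ->; ring.
rewrite !(sumrB, big_split, sumrN) /= -!mulr_sumr.
rewrite (sum_coord_dl _ xdS) (mx_div mF)// (mx_div mF)//.
rewrite !sum_proj//; try exact: sum_coord_F.
rewrite !sum_dl_dl// sumrB (dS4_low xdS) sumr_const card_ord (aF xdS c b).
by ring.
Qed.

(** The three-form x /\ F. In the ambient space it is dual to the Hodge dual of [F] on dS_4, so its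
    purely spatial components carry the magnetic field. *)
Definition dual3 a b c x : R := xlow x a * F b c x + xlow x b * F c a x + xlow x c * F a b x.

(** A single product of [xlow] and [F] is not a conformal scalar, but in the cyclic sum the gradient
    terms of [box_low_mul] combine by the Bianchi identity. *)
Lemma dual3_cs a b c : cs (dual3 a b c).
Proof.
have sl d := @smooth_low R d.
have s3 d e1 e2 : smooth (fun x => xlow x d * F e1 e2 x) by exact: smoothM.
split; first by apply: smoothD => //; exact: smoothD.
move=> x xdS; rewrite /dual3.
rewrite (boxD x (smoothD (s3 a b c) (s3 b c a)) (s3 c a b)) (boxD x (s3 a b c) (s3 b c a)).
rewrite (box_low_mul a (maxwell_cs b c) xdS) (box_low_mul b (maxwell_cs c a) xdS).
rewrite (box_low_mul c (maxwell_cs a b) xdS).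
transitivity (2 * (dl a (F b c) x + dl b (F c a) x + dl c (F a b) x)
  - 2 * (xlow x a * F b c x + xlow x b * F c a x + xlow x c * F a b x)); first by ring.
by rewrite (mx_bianchi mF xdS); ring.
Qed.

Lemma sum_coord_dual3 x b c : dS4 x -> \sum_(a < 5) coord x a * dual3 a b c x = F b c x.
Proof.
move=> xdS.
rewrite (eq_bigr (fun a => F b c x * (coord x a * xlow x a) + xlow x b * (coord x a * F c a x)
  + xlow x c * (coord x a * F a b x))); last by move=> a _; rewrite /dual3; ring.
rewrite !big_split /= -!mulr_sumr (dS4_low xdS) (sum_coord_F c xdS) (mx_tan mF xdS).
by ring.
Qed.

(** The factor is 4 - 1 - 1: the tangential divergence of the position field, less one for each
    index of [F]. *)
Lemma div_dual3 x b c : dS4 x -> \sum_(a < 5) eta R a * dl a (dual3 a b c) x = 2 * F b c x.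
Proof.
move=> xdS; have sl d := @smooth_low R d.
have s3 d e1 e2 : smooth (fun x => xlow x d * F e1 e2 x) by exact: smoothM.
rewrite (eq_bigr (fun a => coord x a * dl a (F b c) x
   + F b c x * (1 - coord x a * xlow x a)
   - xlow x b * (eta R a * dl a (F a c) x)
   + eta R a * ((a == b)%:R * eta R b - xlow x a * xlow x b) * F c a x
   + xlow x c * (eta R a * dl a (F a b) x)
   - eta R a * ((a == c)%:R * eta R c - xlow x a * xlow x c) * F b a x)); last first.
  move=> a _; rewrite /dual3.
  rewrite (dlD a x (smoothD (s3 a b c) (s3 b c a)) (s3 c a b)) (dlD a x (s3 a b c) (s3 b c a)).
  rewrite (dlM a x (sl a) (sF b c)) (dlM a x (sl b) (sF c a)) (dlM a x (sl c) (sF a b)) !dl_low.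
  rewrite eqxx (dl_anti a c a xdS) (aF xdS a b).
  by rewrite /xlow /=; case: (eta_cases R a) => ->; ring.
rewrite !(sumrB, big_split) /= -!mulr_sumr.
rewrite (sum_coord_dl _ xdS) (mx_div mF)// (mx_div mF)//.
rewrite !sum_proj//; try exact: sum_coord_F.
rewrite sumrB (dS4_low xdS) sumr_const card_ord (aF xdS c b).
by ring.
Qed.

Lemma static_odd_eq0 h : cs h -> (forall x, dS4 x -> h (- x) = - h x) ->
  (forall x, dS4 x -> dl o0 h x = 2 * xlow x o0 * h x) -> forall x, dS4 x -> h x = 0.
Proof.
move=> csh ho dh x xdS.
have := cs_even_of_left csh (fun w wS => static_cvg csh.1 dh wS) xdS.
by rewrite ho// => H; lra.
Qed.

Let dl_eq0 h c x : smooth h -> (forall y, dS4 y -> h y = 0) -> dS4 x -> dl c h x = 0.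
Proof.
by move=> sh h0 xdS; rewrite (dl_eq c sh (smooth_cst 0) h0 xdS) dl_cst.
Qed.

(** Without electric components, the Bianchi identity in the directions [o0], [a], [b] reduces to
    the equation of [static_cvg] for [F a b]. *)
Lemma maxwell_electric0 : (forall a b x, dS4 x -> F a b (- x) = - F a b x) ->
  (forall a x, dS4 x -> F a o0 x = 0) -> forall a b x, dS4 x -> F a b x = 0.
Proof.
move=> Fo F0 a b; apply: (static_odd_eq0 (maxwell_cs a b)) => [x xdS|x xdS]; first exact: Fo.
have := mx_bianchi mF xdS o0 a b.
rewrite (dl_anti b o0 a xdS) !(@dl_eq0 (F _ o0) _ x)//; try by move=> y; exact: F0.
by rewrite (aF xdS o0 a) !F0// !oppr0 !addr0 !mulr0 !addr0 mulrA.
Qed.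

Lemma dual3_cycle a b c x : dual3 a b c x = dual3 b c a x.
Proof. by rewrite /dual3; ring. Qed.

Lemma F_diag a x : dS4 x -> F a a x = 0.
Proof. by move=> xdS; have := aF xdS a a => H; lra. Qed.

(** When the spatial components of [dual3] vanish, its contraction with [x] and its divergence each
    reduce to the time term; eliminating [F] between them gives the equation of [static_cvg] for
    [dual3 o0 b c], which is odd because [F] is even. *)
Lemma maxwell_magnetic0 : (forall a b x, dS4 x -> F a b (- x) = F a b x) ->
  (forall a b c x, a != o0 -> b != o0 -> c != o0 -> dS4 x -> dual3 a b c x = 0) ->
  forall a b x, dS4 x -> F a b x = 0.
Proof.
move=> Fe G0.
have [h0 h1 h2 h3 h4] := eta5 R.
have Hs b c : b != o0 -> c != o0 -> forall x, dS4 x -> dual3 o0 b c x = 0.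
  move=> b0 c0; apply: (static_odd_eq0 (dual3_cs o0 b c)) => [x xdS|x xdS].
    by rewrite /dual3 !Fe// /xlow !coordN; ring.
  have z a : a != o0 -> forall y, dS4 y -> dual3 a b c y = 0 by move=> a0 y; exact: G0.
  have := div_dual3 b c xdS; have := sum_coord_dual3 b c xdS.
  have zd a : a != o0 -> dl a (dual3 a b c) x = 0.
    by move=> a0; exact: (dl_eq0 a (dual3_cs a b c).1 (z a a0) xdS).
  rewrite !sum5 h0 (z o1 isT x xdS) (z o2 isT x xdS) (z o3 isT x xdS) (z o4 isT x xdS).
  rewrite (zd o1 isT) (zd o2 isT) (zd o3 isT) (zd o4 isT) !mulr0 !addr0 mulN1r => E1 E2.
  rewrite -[LHS]opprK E2 -E1 /xlow h0; ring.
have H0 b c x : dS4 x -> dual3 o0 b c x = 0.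
  move=> xdS; have [->|b0] := eqVneq b o0.
    by rewrite /dual3 (F_diag o0 xdS) (aF xdS c o0); ring.
  have [->|c0] := eqVneq c o0; last exact: Hs.
  by rewrite /dual3 (F_diag o0 xdS) (aF xdS b o0); ring.
have H a b c x : dS4 x -> dual3 a b c x = 0.
  move=> xdS; have [->|a0] := eqVneq a o0; first exact: H0.
  have [->|b0] := eqVneq b o0; first by rewrite dual3_cycle H0.
  have [->|c0] := eqVneq c o0; first by rewrite -dual3_cycle H0.
  exact: G0.
move=> a b x xdS; rewrite -(sum_coord_dual3 a b xdS) big1// => c _.
by rewrite H// mulr0.
Qed.

End Maxwell.

(** * Vanishing of traceless tensors in low dimension, and the resulting Bianchi identity *)

Section TracelessTensors.
Variable R : realType.
Notation V := (V R).

Lemma eta_neq0 (a : 'I_5) : eta R a != 0.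
Proof. by have := eta_sqr R a; apply: contra_eq_neq => ->; rewrite mul0r eq_sym oner_eq0. Qed.

Lemma ord5_fresh (a b c d : 'I_5) : exists m : 'I_5, m \notin [:: a; b; c; d].
Proof.
apply/existsP; rewrite -[X in is_true X]negbK negb_exists; apply/negP => /forallP H.
have : (#|'I_5| <= size [:: a; b; c; d])%N.
  rewrite (leq_trans _ (card_size [:: a; b; c; d]))//.
  by apply: subset_leq_card; apply/fintype.subsetP => m _; have := H m; rewrite negbK.
by rewrite card_ord.
Qed.

Lemma mem_uniq5 (a b c d m k : 'I_5) : uniq [:: a; b; c; d; m] ->
  [|| k == a, k == b, k == c, k == d | k == m].
Proof.
move=> u; have := @uniq_min_size _ [:: a; b; c; d; m] (index_enum 'I_5) u.
move=> /(_ _)[]; first by move=> i _; exact: mem_index_enum.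
  by rewrite /index_enum -enumT size_enum_ord.
by move=> _ /(_ k); rewrite mem_index_enum !inE => /esym.
Qed.

Lemma sum_uniq5 (F : 'I_5 -> R) (a b c d m : 'I_5) : uniq [:: a; b; c; d; m] ->
  \sum_(i < 5) F i = F a + F b + F c + F d + F m.
Proof.
move=> u; have p : perm_eq (index_enum 'I_5) [:: a; b; c; d; m].
  apply: uniq_perm => //; first exact: index_enum_uniq.
  by move=> i; rewrite mem_index_enum !inE (mem_uniq5 i u).
by rewrite (perm_big _ p) !big_cons big_nil /= addr0 !addrA.
Qed.

Section UniqSwap.
Variables (T : eqType) (a b c d e : T).

Lemma uniq_swap12 : uniq [:: a; b; c; d; e] -> uniq [:: b; a; c; d; e].
Proof. by rewrite (@perm_uniq _ _ [:: b; a; c; d; e])//; apply/permP => q /=; rewrite addnCA. Qed.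

Lemma uniq_swap23 : uniq [:: a; b; c; d; e] -> uniq [:: a; c; b; d; e].
Proof.
rewrite (@perm_uniq _ _ [:: a; c; b; d; e])//; apply/permP => q /=.
by congr (_ + _)%N; rewrite addnCA.
Qed.

Lemma uniq_swap34 : uniq [:: a; b; c; d; e] -> uniq [:: a; b; d; c; e].
Proof.
rewrite (@perm_uniq _ _ [:: a; b; d; c; e])//; apply/permP => q /=.
by congr (_ + (_ + _))%N; rewrite addnCA.
Qed.

Lemma uniq_swap45 : uniq [:: a; b; c; d; e] -> uniq [:: a; b; c; e; d].
Proof.
rewrite (@perm_uniq _ _ [:: a; b; c; e; d])//; apply/permP => q /=.
by congr (_ + (_ + (_ + _)))%N; rewrite addnCA.
Qed.

End UniqSwap.

(* A traceless tensor antisymmetric in [p] and in [q] indices vanishes in dimension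
   less than [p + q]. *)
Lemma traceless42_eq0 (D : 'I_5 -> 'I_5 -> 'I_5 -> 'I_5 -> 'I_5 -> 'I_5 -> R) :
  (forall a b c f d e, D a b c f d e = - D b a c f d e) ->
  (forall a b c f d e, D a b c f d e = - D a c b f d e) ->
  (forall a b c f d e, D a b c f d e = - D a b f c d e) ->
  (forall a b c f d e, D a b c f d e = - D a b c f e d) ->
  (forall b c f e, \sum_(a < 5) eta R a * D a b c f a e = 0) ->
  forall a b c f d e, D a b c f d e = 0.
Proof.
move=> A1 A2 A3 A4 tr.
have e0 := eta_neq0.
have anti0 (y : R) : y = - y -> y = 0 by move=> H; lra.
have z12 a c f d e : D a a c f d e = 0 by apply: anti0; rewrite {1}A1.
have z23 a b f d e : D a b b f d e = 0 by apply: anti0; rewrite {1}A2.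
have z34 a b c d e : D a b c c d e = 0 by apply: anti0; rewrite {1}A3.
have z56 a b c f d : D a b c f d d = 0 by apply: anti0; rewrite {1}A4.
have z13 a b f d e : D a b a f d e = 0 by rewrite A2 z12 oppr0.
have z24 a b c d e : D a b c b d e = 0 by rewrite A3 z23 oppr0.
have z14 a b c d e : D a b c a d e = 0 by rewrite A3 z13 oppr0.
(* The summation index must avoid [b], [c], [f] and the last index [m], which leaves a single term
   of the trace. *)
have T1 a b c f m : uniq [:: a; b; c; f; m] -> D a b c f a m = 0.
  move=> u; have := tr b c f m; rewrite (sum_uniq5 _ u) z12 z13 z14 z56 !mulr0 !addr0.
  by move/eqP; rewrite mulf_eq0 (negbTE (e0 a)) => /eqP.
have T2 a b c f m : uniq [:: a; b; c; f; m] ->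
    eta R a * D a b c f a b + eta R m * D m b c f m b = 0.
  by move=> u; have := tr b c f b; rewrite (sum_uniq5 _ u) z12 z13 z14 !mulr0 !addr0.
(* Three traces relate the components with last index pairs ab, am and bm two at a time; up to signs
   the system has determinant 2. *)
have T3 a b c f m : uniq [:: a; b; c; f; m] -> D a b c f a b = 0.
  move=> u; have E1 := T2 a b c f m u.
  have E2 : eta R b * D b a c f b a + eta R m * D m a c f m a = 0.
    by apply: T2; exact: uniq_swap12.
  have E3 : eta R a * D a m c f a m + eta R b * D b m c f b m = 0.
    apply: T2; apply: uniq_swap45; apply: uniq_swap34; apply: uniq_swap23.
    by apply: uniq_swap34; exact: uniq_swap45.
  rewrite (A1 b a) (A4 _ _ _ _ b a) opprK in E2.
  rewrite (A1 a m) (A4 _ _ _ _ a m) opprK (A1 b m) (A4 _ _ _ _ b m) opprK in E3.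
  have H : 2 * (eta R a * (eta R b * eta R m)) * D a b c f a b = 0.
    have P1 : eta R a * eta R b * (eta R m) * D a b c f a b = eta R m * eta R b * (eta R a * D a b c f a b) by ring.
    have Q1 : eta R a * D a b c f a b = - (eta R m * D m b c f m b) by apply/eqP; rewrite -addr_eq0 E1.
    have Q2 : eta R b * D a b c f a b = - (eta R m * D m a c f m a) by apply/eqP; rewrite -addr_eq0 E2.
    have m2 := eta_sqr R m.
    transitivity (eta R b * eta R m * (eta R a * D a b c f a b) + eta R a * eta R m * (eta R b * D a b c f a b)).
      by ring.
    rewrite Q1 Q2.
    transitivity (- (eta R m * eta R m) * (eta R a * D m a c f m a + eta R b * D m b c f m b)); first by ring.
    by rewrite E3 mulr0.
  by move/eqP: H; rewrite !mulf_eq0 !(negbTE (e0 _)) pnatr_eq0 /= => /eqP.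
move=> a b c f d e.
have [->|ab] := eqVneq a b; first exact: z12.
have [->|ac] := eqVneq a c; first exact: z13.
have [->|af] := eqVneq a f; first exact: z14.
have [->|bc] := eqVneq b c; first exact: z23.
have [->|bf] := eqVneq b f; first exact: z24.
have [->|cf] := eqVneq c f; first exact: z34.
have [m mF] := ord5_fresh a b c f.
have u : uniq [:: a; b; c; f; m].
  move: mF; rewrite /= !inE !negb_or ab ac af bc bf cf /= => /and4P[m1 m2 m3 m4].
  by rewrite !(eq_sym _ m) m1 m2 m3 m4.
have all5 k := mem_uniq5 k u.
have first_eq k : [|| k == a, k == b, k == c | k == f] ->
    exists g1 g2 g3, uniq [:: k; g1; g2; g3; m] /\
      forall d e, (D a b c f d e = D k g1 g2 g3 d e) \/ (D a b c f d e = - D k g1 g2 g3 d e).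
  move=> /or4P[] /eqP->.
  - by exists b, c, f; split => // *; left.
  - exists a, c, f; split; first exact: uniq_swap12.
    by move=> *; right; exact: A1.
  - exists a, b, f; split; first by apply: uniq_swap12; exact: uniq_swap23.
    by move=> *; left; rewrite A2 A1 opprK.
  - exists a, b, c; split.
      by apply: uniq_swap12; apply: uniq_swap23; exact: uniq_swap34.
    by move=> *; right; rewrite A3 A2 A1 opprK.
have key k l : [|| k == a, k == b, k == c | k == f] -> D a b c f k l = 0.
  move=> kin; have [g1 [g2 [g3 [ug Dg]]]] := first_eq k kin.
  suff : D k g1 g2 g3 k l = 0 by move=> H; case: (Dg k l) => ->; rewrite H ?oppr0.
  have /or4P[/eqP->|/eqP->|/eqP->|] := mem_uniq5 l ug.
  - exact: z56.
  - exact: (T3 _ _ _ _ m).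
  - by rewrite A2 (T3 _ _ _ _ m) ?oppr0//; exact: uniq_swap23.
  - case/orP => /eqP->.
      by rewrite A3 A2 opprK (T3 _ _ _ _ m)//; apply: uniq_swap23; exact: uniq_swap34.
    exact: T1.
have := all5 d; rewrite !orbA => /orP[|/eqP->]; first by rewrite -!orbA; exact: key.
have := all5 e; rewrite !orbA => /orP[|/eqP->]; last exact: z56.
by rewrite -!orbA => /key H; rewrite A4 H oppr0.
Qed.

(** [C] lives in the four-dimensional tangent space at [x]. Antisymmetrizing with [x] gives the
    tensor [D] with four antisymmetric indices in dimension five, to which [traceless42_eq0]
    applies; contraction with [x] recovers [C]. *)
Lemma traceless32_eq0 (x : V) (C : 'I_5 -> 'I_5 -> 'I_5 -> 'I_5 -> 'I_5 -> R) : dS4 x ->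
  (forall a b c d e, C a b c d e = - C b a c d e) ->
  (forall a b c d e, C a b c d e = - C a c b d e) ->
  (forall a b c d e, C a b c d e = - C a b c e d) ->
  (forall b c d e, \sum_(a < 5) coord x a * C a b c d e = 0) ->
  (forall a b c e, \sum_(d < 5) coord x d * C a b c d e = 0) ->
  (forall b c e, \sum_(a < 5) eta R a * C a b c a e = 0) ->
  forall a b c d e, C a b c d e = 0.
Proof.
move=> xdS A1 A2 A4 t1 t4 tr.
have A13 a b c d e : C a b c d e = - C c b a d e by rewrite A1 A2 A1 !opprK.
pose D a b c f d e := xlow x f * C a b c d e - xlow x a * C f b c d e
  - xlow x b * C a f c d e - xlow x c * C a b f d e.
have D0 : forall a b c f d e, D a b c f d e = 0.
  apply: traceless42_eq0 => [a b c f d e|a b c f d e|a b c f d e|a b c f d e|b c f e]; rewrite /D.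
  - by rewrite (A1 b a c) (A1 f a c) (A1 b f c) (A1 b a f); ring.
  - by rewrite (A2 a c b) (A2 f c b) (A2 a f b) (A2 a c f); ring.
  - by rewrite (A13 c b f) (A2 a c f); ring.
  - by rewrite !(A4 _ _ _ e d); ring.
  rewrite (eq_bigr (fun a => xlow x f * (eta R a * C a b c a e) - coord x a * C f b c a e
    - xlow x b * (eta R a * C a f c a e) - xlow x c * (eta R a * C a b f a e))); last first.
    move=> a _; have xl : coord x a = eta R a * xlow x a by rewrite /xlow mulrA eta_sqr mul1r.
    by rewrite xl; ring.
  by rewrite !sumrB -!mulr_sumr !tr t4 !mulr0 !subr0.
move=> a b c d e.
have : \sum_(f < 5) coord x f * D a b c f d e = C a b c d e.
  rewrite (eq_bigr (fun f => C a b c d e * (coord x f * xlow x f) - xlow x a * (coord x f * C f b c d e)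
     + xlow x b * (coord x f * C f a c d e) - xlow x c * (coord x f * C f a b d e))); last first.
    move=> f _; rewrite /D (A1 a f c) (A13 a b f) (A2 f b a); ring.
  by rewrite !(sumrB, big_split) /= -!mulr_sumr !t1 (dS4_low xdS); ring.
by move=> <-; rewrite big1// => f _; rewrite D0 mulr0.
Qed.

(* The components of a field strength in two of its index pairs. *)
Record weyl (W : 'I_5 -> 'I_5 -> 'I_5 -> 'I_5 -> V -> R) : Prop := Weyl {
  w_smooth : forall a b c d, smooth (W a b c d);
  w_anti : forall x, dS4 x -> forall a b c d, W a b c d x = - W b a c d x;
  w_sym : forall x, dS4 x -> forall a b c d, W a b c d x = W c d a b x;
  w_tan : forall x, dS4 x -> forall b c d, \sum_(a < 5) coord x a * W a b c d x = 0;
  w_tr : forall x, dS4 x -> forall b c, \sum_(a < 5) eta R a * W a b a c x = 0;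
  w_cyc : forall x, dS4 x -> forall a b c d, W a b c d x + W b c a d x + W c a b d x = 0 }.

Section Weyl.
Variable W : 'I_5 -> 'I_5 -> 'I_5 -> 'I_5 -> V -> R.
Hypothesis wW : weyl W.

Let sW := w_smooth wW.

Let dl_eqW e (f g : V -> R) (x : V) : smooth f -> smooth g -> (forall y : V, dS4 y -> f y = - g y) -> dS4 x ->
  dl e f x = - dl e g x.
Proof.
move=> sf sg fg xdS; rewrite -(dlN e x sg).
by apply: (dl_eq e sf (smoothN sg) _ xdS).
Qed.

Let anti2 (x : V) a b c d : dS4 x -> W a b c d x = - W a b d c x.
Proof. by move=> xdS; rewrite (w_sym wW)// (w_anti wW)// (w_sym wW xdS d c). Qed.

Let tr' (x : V) b c : dS4 x -> \sum_(a < 5) eta R a * W b a a c x = 0.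
Proof.
move=> xdS; rewrite -[RHS]oppr0; transitivity (- \sum_(a < 5) eta R a * W a b a c x).
  by rewrite -sumrN; apply: eq_bigr => a _; rewrite (w_anti wW)// mulrN.
by rewrite (w_tr wW).
Qed.

Let tanW (x : V) a b c : dS4 x -> \sum_(d < 5) coord x d * W a b d c x = 0.
Proof.
move=> xdS; rewrite (eq_bigr (fun d => coord x d * W d c a b x)); first exact: (w_tan wW).
by move=> d _; rewrite (w_sym wW).
Qed.

Lemma weyl_bianchi : (forall x : V, dS4 x -> forall b c d,
    \sum_(a < 5) eta R a * dl a (W a b c d) x = 0) ->
  forall x : V, dS4 x -> forall a b c d e,
  dl a (W b c d e) x + dl b (W c a d e) x + dl c (W a b d e) x =
  2 * (xlow x a * W b c d e x + xlow x b * W c a d e x + xlow x c * W a b d e x).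
Proof.
move=> dv x xdS a b c d e; apply/eqP; rewrite -subr_eq0; apply/eqP.
pose C a b c d e := dl a (W b c d e) x + dl b (W c a d e) x + dl c (W a b d e) x -
  2 * (xlow x a * W b c d e x + xlow x b * W c a d e x + xlow x c * W a b d e x).
rewrite -/(C a b c d e); move: a b c d e.
have dA f a b d e : dl f (W a b d e) x = - dl f (W b a d e) x.
  by apply: (dl_eqW f (sW a b d e) (sW b a d e) _ xdS) => y ydS; exact: (w_anti wW).
have dA2 f a b d e : dl f (W a b d e) x = - dl f (W a b e d) x.
  by apply: (dl_eqW f (sW a b d e) (sW a b e d) _ xdS) => y ydS; exact: anti2.
have tan1 b d e c : \sum_(a < 5) coord x a * dl c (W a b d e) x = - W c b d e x.
  by apply: (dl_tangent c (fun a => sW a b d e) _ xdS) => y ydS; exact: (w_tan wW).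
have tan3 a b e c : \sum_(d < 5) coord x d * dl c (W a b d e) x = - W a b c e x.
  by apply: (dl_tangent c (fun d => sW a b d e) _ xdS) => y ydS; exact: tanW.
have trd f b e : \sum_(a < 5) eta R a * dl f (W a b a e) x = 0.
  have s1 a : smooth (fun x => eta R a * W a b a e x) by exact: smoothZ.
  have s2 : smooth (fun x => \sum_(a < 5) eta R a * W a b a e x) by exact: smooth_sum.
  have : dl f (fun x => \sum_(a < 5) eta R a * W a b a e x) x = dl f (fun=> 0) x.
    by apply: (dl_eq f s2 (smooth_cst 0) _ xdS) => y ydS; exact: (w_tr wW).
  rewrite dl_cst (dl_sum f _ x s1) => H; rewrite -[RHS]H.
  by apply: eq_bigr => a _; rewrite (dlZ f _ x (sW a b a e)).
(* The trace of [C] contracts the derivative with the third index of [W]; the exchange of pairs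
   carries the divergence equation there. *)
have dv3 b c e : \sum_(a < 5) eta R a * dl a (W b c a e) x = 0.
  rewrite -[RHS](dv x xdS e b c); apply: eq_bigr => a _; congr (_ * _).
  by apply: (dl_eq a (sW b c a e) (sW a e b c) _ xdS) => y ydS; exact: (w_sym wW).
apply: (traceless32_eq0 xdS) => [a b c d e|a b c d e|a b c d e|b c d e|a b c e|b c e]; rewrite /C.
- rewrite (dA b a c) (dA a c b) (dA c b a) !(w_anti wW xdS a c) !(w_anti wW xdS c b)
    !(w_anti wW xdS b a); ring.
- rewrite (dA a c b) (dA b a c) (dA c b a) !(w_anti wW xdS a c) !(w_anti wW xdS c b)
    !(w_anti wW xdS b a); ring.
- rewrite (dA2 a b c e d) (dA2 b c a e d) (dA2 c a b e d) (anti2 b c e d xdS) (anti2 c a e d xdS)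
    (anti2 a b e d xdS); ring.
- rewrite (eq_bigr (fun a => coord x a * dl a (W b c d e) x - coord x a * dl b (W a c d e) x
    + coord x a * dl c (W a b d e) x - 2 * W b c d e x * (coord x a * xlow x a)
    + 2 * xlow x b * (coord x a * W a c d e x) - 2 * xlow x c * (coord x a * W a b d e x))); last first.
    by move=> a _; rewrite (dA b c a) (w_anti wW xdS c a); ring.
  rewrite !(sumrB, big_split) /= -!mulr_sumr (sum_coord_dl _ xdS) !tan1 !(w_tan wW xdS) (dS4_low xdS).
  by rewrite (w_anti wW xdS c b); ring.
- rewrite (eq_bigr (fun d => coord x d * dl a (W b c d e) x + coord x d * dl b (W c a d e) x
    + coord x d * dl c (W a b d e) x - 2 * xlow x a * (coord x d * W b c d e x)
    - 2 * xlow x b * (coord x d * W c a d e x) - 2 * xlow x c * (coord x d * W a b d e x))); last first.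
    by move=> d _; ring.
  rewrite !(sumrB, big_split) /= -!mulr_sumr !tan3 !(tanW _ _ _ xdS) !mulr0 !subr0.
  by rewrite -!opprD (w_cyc wW xdS b c a e) oppr0.
- rewrite (eq_bigr (fun a => eta R a * dl a (W b c a e) x - eta R a * dl b (W a c a e) x
    + eta R a * dl c (W a b a e) x - 2 * (coord x a * W b c a e x)
    + 2 * xlow x b * (eta R a * W a c a e x) - 2 * xlow x c * (eta R a * W a b a e x))); last first.
    move=> a _; have xl : coord x a = eta R a * xlow x a by rewrite /xlow mulrA eta_sqr mul1r.
    by rewrite xl (dA b c a) (w_anti wW xdS c a); ring.
  rewrite !(sumrB, big_split) /= -!mulr_sumr dv3 !trd !(w_tr wW xdS) (tanW _ _ _ xdS).
  by ring.
Qed.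

(* [v] is the projection of the constant covector [e0] to the tangent space; if [W] is
   orthogonal to [v], then the antisymmetrization of [v] and [W] is traceless. *)
Lemma weyl_step (x : V) : dS4 x -> (forall a b c, W a b c o0 x = 0) -> forall a b c d, W a b c d x = 0.
Proof.
move=> xdS W0.
have [h0 h1 h2 h3 h4] := eta5 R.
pose v a := (a == o0)%:R * eta R o0 - xlow x a * xlow x o0.
have sv (f : 'I_5 -> R) : \sum_(a < 5) coord x a * f a = 0 -> \sum_(a < 5) eta R a * v a * f a = f o0.
  exact: (@sum_proj R f x o0 xdS).
have xv : \sum_(a < 5) coord x a * v a = 0.
  rewrite (eq_bigr (fun a => (a == o0)%:R * (eta R o0 * coord x a) - xlow x o0 * (coord x a * xlow x a))).
    by rewrite sumrB sum_delta -mulr_sumr (dS4_low xdS) /xlow; ring.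
  by move=> a _; rewrite /v; ring.
have W02 a b c : W a b o0 c x = 0 by rewrite anti2// W0 oppr0.
have W01 a b c : W o0 a b c x = 0 by rewrite (w_sym wW xdS) W02.
have W00 a b c : W a o0 b c x = 0 by rewrite (w_sym wW xdS) W0.
have tanS a b c := tanW a b c xdS.
have tan2 b c d : \sum_(a < 5) coord x a * W b a c d x = 0.
  transitivity (- \sum_(a < 5) coord x a * W a b c d x).
    by rewrite -sumrN; apply: eq_bigr => a _; rewrite (w_anti wW xdS) mulrN.
  by rewrite (w_tan wW xdS) oppr0.
pose C a b c d e := v a * W b c d e x + v b * W c a d e x + v c * W a b d e x.
have C0 : forall a b c d e, C a b c d e = 0.
  apply: (traceless32_eq0 xdS) => [a b c d e|a b c d e|a b c d e|b c d e|a b c e|b c e]; rewrite /C.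
  - by rewrite !(w_anti wW xdS a c) !(w_anti wW xdS c b) !(w_anti wW xdS b a); ring.
  - by rewrite !(w_anti wW xdS a c) !(w_anti wW xdS c b) !(w_anti wW xdS b a); ring.
  - by rewrite (anti2 b c e d xdS) (anti2 c a e d xdS) (anti2 a b e d xdS); ring.
  - rewrite (eq_bigr (fun a => W b c d e x * (coord x a * v a) + v b * (coord x a * W c a d e x)
      + v c * (coord x a * W a b d e x))); last by move=> a _; ring.
    by rewrite !big_split /= -!mulr_sumr xv tan2 (w_tan wW xdS) !mulr0 !addr0.
  - rewrite (eq_bigr (fun d => v a * (coord x d * W b c d e x) + v b * (coord x d * W c a d e x)
      + v c * (coord x d * W a b d e x))); last by move=> d _; ring.
    by rewrite !big_split /= -!mulr_sumr !tanS !mulr0 !addr0.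
  - rewrite (eq_bigr (fun a => eta R a * v a * W b c a e x + v b * (eta R a * W c a a e x)
      + v c * (eta R a * W a b a e x))); last by move=> a _; ring.
    by rewrite !big_split /= -!mulr_sumr sv// W02 tr'// (w_tr wW xdS) !mulr0 !addr0.
move=> b c d e.
have : \sum_(a < 5) eta R a * v a * C a b c d e = v o0 * W b c d e x.
  rewrite (eq_bigr (fun a => W b c d e x * (eta R a * v a * v a) + v b * (eta R a * v a * W c a d e x)
    + v c * (eta R a * v a * W a b d e x))); last by move=> a _; rewrite /C; ring.
  rewrite !big_split /= -!mulr_sumr (sv v xv) sv// sv; last exact: (w_tan wW xdS).
  by rewrite W00 W01; ring.
rewrite big1; last by move=> a _; rewrite C0 mulr0.
move/esym/eqP; rewrite mulf_eq0 => /orP[/eqP v0|/eqP//].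
(* This number is the square of [v], namely -(1 + (x^0)^2), as [v] is timelike. *)
have : v o0 < 0.
  rewrite /v eqxx h0 /xlow h0 mulN1r mulrNN mul1r.
  by have := sqr_ge0 (coord x o0); rewrite expr2 => ?; lra.
by rewrite v0 ltxx.
Qed.

End Weyl.

End TracelessTensors.

(** * Updates of multi-indices *)

Section IndexUpdates.
Variables (I : finType) (J : {ffun I -> 'I_5}).
Implicit Types (p q : I) (a b : 'I_5).

Lemma upd_eq p a : upd J p a p = a.
Proof. by rewrite ffunE eqxx. Qed.

Lemma upd_neq p q a : q != p -> upd J p a q = J q.
Proof. by move=> /negbTE qp; rewrite ffunE qp. Qed.

Lemma upd_upd p a b : upd (upd J p a) p b = upd J p b.
Proof. by apply/ffunP => q; rewrite !ffunE; case: (q == p). Qed.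

Lemma upd_id p : upd J p (J p) = J.
Proof. by apply/ffunP => q; rewrite !ffunE; case: eqP => [->|]. Qed.

Lemma updC p q a b : p != q -> upd (upd J p a) q b = upd (upd J q b) p a.
Proof.
move=> pq; apply/ffunP => r; rewrite !ffunE; case: (eqVneq r q) => [->|//].
by rewrite eq_sym (negbTE pq).
Qed.

End IndexUpdates.

(** * Contractions in all slots and the ambient form of the covariant derivative *)

Section MultilinearContraction.
Variables (R : realType) (I : finType).
Notation V := (V R).
Implicit Types (J : {ffun I -> 'I_5}) (p : I).

(* Averaging over the value of one index: [(b, a) |-> (upd b p a, b p)] is an involution. *)
Lemma sum_upd p (f : {ffun I -> 'I_5} -> R) :
  \sum_(b : {ffun I -> 'I_5}) \sum_(a < 5) f (upd b p a) = 5 * \sum_b f b.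
Proof.
rewrite pair_bigA /=.
rewrite (reindex_onto (fun u : {ffun I -> 'I_5} * 'I_5 => (upd u.1 p u.2, u.1 p))
  (fun u : {ffun I -> 'I_5} * 'I_5 => (upd u.1 p u.2, u.1 p))) /=; last first.
  by move=> [b a] _ /=; rewrite upd_upd upd_id upd_eq.
rewrite (eq_bigl xpredT); last first.
  by move=> [b a]; rewrite /= upd_upd upd_id upd_eq eqxx.
rewrite -(pair_bigA _ (fun (b : {ffun I -> 'I_5}) (a : 'I_5) => f (upd (upd b p a) p (b p)))) /= mulr_sumr.
apply: eq_bigr => b _; rewrite (eq_bigr (fun=> f b)) => [|a _]; last by rewrite upd_upd upd_id.
by rewrite sumr_const card_ord mulr_natl.
Qed.

Lemma contract_slot0 p (k : 'I_5 -> R) (h : I -> 'I_5 -> R) (S : {ffun I -> 'I_5} -> R) :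
  (forall J, \sum_(a < 5) k a * S (upd J p a) = 0) ->
  \sum_(b : {ffun I -> 'I_5}) k (b p) * (\prod_(i | i != p) h i (b i)) * S b = 0.
Proof.
move=> H; have : 5 * \sum_(b : {ffun I -> 'I_5}) k (b p) * (\prod_(i | i != p) h i (b i)) * S b = 0.
  rewrite -(sum_upd p) big1// => b _.
  rewrite (eq_bigr (fun a => (\prod_(i | i != p) h i (b i)) * (k a * S (upd b p a)))).
    by rewrite -mulr_sumr H mulr0.
  move=> a _; rewrite upd_eq mulrCA mulrA; congr (_ * _ * _).
  by apply: eq_bigr => i ip; rewrite upd_neq.
by move/eqP; rewrite mulf_eq0 pnatr_eq0 => /eqP.
Qed.

(** Every slot of [S] annihilates the normal, so multiples of it may be added to the contracted
    vectors. This removes the projections in [nablaE] and [bvalue_proj] and replaces the unit normal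
    by [e0] in [chart_normal]. *)
Lemma contract_normal (S : {ffun I -> 'I_5} -> R) (x : V) (h : I -> 'I_5 -> R) (c : I -> R) :
  (forall p J, \sum_(a < 5) coord x a * S (upd J p a) = 0) ->
  \sum_(b : {ffun I -> 'I_5}) (\prod_i (h i (b i) + c i * coord x (b i))) * S b = \sum_(b : {ffun I -> 'I_5}) (\prod_i h i (b i)) * S b.
Proof.
move=> tS; pose g (l : seq I) i a := h i a + (i \in l)%:R * (c i * coord x a).
suff key l : uniq l -> \sum_(b : {ffun I -> 'I_5}) (\prod_i g l i (b i)) * S b = \sum_(b : {ffun I -> 'I_5}) (\prod_i h i (b i)) * S b.
  rewrite -(key (enum I) (enum_uniq I)); apply: eq_bigr => b _; congr (_ * _).
  by apply: eq_bigr => i _; rewrite /g mem_enum mul1r.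
elim: l => [|p l IH] /=.
  move=> _; apply: eq_bigr => b _; congr (_ * _).
  by apply: eq_bigr => i _; rewrite /g mul0r addr0.
case/andP=> pl /IH <-.
rewrite (eq_bigr (fun b : {ffun I -> 'I_5} => (\prod_i g l i (b i)) * S b +
    (c p * coord x (b p)) * (\prod_(i | i != p) g l i (b i)) * S b)).
  rewrite big_split /= (contract_slot0 _ (k := fun a => c p * coord x a)) ?addr0// => J.
  transitivity (c p * \sum_(a < 5) coord x a * S (upd J p a)); last by rewrite tS mulr0.
  by rewrite mulr_sumr; apply: eq_bigr => a _; rewrite mulrA.
move=> b _; rewrite -mulrDl; congr (_ * _).
rewrite (bigD1 p)//= (bigD1 p (P := xpredT))//= /g inE eqxx (negbTE pl) mul0r mul1r addr0 mulrDl.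
by congr (_ * _ + _ * _); apply: eq_bigr => i /negbTE ip; rewrite inE ip.
Qed.

Lemma sum_delta_ffun (S : {ffun I -> 'I_5} -> R) J :
  \sum_(b : {ffun I -> 'I_5}) (\prod_i (J i == b i)%:R) * S b = S J.
Proof.
rewrite (bigD1 J)//= big1 => [|i _]; last by rewrite eqxx.
rewrite mul1r big1 ?addr0// => b /eqP bJ.
have [i iJ] : exists i, J i != b i.
  apply/existsP; rewrite -negb_forall; apply/negP => /forallP H; apply: bJ.
  by apply/ffunP => i; have /eqP := H i.
by rewrite (bigD1 i)//= (negbTE iJ) !mul0r.
Qed.

Variable T : field R I.
Hypotheses (sT : smooth_field T) (tT : tangent_field T).

Lemma dl_pd a (f : V -> R) x : dl a f x = \sum_(b < 5) proj x a b * pd b f x.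
Proof. by rewrite dl_D1; apply: eq_bigr => b _; rewrite coord_row. Qed.

(** The added terms cancel the normal parts of the ambient derivative. They are annihilated by the
    projections in [nabla], while their sum [S] with the derivative is tangential, so that
    projecting it changes nothing. *)
Lemma nablaE rho J x : dS4 x ->
  nabla T rho J x = dl rho (T J) x + \sum_p xlow x (J p) * T (upd J p rho) x.
Proof.
move=> xdS; pose S J := dl rho (T J) x + \sum_p xlow x (J p) * T (upd J p rho) x.
have tS q K : \sum_(a < 5) coord x a * S (upd K q a) = 0.
  have tdl : \sum_(a < 5) coord x a * dl rho (T (upd K q a)) x = - T (upd K q rho) x.
    apply: (dl_tangent rho (fun a => sT (upd K q a)) _ xdS) => y ydS.
    exact: tT.
  rewrite (eq_bigr (fun a => coord x a * dl rho (T (upd K q a)) x + (coord x a * xlow x a) * T (upd K q rho) x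
    + \sum_(p | p != q) xlow x (K p) * (coord x a * T (upd (upd K p rho) q a) x))).
    rewrite !big_split /= tdl -mulr_suml (dS4_low xdS) mul1r addNr add0r exchange_big /=.
    by rewrite big1// => p pq; rewrite -mulr_sumr tT// mulr0.
  move=> a _; rewrite /S mulrDr -addrA; congr (_ + _).
  rewrite (bigD1 q)//= upd_eq upd_upd mulrDr mulrA; congr (_ + _).
  rewrite mulr_sumr; apply: eq_bigr => p pq.
  by rewrite upd_neq// (updC _ _ _ pq) mulrCA.
transitivity (\sum_(b : {ffun I -> 'I_5}) (\prod_i proj x (J i) (b i)) * dl rho (T b) x).
  rewrite /nabla exchange_big /=; apply: eq_bigr => b _.
  rewrite dl_pd mulr_sumr; apply: eq_bigr => a _.
  by rewrite -pdE; ring.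
transitivity (\sum_(b : {ffun I -> 'I_5}) (\prod_i proj x (J i) (b i)) * S b).
  rewrite [RHS](eq_bigr (fun b : {ffun I -> 'I_5} => (\prod_i proj x (J i) (b i)) * dl rho (T b) x
    + \sum_p (proj x (J p) (b p) * xlow x (b p)) * (\prod_(i | i != p) proj x (J i) (b i))
      * T (upd b p rho) x)).
    rewrite big_split /= exchange_big /= [X in _ + X]big1 ?addr0// => p _.
    apply: (@contract_slot0 p (fun a => proj x (J p) a * xlow x a)
      (fun i a => proj x (J i) a) (fun b => T (upd b p rho) x)) => K.
    rewrite (eq_bigr (fun a => proj x (J p) a * xlow x a * T (upd K p rho) x)).
      rewrite -mulr_suml (eq_bigr (fun a => (a == J p)%:R * xlow x a - xlow x (J p) * (coord x a * xlow x a))).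
        by rewrite sumrB sum_delta -mulr_sumr (dS4_low xdS) mulr1 subrr mul0r.
      by move=> a _; rewrite /proj eq_sym; ring.
    by move=> a _; rewrite upd_upd.
  move=> b _; rewrite /S mulrDr; congr (_ + _); rewrite mulr_sumr; apply: eq_bigr => p _.
  by rewrite (bigD1 p)//=; ring.
rewrite -[RHS](sum_delta_ffun S J).
rewrite -(contract_normal (x := x) (fun i b => (J i == b)%:R) (fun i => - xlow x (J i)) tS).
apply: eq_bigr => b _; congr (_ * _); apply: eq_bigr => i _.
by rewrite /proj mulNr.
Qed.

End MultilinearContraction.

(** * Updates of whole index pairs *)

Section PairUpdates.
Variable n : nat.
Implicit Types (J : {ffun slot n -> 'I_5}) (k l : 'I_n.+1) (a b c d : 'I_5).

Definition setp J k a b : {ffun slot n -> 'I_5} :=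
  [ffun p : slot n => if p.1 == k then (if p.2 then b else a) else J p].

Lemma setpC J k l a b c d : k != l -> setp (setp J k a b) l c d = setp (setp J l c d) k a b.
Proof.
move=> kl; apply/ffunP => -[m []]; rewrite !ffunE /=; case: (eqVneq m l) => [->|//];
  by rewrite eq_sym (negbTE kl).
Qed.
Lemma setp_id J k : setp J k (J (k, false)) (J (k, true)) = J.
Proof. by apply/ffunP => -[m []]; rewrite !ffunE /=; case: eqP => [->|]. Qed.

Lemma setp_eq J k a b (t : bool) : setp J k a b (k, t) = if t then b else a.
Proof. by rewrite ffunE eqxx. Qed.

Lemma setp_neq J k l a b t : l != k -> setp J k a b (l, t) = J (l, t).
Proof. by move=> /negbTE lk; rewrite ffunE /= lk. Qed.

Lemma upd_setpF J k a b c : upd (setp J k a b) (k, false) c = setp J k c b.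
Proof.
by apply/ffunP => -[m []]; rewrite !ffunE /= xpair_eqE; case: (m == k).
Qed.

Lemma upd_setpT J k a b c : upd (setp J k a b) (k, true) c = setp J k a c.
Proof.
by apply/ffunP => -[m []]; rewrite !ffunE /= xpair_eqE; case: (m == k).
Qed.

Lemma swap_setp J k a b : swap (setp J k a b) (k, false) (k, true) = setp J k b a.
Proof. by rewrite /swap !setp_eq upd_setpF upd_setpT. Qed.

Lemma upd_setp2F J k l a b c d e : k != l ->
  upd (setp (setp J k c d) l a b) (k, false) e = setp (setp J k e d) l a b.
Proof. by move=> kl; rewrite (setpC _ _ _ _ _ kl) upd_setpF setpC// eq_sym. Qed.

Lemma upd_setp2T J k l a b c d e : k != l ->
  upd (setp (setp J k c d) l a b) (k, true) e = setp (setp J k c e) l a b.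
Proof. by move=> kl; rewrite (setpC _ _ _ _ _ kl) upd_setpT setpC// eq_sym. Qed.

Lemma swap_setp2 J k l a b c d : k != l ->
  swap (swap (setp (setp J k c d) l a b) (l, false) (k, false)) (l, true) (k, true) =
  setp (setp J k a b) l c d.
Proof.
move=> kl; have lk : l != k by rewrite eq_sym.
rewrite /swap !setp_eq !(setp_neq _ _ _ _ kl) !setp_eq upd_setpF upd_setp2F//.
by rewrite !setp_eq !(setp_neq _ _ _ _ kl) !setp_eq upd_setpT upd_setp2T// setpC.
Qed.

End PairUpdates.

(** * Symmetries and divergence of a solution, one or two index pairs at a time *)

Section Solutions.
Variables (R : realType) (n : nat) (phi : field R (slot n)).
Notation V := (V R).
Hypothesis sol : solution phi.
Implicit Types (J : {ffun slot n -> 'I_5}) (k l : 'I_n.+1) (a b c d : 'I_5) (x : V).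

Let s0 : smooth_field phi. Proof. by case: sol. Qed.
Let t0 : tangent_field phi. Proof. by case: sol => _ []. Qed.

Lemma sol_anti x J k a b : dS4 x -> phi (setp J k a b) x = - phi (setp J k b a) x.
Proof. by case: sol => _ [_ H] _ /H[+ _ _ _]; move=> /(_ k (setp J k b a)); rewrite swap_setp. Qed.

Lemma sol_sym x J k l a b c d : dS4 x -> k != l ->
  phi (setp (setp J k c d) l a b) x = phi (setp (setp J k a b) l c d) x.
Proof.
case: sol => _ [_ H] _ /H[_ + _ _] kl.
by move=> /(_ l k (setp (setp J k c d) l a b)); rewrite swap_setp2.
Qed.

Lemma sol_tan x J k b : dS4 x -> \sum_(a < 5) coord x a * phi (setp J k a b) x = 0.
Proof.
move=> xdS; rewrite -[RHS](t0 xdS (k, false) (setp J k b b)); apply: eq_bigr => a _.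
by rewrite upd_setpF.
Qed.

Lemma sol_trace x J p q : dS4 x -> p != q ->
  \sum_(a < 5) eta R a * phi (upd (upd J p a) q a) x = 0.
Proof. by case: sol => _ [_ H] _ /H[_ _ + _]; apply. Qed.

Lemma sol_cyc x J k l a b c d : dS4 x -> k != l ->
  phi (setp (setp J k c d) l a b) x + phi (setp (setp J k a d) l b c) x +
  phi (setp (setp J k b d) l c a) x = 0.
Proof.
move=> xdS kl; case: sol => _ [_ H] _; have [_ _ _] := H x xdS.
move=> /(_ (l, false) (l, true) (k, false) (setp (setp J k c d) l a b)).
rewrite !xpair_eqE /= andbF eq_sym (negbTE kl) => /(_ isT isT isT).
rewrite /alt3 /assign3 !setp_eq !(setp_neq _ _ _ _ kl) !setp_eq !upd_setpF !upd_setpT.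
rewrite !(upd_setp2F _ _ _ _ _ _ kl).
rewrite (sol_anti _ l b a xdS) (sol_anti _ l a c xdS) (sol_anti _ l c b xdS) => E.
lra.
Qed.

(** In the contracted [nablaE] every correction term is a trace of [phi] or a contraction with [x],
    so the covariant divergence equals the one formed with [dl]. *)
Lemma sol_div x J k b : k = ord0 -> dS4 x ->
  \sum_(a < 5) eta R a * dl a (phi (setp J k a b)) x = 0.
Proof.
move=> -> xdS; case: sol => _ _ [/(_ x xdS (setp J ord0 b b)) E _].
rewrite -[RHS]E {E}.
rewrite [RHS](eq_bigr (fun a => eta R a * dl a (phi (setp J ord0 a b)) x +
  (coord x a * phi (setp J ord0 a b) x + \sum_(p | p != (ord0, false))
   xlow x (setp J ord0 b b p) * (eta R a * phi (upd (upd (setp J ord0 b b) (ord0, false) a) p a) x)))).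
  rewrite !big_split /= sol_tan// add0r exchange_big /= [X in _ + X]big1 ?addr0// => p p0.
  by rewrite -mulr_sumr sol_trace ?mulr0// eq_sym.
move=> a _; rewrite (nablaE s0 t0)// mulrDr upd_setpF; congr (_ + _).
rewrite (bigD1 (ord0, false))//= upd_setpF setp_eq mulrDr; congr (_ + _).
  by rewrite /xlow !mulrA eta_sqr mul1r.
rewrite mulr_sumr; apply: eq_bigr => p p0.
rewrite mulrCA; congr (_ * (_ * phi (upd _ _ _) x)); rewrite ?upd_setpF//.
by rewrite -(upd_setpF J ord0 b b a) upd_neq.
Qed.

Lemma sol_weyl J k : k != ord0 -> weyl (fun a b c d => phi (setp (setp J k c d) ord0 a b)).
Proof.
move=> k0; split.
- by move=> *; exact: s0.
- by move=> x xdS a b c d; exact: sol_anti.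
- by move=> x xdS a b c d; exact: sol_sym.
- by move=> x xdS b c d; exact: sol_tan.
- move=> x xdS b c.
  have E : (ord0, false) != (k, false) :> slot n by rewrite xpair_eqE eq_sym (negbTE k0).
  rewrite -[RHS](sol_trace (setp (setp J k b c) ord0 b b) xdS E); apply: eq_bigr => a _.
  by rewrite upd_setpF upd_setp2F.
- by move=> x xdS a b c d; exact: sol_cyc.
Qed.

Lemma sum_slot0 (f : slot 0 -> R) : \sum_p f p = f (ord0, false) + f (ord0, true).
Proof.
rewrite (eq_bigr (fun p => f (p.1, p.2))) => [|[]//].
rewrite -(pair_bigA _ (fun i j => f (i, j))) /= big_ord1.
by rewrite big_bool addrC.
Qed.

End Solutions.

(** * Maxwell fields obtained by freezing index pairs *)

Section SolutionMaxwell.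
Variables (R : realType).
Notation V := (V R).

Lemma solution_bianchi n (phi : field R (slot n)) J : solution phi ->
  forall x : V, dS4 x -> forall a b c,
    dl a (phi (setp J ord0 b c)) x + dl b (phi (setp J ord0 c a)) x + dl c (phi (setp J ord0 a b)) x =
    2 * (xlow x a * phi (setp J ord0 b c) x + xlow x b * phi (setp J ord0 c a) x
      + xlow x c * phi (setp J ord0 a b) x).
Proof.
case: n phi J => [|n] phi J sol x xdS a b c; last first.
  have k0 : lift ord0 ord0 != ord0 :> 'I_n.+2 by [].
  have H := weyl_bianchi (sol_weyl sol J k0) _ xdS.
  have := H _ a b c (J (lift ord0 ord0, false)).
  move=> /(_ _ (J (lift ord0 ord0, true))); rewrite setp_id; apply.
  by move=> y ydS b' c' d'; exact: (sol_div sol).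
have [s0 [t0 _] [_ /= cl]] := sol.
have pE d e : pairJ d e = setp J ord0 d e.
  by apply/ffunP => -[m t]; rewrite !ffunE /= ord1 eqxx.
have := cl x xdS a b c; rewrite !pE !(nablaE s0 t0)// !sum_slot0 !setp_eq !upd_setpF !upd_setpT.
have dA d e f : dl d (phi (setp J ord0 e f)) x = - dl d (phi (setp J ord0 f e)) x.
  rewrite -(dlN d x (s0 _)); apply: (dl_eq d (s0 _) (smoothN (s0 _)) _ xdS) => y ydS.
  exact: (sol_anti sol).
rewrite (dA b a c) (dA a c b) (dA c b a).
rewrite (sol_anti sol J ord0 b a xdS) (sol_anti sol J ord0 a c xdS) (sol_anti sol J ord0 c b xdS).
move=> E; lra.
Qed.

Lemma solution_maxwell n (phi : field R (slot n)) J : solution phi ->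
  maxwell (fun a b => phi (setp J ord0 a b)).
Proof.
move=> sol; split.
- by case: sol.
- by move=> x xdS a b; exact: (sol_anti sol).
- by move=> x xdS b; exact: (sol_tan sol).
- by move=> x xdS b; exact: (sol_div sol).
- by move=> x xdS a b c; exact: (solution_bianchi J sol).
Qed.

End SolutionMaxwell.

(** * Boundary values of tensors without time components *)

Section BoundaryTensors.
Variables (R : realType) (n : nat).
Notation V := (V R).
Implicit Types (J : {ffun 'I_n.+1 -> 'I_5}) (x w : V) (u : 'I_n.+1 -> V) (z : R).

Lemma Xpt_dS4 z w : S3 w -> dS4 (Xpt z w).
Proof.
move=> wS; have z2 : 0 <= 1 + z^-2 by rewrite addr_ge0// invr_ge0 sqr_ge0.
have ss : Num.sqrt (1 + z^-2) * Num.sqrt (1 + z^-2) = 1 + z^-1 * z^-1.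
  by rewrite -expr2 sqr_sqrtr// -exprVn expr2.
by have [[]] := frame_boost (quat_frame wS) ss.
Qed.

(* The electric and magnetic parts contracted with the static vector field [d/dx^0]
   instead of the normal [n], which agrees with it up to scale modulo [x]. *)
Record boundary_tensor (G : field R 'I_n.+1) : Prop := BoundaryTensor {
  bt_cs : forall J, cs (G J);
  bt_tan : tangent_field G;
  bt_spatial : forall x, dS4 x -> forall p J, J p = o0 -> G J x = 0 }.

(** The factors [Num.sqrt (1 + z^-2)] of the chart vectors are absent: each is absorbed by the unit
    normal of the same pair, see [sqrt_nvec]. *)
Definition bvalue (G : field R 'I_n.+1) u x : R :=
  \sum_(J : {ffun 'I_n.+1 -> 'I_5}) (\prod_k coord (u k) (J k)) * G J x.

Variable G : field R 'I_n.+1.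
Hypothesis bG : boundary_tensor G.

Lemma bvalue_cs u : cs (bvalue G u).
Proof. by apply: cs_sum => J; apply: csZ; exact: bt_cs. Qed.

Lemma bvalue_even u : (forall J x, dS4 x -> G J (- x) = G J x) ->
  forall x, dS4 x -> bvalue G u (- x) = bvalue G u x.
Proof. by move=> Ge x xdS; apply: eq_bigr => J _; rewrite Ge. Qed.

(** Having no time components, [G] is orthogonal to [w] as well as to [x], so projecting the ambient
    basis vectors to the tangent space of S^3 loses nothing. Data on tangent vectors thus determine
    every spatial component. *)
Lemma bvalue_proj z w J : S3 w -> (forall k, J k != o0) ->
  bvalue G (fun k => evec R (J k) - coord w (J k) *: w) (Xpt z w) = G J (Xpt z w).
Proof.
move=> wS J0; have [w0 _] := S3E wS; have XdS := Xpt_dS4 z wS.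
rewrite -[RHS](sum_delta_ffun (fun K => G K (Xpt z w)) J).
have S0 : Num.sqrt (1 + z^-2) != 0.
  by rewrite sqrtr_eq0 -ltNge ltr_pwDl// invr_ge0 sqr_ge0.
rewrite -(contract_normal (x := w) (fun i b => (J i == b)%:R) (fun i => - coord w (J i))).
  apply: eq_bigr => K _; congr (_ * _); apply: eq_bigr => k _.
  by rewrite coordB coordZ coord_evec mulNr eq_sym.
move=> p K; have := bt_tan bG XdS p K.
rewrite (eq_bigr (fun a => Num.sqrt (1 + z^-2) * (coord w a * G (upd K p a) (Xpt z w)))).
  by rewrite -mulr_sumr => /eqP; rewrite mulf_eq0 (negbTE S0) => /eqP.
move=> a _; have [->|a0] := eqVneq a o0.
  by rewrite (bt_spatial bG XdS (p := p)) ?upd_eq// !mulr0.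
rewrite {1}/Xpt coordD !coordZ coord_evec ord0E (negbTE a0) mulr0 add0r.
by rewrite mulrA.
Qed.

Lemma tangentS3_proj w (a : 'I_5) : S3 w -> a != o0 ->
  tangentS3 w (evec R a - coord w a *: w).
Proof.
move=> wS a0; have [w0 _] := S3E wS; case: (wS) => _ w1; split.
  by rewrite ord0E coordB coordZ coord_evec eq_sym (negbTE a0) w0 mulr0 subr0.
rewrite (eq_bigr (fun b => (b == a)%:R * coord w b - coord w a * coord w b ^+ 2)).
  by rewrite sumrB sum_delta -mulr_sumr w1 mulr1 subrr.
by move=> b _; rewrite coordB coordZ coord_evec; ring.
Qed.

Lemma boundary_even : (forall w u, S3 w -> (forall k, tangentS3 w (u k)) ->
    bvalue G u (Xpt z w) / z @[z --> 0^'-] --> (0 : R)) ->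
  forall J x, dS4 x -> G J (- x) = G J x.
Proof.
move=> H J x xdS.
have [/existsP[p /eqP p0]|] := boolP [exists k, J k == o0].
  by rewrite !(bt_spatial bG _ p0)//; exact: dS4_opp.
rewrite negb_exists => /forallP J0.
apply: (cs_even_of_left (bt_cs bG J) _ xdS) => w wS.
have := H w (fun k => evec R (J k) - coord w (J k) *: w) wS (fun k => tangentS3_proj wS (J0 k)).
rewrite (_ : (fun z => _) = fun z => G J (Xpt z w) / z)//.
by apply/funext => z; rewrite bvalue_proj.
Qed.

End BoundaryTensors.

(** * Antisymmetry of the Levi-Civita symbol *)

Section LeviCivita.
Variable R : realType.
Notation V := (V R).
Implicit Types (a b c d e : 'I_5).

Definition inversions a b c d e : nat :=
  ((b < a) + (c < a) + (d < a) + (e < a) + (c < b) + (d < b) + (e < b) + (d < c) + (e < c) + (e < d))%N.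

Lemma eps5E a b c d e :
  eps5 R a b c d e = if uniq [:: a; b; c; d; e] then (-1) ^+ inversions a b c d e else 0.
Proof.
rewrite /eps5 (map_inj_uniq (@val_inj _ _ _) [:: a; b; c; d; e]); case: ifP => // _.
congr (_ ^+ _); rewrite /inversions.
under eq_bigr do rewrite big_mkcond /=.
rewrite big_ord_recl !(big_ord_recl, big_ord0) /=.
rewrite ?addn0 ?add0n.
lia.
Qed.

(** Here [m] and [n] count the inversions before and after the exchange of the neighbours [b] and
    [c], and differ by one. *)
Let signE (m n : nat) (b c : 'I_5) : c != b -> (m + (b < c) = n + (c < b))%N ->
  (-1) ^+ m = - (-1) ^+ n :> R.
Proof.
rewrite -val_eqE /=; case: ltngtP => //= _ _; rewrite addn0 addn1.
  by move=> <-; rewrite exprS mulN1r opprK.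
by move=> ->; rewrite exprS mulN1r.
Qed.

Lemma eps5_swap12 a b c d e : eps5 R a b c d e = - eps5 R b a c d e.
Proof.
rewrite !eps5E; case: ifP => u; last by case: ifP => [/uniq_swap12|]; rewrite ?u ?oppr0.
rewrite (uniq_swap12 u).
have ab : b != a by apply: contraTneq u => ->; rewrite /= !inE eqxx.
apply: (signE ab); rewrite /inversions; lia.
Qed.

Lemma eps5_swap23 a b c d e : eps5 R a b c d e = - eps5 R a c b d e.
Proof.
rewrite !eps5E; case: ifP => u; last by case: ifP => [/uniq_swap23|]; rewrite ?u ?oppr0.
rewrite (uniq_swap23 u); have bc : c != b by apply: contraTneq u => ->; rewrite /= !inE eqxx /= ?orbT ?andbF.
apply: (signE bc); rewrite /inversions; lia.
Qed.

Lemma eps5_swap34 a b c d e : eps5 R a b c d e = - eps5 R a b d c e.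
Proof.
rewrite !eps5E; case: ifP => u; last by case: ifP => [/uniq_swap34|]; rewrite ?u ?oppr0.
rewrite (uniq_swap34 u); have cd : d != c by apply: contraTneq u => ->; rewrite /= !inE eqxx /= ?orbT ?andbF.
apply: (signE cd); rewrite /inversions; lia.
Qed.

Lemma eps5_swap45 a b c d e : eps5 R a b c d e = - eps5 R a b c e d.
Proof.
rewrite !eps5E; case: ifP => u; last by case: ifP => [/uniq_swap45|]; rewrite ?u ?oppr0.
rewrite (uniq_swap45 u); have de : e != d by apply: contraTneq u => ->; rewrite /= !inE eqxx /= ?orbT ?andbF.
apply: (signE de); rewrite /inversions; lia.
Qed.

Lemma eps5_rep a b c d e : ~~ uniq [:: a; b; c; d; e] -> eps5 R a b c d e = 0.
Proof. by rewrite eps5E => /negbTE->. Qed.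

Lemma eps5_uniq a b c d e : uniq [:: a; b; c; d; e] -> eps5 R a b c d e != 0.
Proof. by move=> u; rewrite eps5E u signr_eq0. Qed.

End LeviCivita.

Ltac eps5_rep0 := by apply: eps5_rep; rewrite /= !inE ?eqxx ?orbT ?andbF.

(** * The magnetic vector in terms of the dual three-form *)

Section MagneticContraction.
Variable R : realType.
Notation V := (V R).
Implicit Types (x : V) (a b c j k l m : 'I_5) (F : 'I_5 -> 'I_5 -> V -> R).

Lemma anti_contract (x : V) (f : 'I_5 -> 'I_5 -> R) : (forall a l, f a l = - f l a) ->
  \sum_(a < 5) xlow x a * \sum_(l < 5) f a l * xlow x l = 0.
Proof.
move=> fA; set Y := (X in X = _).
suff : Y = - Y by move=> H; lra.
rewrite {1}/Y (eq_bigr (fun a => \sum_(l < 5) f a l * xlow x l * xlow x a)); last first.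
  by move=> a _; rewrite mulrC mulr_suml.
rewrite exchange_big /= -sumrN; apply: eq_bigr => a _.
rewrite mulr_sumr -sumrN; apply: eq_bigr => l _.
by rewrite fA; ring.
Qed.

Lemma eps4ll_tan2 x j (r s : 'I_5) : \sum_(a < 5) coord x a * eps4ll x j a r s = 0.
Proof.
rewrite (eq_bigr (fun a => eta R j * (xlow x a * \sum_(l < 5) eps5 R j a r s l * xlow x l))).
  rewrite -mulr_sumr (@anti_contract x (fun a l => eps5 R j a r s l)) ?mulr0// => a l.
  by rewrite eps5_swap23 eps5_swap34 eps5_swap45 eps5_swap34 eps5_swap23 !opprK.
by move=> a _; rewrite /eps4ll /eps4 /xlow; ring.
Qed.

Lemma eps4llC x a b (r s : 'I_5) : eps4ll x a b r s = - eps4ll x b a r s.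
Proof.
rewrite /eps4ll /eps4 -mulrN -sumrN (mulrC (eta R b)); congr (_ * _).
by apply: eq_bigr => l _; rewrite eps5_swap12 mulNr.
Qed.

Lemma eps4ll_tan1 x j (r s : 'I_5) : \sum_(a < 5) coord x a * eps4ll x a j r s = 0.
Proof.
transitivity (- \sum_(a < 5) coord x a * eps4ll x j a r s).
  by rewrite -sumrN; apply: eq_bigr => a _; rewrite eps4llC mulrN.
by rewrite eps4ll_tan2 oppr0.
Qed.

Lemma eps4ll_diag x a (r s : 'I_5) : eps4ll x a a r s = 0.
Proof. by have := eps4llC x a a r s => H; lra. Qed.

Lemma smooth_eps4ll a b (r s : 'I_5) : smooth (fun x => eps4ll x a b r s).
Proof.
apply: smoothZ; apply: smooth_sum => l; apply: smoothZ; exact: smooth_low.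
Qed.

Definition mag F j x : R := 2^-1 * \sum_(r < 5) \sum_(s < 5) eps4ll x j o0 r s * F r s x.

(** The Levi-Civita tensor of dS_4 contains [x], so [mag] contracts the ambient symbol with x /\ F;
    with [j] and [o0] fixed, the permutations of the other three indices all give the same
    component. *)
Lemma mag_dual3 F x j k l m : (forall a b, F a b x = - F b a x) ->
  uniq [:: j; o0; k; l; m] ->
  mag F j x = eta R j * eta R o0 * eps5 R j o0 k l m * dual3 F k l m x.
Proof.
move=> FA u.
have E13 b d e : eps5 R j b j d e = 0 by eps5_rep0.
have E14 b d e : eps5 R j b d j e = 0 by eps5_rep0.
have E15 b d e : eps5 R j b d e j = 0 by eps5_rep0.
have E23 a d e : eps5 R a o0 o0 d e = 0 by eps5_rep0.
have E24 a d e : eps5 R a o0 d o0 e = 0 by eps5_rep0.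
have E25 a d e : eps5 R a o0 d e o0 = 0 by eps5_rep0.
have E34 a b d e : eps5 R a b d d e = 0 by eps5_rep0.
have E35 a b d e : eps5 R a b d e d = 0 by eps5_rep0.
have E45 a b d e : eps5 R a b e d d = 0 by eps5_rep0.
rewrite /mag /eps4ll /eps4.
have S3 (r s : 'I_5) : \sum_(i < 5) eps5 R j o0 r s i * xlow x i =
    eps5 R j o0 r s k * xlow x k + eps5 R j o0 r s l * xlow x l + eps5 R j o0 r s m * xlow x m.
  by rewrite (sum_uniq5 _ u) E15 E25 !mul0r !add0r.
have S2 (r : 'I_5) (H : 'I_5 -> R) : \sum_(s < 5) eta R j * eta R o0 *
    (\sum_(i < 5) eps5 R j o0 r s i * xlow x i) * H s = eta R j * eta R o0 * (
    (eps5 R j o0 r k l * xlow x l + eps5 R j o0 r k m * xlow x m) * H k +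
    (eps5 R j o0 r l k * xlow x k + eps5 R j o0 r l m * xlow x m) * H l +
    (eps5 R j o0 r m k * xlow x k + eps5 R j o0 r m l * xlow x l) * H m).
  by rewrite (sum_uniq5 _ u) !S3 !E14 !E24 !E45; ring.
rewrite (sum_uniq5 _ u) !S2 !E13 !E23 !E34 !E35.
rewrite (FA l k) (FA m k) (FA m l).
have P1 : eps5 R j o0 k m l = - eps5 R j o0 k l m by exact: eps5_swap45.
have P2 : eps5 R j o0 l k m = - eps5 R j o0 k l m by exact: eps5_swap34.
have P3 : eps5 R j o0 l m k = eps5 R j o0 k l m by rewrite eps5_swap45 P2 opprK.
have P4 : eps5 R j o0 m k l = eps5 R j o0 k l m by rewrite eps5_swap34 P1 opprK.
have P5 : eps5 R j o0 m l k = - eps5 R j o0 k l m by rewrite eps5_swap34 P3.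
rewrite P1 P2 P3 P4 P5.
rewrite /dual3 (FA m k).
by field.
Qed.

Lemma dual3_of_mag F x : (forall a b, F a b x = - F b a x) -> (forall j, mag F j x = 0) ->
  forall a b c, a != o0 -> b != o0 -> c != o0 -> dual3 F a b c x = 0.
Proof.
move=> FA F0 a b c a0 b0 c0.
have FD d : F d d x = 0 by have := FA d d => H; lra.
have [->|ab] := eqVneq a b; first by rewrite /dual3 (FA c b) FD; ring.
have [->|ac] := eqVneq a c; first by rewrite /dual3 (FA c b) FD; ring.
have [->|bc] := eqVneq b c; first by rewrite /dual3 (FA c a) FD; ring.
have [j jF] := ord5_fresh o0 a b c.
have u : uniq [:: j; o0; a; b; c].
  by rewrite cons_uniq jF /= !inE !(eq_sym o0) !negb_or a0 b0 c0 ab ac bc.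
have /eqP := F0 j; rewrite (mag_dual3 FA u) !mulf_eq0 (negbTE (eps5_uniq R u)).
by rewrite !(negbTE (eta_neq0 _ _)) => /eqP.
Qed.

Lemma mag_cs F : maxwell F -> forall j, cs (mag F j).
Proof.
move=> mF j; have sF := mx_smooth mF.
have sm : smooth (mag F j).
  apply: smoothZ; apply: smooth_sum => r; apply: smooth_sum => s.
  exact: (smoothM (smooth_eps4ll j o0 r s) (sF r s)).
have [->|j0] := eqVneq j o0.
  apply: (cs_eq _ _ (cs0 R)) => [|y _].
    apply: smoothZ; apply: smooth_sum => r; apply: smooth_sum => s.
    exact: (smoothM (smooth_eps4ll o0 o0 r s) (sF r s)).
  rewrite /mag big1 ?mulr0// => r _; rewrite big1// => s _.
  by rewrite eps4ll_diag mul0r.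
have [k kF] := ord5_fresh j o0 j o0; have [l lF] := ord5_fresh j o0 k k.
have [m mF'] := ord5_fresh j o0 k l.
have u : uniq [:: j; o0; k; l; m].
  move: kF lF mF'; rewrite !inE !negb_or => /and4P[kj ko _ _] /and4P[lj lo lk _] /and4P[mj mo mk ml].
  rewrite /= !inE !negb_or j0 (eq_sym j k) (eq_sym j l) (eq_sym j m) (eq_sym o0 k) (eq_sym o0 l).
  by rewrite (eq_sym o0 m) (eq_sym k l) (eq_sym k m) (eq_sym l m) kj ko lj lo lk mj mo mk ml.
apply: (cs_eq sm _ (csZ (eta R j * eta R o0 * eps5 R j o0 k l m) (dual3_cs mF k l m))) => y ydS.
by rewrite (mag_dual3 (mx_anti mF ydS) u).
Qed.

End MagneticContraction.

(** * Electric and magnetic parts of a solution as boundary tensors *)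

Section BoundaryData.
Variables (R : realType) (n : nat).
Notation V := (V R).
Implicit Types (J nu : {ffun 'I_n.+1 -> 'I_5}) (x w : V) (u : 'I_n.+1 -> V) (z : R).

Lemma sqrt_nvec z w a : S3 w ->
  Num.sqrt (1 + z^-2) * nvec (Xpt z w) a = (o0 == a)%:R + z^-1 * coord (Xpt z w) a.
Proof.
move=> wS; have [w0 _] := S3E wS.
have z2 : 0 < 1 + z^-2 by rewrite ltr_pwDl// invr_ge0 sqr_ge0.
have SS : Num.sqrt (1 + z^-2) * Num.sqrt (1 + z^-2) = 1 + z^-2.
  by rewrite -expr2 sqr_sqrtr// ltW.
have X0 : coord (Xpt z w) o0 = z^-1.
  by rewrite /Xpt coordD !coordZ coord_evec ord0E w0 mulr0 mulr1 addr0.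
rewrite /nvec ord0E X0 exprVn (eq_sym o0); case: (eqVneq a o0) => [->|_].
  by rewrite X0 SS -exprVn expr2.
by rewrite mulrC mulfVK ?add0r// sqrtr_eq0 -ltNge.
Qed.

Lemma chart_normal (T : field R 'I_n.+1)
    (H : {ffun 'I_n.+1 -> 'I_5} -> {ffun 'I_n.+1 -> 'I_5} -> V -> R) w u z : S3 w ->
  (forall J x, T J x = \sum_(nu : {ffun 'I_n.+1 -> 'I_5}) (\prod_(k < n.+1) nvec x (nu k)) * H J nu x) ->
  (forall x, dS4 x -> forall p J nu, \sum_(a < 5) coord x a * H J (upd nu p a) x = 0) ->
  chart_comp T w u z = bvalue (fun J => H J [ffun=> o0]) u (Xpt z w).
Proof.
move=> wS TE tH; apply: eq_bigr => J _; rewrite big_split /= TE.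
rewrite mulrAC mulrC; congr (_ * _).
rewrite -[RHS](sum_delta_ffun (fun nu => H J nu (Xpt z w)) [ffun=> o0]).
rewrite -(contract_normal (x := Xpt z w) (fun i b => ([ffun=> o0] i == b)%:R) (fun=> z^-1)).
  rewrite mulr_sumr; apply: eq_bigr => nu _; rewrite mulrA -big_split /=; congr (_ * _).
  by apply: eq_bigr => k _; rewrite sqrt_nvec// ffunE.
by move=> p nu; exact: (tH _ (Xpt_dS4 z wS)).
Qed.

Definition pairs (J nu : {ffun 'I_n.+1 -> 'I_5}) : {ffun slot n -> 'I_5} :=
  [ffun p : slot n => if p.2 then nu p.1 else J p.1].

Lemma pairs_updT J nu p a : pairs J (upd nu p a) = upd (pairs J nu) (p, true) a.
Proof. by apply/ffunP => -[m []]; rewrite !ffunE /= xpair_eqE ?andbT ?andbF. Qed.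

Lemma pairs_updF J nu p a : pairs (upd J p a) nu = upd (pairs J nu) (p, false) a.
Proof. by apply/ffunP => -[m []]; rewrite !ffunE /= xpair_eqE ?andbT ?andbF. Qed.

Lemma setp_updT (K : {ffun slot n -> 'I_5}) p a (r s : 'I_5) :
  setp (upd K (p, true) a) ord0 r s =
  if p == ord0 then setp K ord0 r s else upd (setp K ord0 r s) (p, true) a.
Proof.
case: (eqVneq p ord0) => [->|p0]; apply/ffunP => -[m []]; rewrite !ffunE /= ?xpair_eqE;
  by case: (eqVneq m ord0) => [m0|]; rewrite ?m0 ?(eq_sym ord0) ?(negbTE p0) ?andbF.
Qed.

Lemma setp_updF (K : {ffun slot n -> 'I_5}) p a (r s : 'I_5) :
  setp (upd K (p, false) a) ord0 r s =
  if p == ord0 then setp K ord0 r s else upd (setp K ord0 r s) (p, false) a.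
Proof.
case: (eqVneq p ord0) => [->|p0]; apply/ffunP => -[m []]; rewrite !ffunE /= ?xpair_eqE;
  by case: (eqVneq m ord0) => [m0|]; rewrite ?m0 ?(eq_sym ord0) ?(negbTE p0) ?andbF.
Qed.

Lemma contract_double x (g : 'I_5 -> 'I_5 -> 'I_5 -> R) :
  (forall r s, \sum_(a < 5) coord x a * g a r s = 0) ->
  \sum_(a < 5) coord x a * (2^-1 * \sum_(r < 5) \sum_(s < 5) g a r s) = 0.
Proof.
move=> g0; transitivity (2^-1 * \sum_(r < 5) \sum_(s < 5) \sum_(a < 5) coord x a * g a r s).
  rewrite (eq_bigr _ (fun r _ => exchange_big _ _ _ _ _ _)) exchange_big mulr_sumr.
  apply: eq_bigr => a _; rewrite mulrCA mulr_sumr; congr (_ * _).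
  by apply: eq_bigr => r _; rewrite mulr_sumr.
by rewrite big1 ?mulr0// => r _; rewrite big1.
Qed.

Variable phi : field R (slot n).
Hypothesis sol : solution phi.

Let t0 : tangent_field phi. Proof. by case: sol => _ []. Qed.

Definition electric : field R 'I_n.+1 := fun J => phi (pairs J [ffun=> o0]).

Definition magnetic : field R 'I_n.+1 := fun J =>
  mag (fun a b => phi (setp (pairs J [ffun=> o0]) ord0 a b)) (J ord0).

Lemma chart_efield w u z : S3 w -> chart_comp (efield phi) w u z = bvalue electric u (Xpt z w).
Proof.
move=> wS; apply: (@chart_normal _ (fun J nu => phi (pairs J nu))) => // x xdS p J nu.
rewrite -[RHS](t0 xdS (p, true) (pairs J nu)); apply: eq_bigr => a _.
by rewrite pairs_updT.
Qed.

Lemma chart_bfield w u z : S3 w -> chart_comp (bfield phi) w u z = bvalue magnetic u (Xpt z w).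
Proof.
move=> wS; rewrite (chart_normal (H := fun J nu x => 2^-1 * \sum_(r < 5) \sum_(s < 5)
    eps4ll x (J ord0) (nu ord0) r s * phi (setp (pairs J nu) ord0 r s) x))//.
- apply: eq_bigr => J _; congr (_ * _); rewrite /magnetic /mag; congr (_ * _).
  by apply: eq_bigr => r _; apply: eq_bigr => s _; rewrite ffunE.
- move=> J x; rewrite /bfield mulr_sumr; apply: eq_bigr => nu _.
  rewrite [RHS]mulrCA; congr (_ * _); rewrite mulr_sumr; apply: eq_bigr => r _.
  rewrite mulr_sumr; apply: eq_bigr => s _; rewrite mulrCA mulrA; congr (_ * phi _ x).
  by apply/ffunP => -[m []]; rewrite !ffunE.
move=> x xdS p J nu; apply: contract_double => r s; have [->|p0] := eqVneq p ord0.
  rewrite (eq_bigr (fun a => (coord x a * eps4ll x (J ord0) a r s) * phi (setp (pairs J nu) ord0 r s) x)).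
    by rewrite -mulr_suml eps4ll_tan2 mul0r.
  by move=> a _; rewrite pairs_updT setp_updT eqxx upd_eq mulrA.
rewrite (eq_bigr (fun a => eps4ll x (J ord0) (nu ord0) r s *
   (coord x a * phi (upd (setp (pairs J nu) ord0 r s) (p, true) a) x))).
  by rewrite -mulr_sumr t0// mulr0.
move=> a _; rewrite pairs_updT setp_updT (negbTE p0) upd_neq ?(eq_sym ord0)//.
by rewrite mulrCA.
Qed.

Lemma sol_diag (K : {ffun slot n -> 'I_5}) k a x : dS4 x -> phi (setp K k a a) x = 0.
Proof. by move=> xdS; have := sol_anti sol K k a a xdS => H; lra. Qed.

Lemma electric_boundary : boundary_tensor electric.
Proof.
split.
- move=> J; have := maxwell_cs (solution_maxwell (pairs J [ffun=> o0]) sol) (J ord0) o0.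
  rewrite /electric -[in X in _ -> X](setp_id (pairs J [ffun=> o0]) ord0).
  by rewrite !ffunE.
- move=> x xdS p J; rewrite -[RHS](t0 xdS (p, false) (pairs J [ffun=> o0])).
  by apply: eq_bigr => a _; rewrite /electric pairs_updF.
move=> x xdS p J Jp; rewrite /electric -(setp_id (pairs J _) p) !ffunE /= Jp.
exact: sol_diag.
Qed.

Lemma magnetic_boundary : boundary_tensor magnetic.
Proof.
split.
- move=> J; exact: (mag_cs (solution_maxwell (pairs J [ffun=> o0]) sol)).
- move=> x xdS p J; apply: contract_double => r s; have [->|p0] := eqVneq p ord0.
    rewrite (eq_bigr (fun a => (coord x a * eps4ll x a o0 r s) * phi (setp (pairs J [ffun=> o0]) ord0 r s) x)).
      by rewrite -mulr_suml eps4ll_tan1 mul0r.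
    by move=> a _; rewrite pairs_updF setp_updF eqxx upd_eq mulrA.
  rewrite (eq_bigr (fun a => eps4ll x (J ord0) o0 r s *
     (coord x a * phi (upd (setp (pairs J [ffun=> o0]) ord0 r s) (p, false) a) x))).
    by rewrite -mulr_sumr t0// mulr0.
  move=> a _; rewrite pairs_updF setp_updF (negbTE p0) upd_neq ?(eq_sym ord0)//.
  by rewrite mulrCA.
move=> x xdS p J Jp; rewrite /magnetic /mag big1 ?mulr0// => r _; rewrite big1// => s _.
have [p0|p0] := eqVneq p ord0.
  by rewrite -p0 Jp eps4ll_diag mul0r.
rewrite -(setp_id (setp _ ord0 r s) p) !setp_neq// !ffunE /= Jp.
by rewrite sol_diag ?mulr0.
Qed.

End BoundaryData.

(** * Linear combinations, reflection, and the even and odd parts *)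

Section LinearStructure.
Variables (R : realType) (n : nat).
Notation V := (V R).
Implicit Types (phi psi : field R (slot n)) (x : V) (c d : R).

Definition reflect_field phi : field R (slot n) := fun J x => phi J (- x).

Definition comb_field c phi d psi : field R (slot n) := fun J x => c * phi J x + d * psi J x.

Lemma xlowN x (a : 'I_5) : xlow (- x) a = - xlow x a.
Proof. by rewrite /xlow coordN mulrN. Qed.

Lemma solution_of_nabla phi psi c d chi : solution phi -> solution psi ->
  smooth_field chi -> field_strength chi ->
  (forall rho J x, dS4 x -> nabla chi rho J x = c * nabla phi rho J x + d * nabla psi rho J x) ->
  solution chi.
Proof.
move=> [_ _ [dp cp]] [_ _ [ds cs']] sc fc E.
have dc : divergence_free chi.
  move=> x xdS J.
  rewrite (eq_bigr (fun rho => c * (eta R rho * nabla phi rho (upd J (ord0, false) rho) x)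
    + d * (eta R rho * nabla psi rho (upd J (ord0, false) rho) x))).
    by rewrite big_split /= -!mulr_sumr (dp x xdS) (ds x xdS) !mulr0 addr0.
  by move=> a _; rewrite E//; ring.
split => //; split => //; case: n phi psi chi cp cs' E {dp ds sc fc dc} => [|//] phi psi chi cp cs' E.
move=> x xdS a b e; rewrite !E//.
have Hp := cp x xdS a b e; have Hs := cs' x xdS a b e.
transitivity (c * 0 + d * 0 : R); last by rewrite !mulr0 addr0.
rewrite -[in c * 0]Hp -[in d * 0]Hs {Hp Hs E}.
by do 6!move: (nabla phi _ _ x) (nabla psi _ _ x) => ? ?; ring.
Qed.

Lemma solution_comb phi psi c d : solution phi -> solution psi -> solution (comb_field c phi d psi).
Proof.
move=> sp ss; case: (sp) => s1 [t1 f1] _; case: (ss) => s2 [t2 f2] _.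
have sc : smooth_field (comb_field c phi d psi).
  by move=> J; exact: (smoothD (smoothZ c (s1 J)) (smoothZ d (s2 J))).
have tc : tangent_field (comb_field c phi d psi).
  move=> x xdS p J; rewrite (eq_bigr (fun a => c * (coord x a * phi (upd J p a) x)
    + d * (coord x a * psi (upd J p a) x))).
    by rewrite big_split /= -!mulr_sumr t1// t2// !mulr0 addr0.
  by move=> a _; rewrite /comb_field; ring.
apply: (solution_of_nabla (c := c) (d := d) sp ss sc).
  split => // x xdS; have [a1 b1 c1 d1] := f1 x xdS; have [a2 b2 c2 d2] := f2 x xdS; split.
  - by move=> k J; rewrite /comb_field a1 a2; ring.
  - by move=> k l J; rewrite /comb_field b1 b2.
  - move=> p q J pq; rewrite (eq_bigr (fun a => c * (eta R a * phi (upd (upd J p a) q a) x)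
      + d * (eta R a * psi (upd (upd J p a) q a) x))).
      by rewrite big_split /= -!mulr_sumr c1// c2// !mulr0 addr0.
    by move=> a _; rewrite /comb_field; ring.
  - move=> p q r J pq qr pr; have H1 := d1 p q r J pq qr pr; have H2 := d2 p q r J pq qr pr.
    transitivity (c * alt3 phi J p q r x + d * alt3 psi J p q r x).
      rewrite /alt3 /comb_field /=.
      move: (assign3 J p q r) (J p) (J q) (J r) => A a b e; ring.
    by rewrite H1 H2 !mulr0 addr0.
move=> rho J x xdS; rewrite (nablaE sc tc rho J xdS) (nablaE s1 t1 rho J xdS) (nablaE s2 t2 rho J xdS) /comb_field.
rewrite (dlD rho x (smoothZ c (s1 J)) (smoothZ d (s2 J))) (dlZ rho c x (s1 J)) (dlZ rho d x (s2 J)).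
rewrite (eq_bigr (fun p => c * (xlow x (J p) * phi (upd J p rho) x) + d * (xlow x (J p) * psi (upd J p rho) x))).
  by rewrite big_split /= -!mulr_sumr; ring.
by move=> p _; ring.
Qed.

Lemma solution_reflect phi : solution phi -> solution (reflect_field phi).
Proof.
move=> sp; case: (sp) => s1 [t1 f1] [dv cl].
have sc : smooth_field (reflect_field phi) by move=> J; exact: smooth_opp.
have tc : tangent_field (reflect_field phi).
  move=> x xdS p J; have := t1 (- x) (dS4_opp xdS) p J.
  rewrite (eq_bigr (fun a => - (coord x a * reflect_field phi (upd J p a) x))).
    by rewrite sumrN => /eqP; rewrite oppr_eq0 => /eqP.
  by move=> a _; rewrite coordN mulNr.
have fc : field_strength (reflect_field phi).
  split => // x xdS; have [a1 b1 c1 d1] := f1 (- x) (dS4_opp xdS); split => //.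
have E rho J x : dS4 x -> nabla (reflect_field phi) rho J x = - nabla phi rho J (- x).
  move=> xdS; rewrite (nablaE sc tc rho J xdS) (nablaE s1 t1 rho J (dS4_opp xdS)).
  rewrite /reflect_field (dl_opp rho x (s1 J)) (opprD (dl rho (phi J) (- x))).
  rewrite -sumrN; congr (_ + _); apply: eq_bigr => p _.
  by rewrite xlowN mulNr opprK.
split => //; split.
  move=> x xdS J; have := dv (- x) (dS4_opp xdS) J.
  rewrite (eq_bigr (fun rho => - (eta R rho * nabla (reflect_field phi) rho (upd J (ord0, false) rho) x))).
    by rewrite sumrN => /eqP; rewrite oppr_eq0 => /eqP.
  by move=> a _; rewrite E// mulrN opprK.
move: (reflect_field phi) E => chi E.
case: n phi chi cl E {sp s1 t1 f1 dv sc tc fc} => [|//] phi chi cl E.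
move=> x xdS a b e; rewrite !E//; have H := cl (- x) (dS4_opp xdS) a b e.
rewrite -[RHS]oppr0 -[in RHS]H {H E}.
by do 6!move: (nabla phi _ _ (- x)) => ?; ring.
Qed.

(** The rank 2s is even, so antipodal parity is the plain parity of ambient components. *)
Lemma sign_slot : (-1) ^+ #|{: slot n}| = 1 :> R.
Proof. by rewrite card_prod card_bool -signr_odd oddM andbF. Qed.

Lemma evenE phi : antipodally_even phi <-> forall x, dS4 x -> forall J, phi J (- x) = phi J x.
Proof. by rewrite /antipodally_even; split => H x xdS J; rewrite H// sign_slot mul1r. Qed.

Lemma oddE phi : antipodally_odd phi <-> forall x, dS4 x -> forall J, phi J (- x) = - phi J x.
Proof. by rewrite /antipodally_odd; split => H x xdS J; rewrite H// sign_slot mul1r. Qed.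

Definition even_part phi := comb_field 2^-1 phi 2^-1 (reflect_field phi).
Definition odd_part phi := comb_field 2^-1 phi (- 2^-1) (reflect_field phi).

Lemma even_part_even phi x J : even_part phi J (- x) = even_part phi J x.
Proof. by rewrite /even_part /comb_field /reflect_field opprK addrC. Qed.

Lemma odd_part_odd phi x J : odd_part phi J (- x) = - odd_part phi J x.
Proof. by rewrite /odd_part /comb_field /reflect_field opprK; ring. Qed.

Lemma parts_add phi x J : phi J x = even_part phi J x + odd_part phi J x.
Proof. by rewrite /even_part /odd_part /comb_field; field. Qed.

Lemma solution_even_part phi : solution phi -> solution (even_part phi).
Proof. by move=> sp; exact: (solution_comb 2^-1 2^-1 sp (solution_reflect sp)). Qed.

Lemma solution_odd_part phi : solution phi -> solution (odd_part phi).
Proof. by move=> sp; exact: (solution_comb 2^-1 (- 2^-1) sp (solution_reflect sp)). Qed.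

End LinearStructure.

(** * From parity to boundary data, and from boundary data to the parity of the two parts *)

Section Parity.
Variables (R : realType) (n : nat) (phi : field R (slot n)).
Notation V := (V R).
Hypothesis sol : solution phi.
Implicit Types (x w : V) (u : 'I_n.+1 -> V).

Lemma EqE w u : S3 w -> Eq phi w u = fun z => bvalue (electric phi) u (Xpt z w) / z.
Proof. by move=> wS; apply/funext => z; rewrite /Eq (chart_efield sol). Qed.

Lemma BqE w u : S3 w -> Bq phi w u = fun z => bvalue (magnetic phi) u (Xpt z w) / z.
Proof. by move=> wS; apply/funext => z; rewrite /Bq (chart_bfield sol). Qed.

Let csE u := bvalue_cs (electric_boundary sol) u.
Let csB u := bvalue_cs (magnetic_boundary sol) u.

Lemma Eq_cvg w u : S3 w -> cvg (Eq phi w u @ 0^'+) /\ cvg (Eq phi w u @ 0^'-).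
Proof. by move=> wS; rewrite EqE//; split; [exact: (cs_cvg_right (csE u))|exact: (cs_cvg_left (csE u))]. Qed.

Lemma Bq_cvg w u : S3 w -> cvg (Bq phi w u @ 0^'+) /\ cvg (Bq phi w u @ 0^'-).
Proof. by move=> wS; rewrite BqE//; split; [exact: (cs_cvg_right (csB u))|exact: (cs_cvg_left (csB u))]. Qed.

Lemma magnetic_refl J x : (forall K, phi K (- x) = - phi K x) -> magnetic phi J (- x) = magnetic phi J x.
Proof.
move=> po; rewrite /magnetic /mag; congr (_ * _); apply: eq_bigr => r _; apply: eq_bigr => s _.
rewrite po mulrN -mulNr; congr (_ * _); rewrite /eps4ll /eps4 -mulrN -sumrN; congr (_ * _).
by apply: eq_bigr => l _; rewrite xlowN mulrN opprK.
Qed.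

Lemma even_magnetic w u : antipodally_even phi -> S3 w ->
  bdryE_plus phi w u = 0 /\ bdryE_minus phi w u = 0.
Proof.
move/evenE => pe wS; rewrite /bdryE_plus /bdryE_minus EqE//.
have be : forall x, dS4 x -> bvalue (electric phi) u (- x) = bvalue (electric phi) u x.
  by apply: bvalue_even => J x xdS; exact: pe.
by split; [rewrite (cvg_lim (@Rhausdorff R) (cs_even_right (csE u) be wS))
  |rewrite (cvg_lim (@Rhausdorff R) (cs_even_left (csE u) be wS))]; rewrite mulr0.
Qed.

Lemma odd_electric w u : antipodally_odd phi -> S3 w ->
  bdryB_plus phi w u = 0 /\ bdryB_minus phi w u = 0.
Proof.
move/oddE => po wS; rewrite /bdryB_plus /bdryB_minus BqE//.
have be : forall x, dS4 x -> bvalue (magnetic phi) u (- x) = bvalue (magnetic phi) u x.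
  by apply: bvalue_even => J x xdS; apply: magnetic_refl => K; exact: po.
by split; [rewrite (cvg_lim (@Rhausdorff R) (cs_even_right (csB u) be wS))
  |rewrite (cvg_lim (@Rhausdorff R) (cs_even_left (csB u) be wS))]; rewrite mulr0.
Qed.

(** Since [lim] takes a default value where no limit exists, its vanishing is informative only
    together with convergence. *)
Let lim_eq0 (f : R -> R) m : cvg (f @ 0^'-) -> (-1) ^+ m * lim (f @ 0^'-) = 0 ->
  f z @[z --> 0^'-] --> (0 : R).
Proof.
move=> cf /eqP; rewrite mulf_eq0 signr_eq0 /= => /eqP l0.
by rewrite -[X in _ --> X]l0.
Qed.

Lemma electric_even : (forall w u, S3 w -> (forall k, tangentS3 w (u k)) -> bdryE_minus phi w u = 0) ->
  forall J x, dS4 x -> electric phi J (- x) = electric phi J x.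
Proof.
move=> H; apply: (boundary_even (electric_boundary sol)) => w u wS tu.
have := lim_eq0 (Eq_cvg u wS).2 (H w u wS tu).
by rewrite EqE.
Qed.

Lemma magnetic_even : (forall w u, S3 w -> (forall k, tangentS3 w (u k)) -> bdryB_minus phi w u = 0) ->
  forall J x, dS4 x -> magnetic phi J (- x) = magnetic phi J x.
Proof.
move=> H; apply: (boundary_even (magnetic_boundary sol)) => w u wS tu.
have := lim_eq0 (Bq_cvg u wS).2 (H w u wS tu).
by rewrite BqE.
Qed.

(* The pairs of indices other than the first are freed one at a time. *)
Lemma solution_eq0 x : dS4 x ->
  (forall (J : {ffun 'I_n.+1 -> 'I_5}) a b, phi (setp (pairs J [ffun=> o0]) ord0 a b) x = 0) ->
  forall K, phi K x = 0.
Proof.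
move=> xdS H.
suff key m : forall K : {ffun slot n -> 'I_5},
    (forall k : 'I_n.+1, (m < k)%N -> K (k, true) = o0) -> phi K x = 0.
  by move=> K; apply: (key n) => k; rewrite ltnNge -ltnS ltn_ord.
elim: m => [|m IH] K Km.
  have := H [ffun k => K (k, false)] (K (ord0, false)) (K (ord0, true)).
  rewrite (_ : setp _ _ _ _ = K)//; apply/ffunP => -[k t]; rewrite !ffunE /=.
  have [->|k0] := eqVneq k ord0; first by case: t.
  by case: t; rewrite ?ffunE// Km// lt0n.
have [mn|mn] := leqP n m.
  by apply: IH => k mk; have := leq_ltn_trans mn mk; rewrite ltnNge -ltnS ltn_ord.
pose k : 'I_n.+1 := Ordinal (mn : (m.+1 < n.+1)%N).
have k0 : k != ord0 by [].
rewrite -(setp_id K ord0) -{1}(setp_id K k).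
apply: (weyl_step (sol_weyl sol K k0) xdS) => a b c; apply: IH => l ml.
have l0 : l != ord0 by apply: contraTneq ml => ->.
rewrite setp_neq//; have [->|lk] := eqVneq l k; first by rewrite setp_eq.
by rewrite setp_neq// Km// ltn_neqAle ml andbT; apply: contraNneq lk => ml'; apply/eqP/val_inj.
Qed.

End Parity.

(** * From the parity of the electric or magnetic part to that of the field *)

Section Converse.
Variables (R : realType) (n : nat) (phi : field R (slot n)).
Notation V := (V R).
Hypothesis sol : solution phi.

Lemma even_of_electric : (forall J x, dS4 x -> electric phi J (- x) = electric phi J x) ->
  antipodally_even phi.
Proof.
move=> Ee; have so := solution_odd_part sol.
suff o_eq0 x : dS4 x -> forall K, odd_part phi K x = 0.
  apply/evenE => x xdS J; rewrite (parts_add phi (- x)) (parts_add phi x) even_part_even.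
  by rewrite !o_eq0//; exact: dS4_opp.
move=> xdS; apply: (solution_eq0 so xdS) => J a b.
apply: (maxwell_electric0 (solution_maxwell (pairs J [ffun=> o0]) so) _ _ a b xdS) => [c d y ydS|c y ydS].
  exact: odd_part_odd.
have -> : setp (pairs J [ffun=> o0]) ord0 c o0 = pairs (upd J ord0 c) [ffun=> o0].
  by apply/ffunP => -[k []]; rewrite !ffunE /= ?if_same.
rewrite /odd_part /comb_field /reflect_field -/(electric phi (upd J ord0 c) y).
by rewrite -/(electric phi (upd J ord0 c) (- y)) Ee//; ring.
Qed.

Lemma odd_of_magnetic : (forall J x, dS4 x -> magnetic phi J (- x) = magnetic phi J x) ->
  antipodally_odd phi.
Proof.
move=> Be; have se := solution_even_part sol.
suff e_eq0 x : dS4 x -> forall K, even_part phi K x = 0.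
  apply/oddE => x xdS J; rewrite (parts_add phi (- x)) (parts_add phi x) odd_part_odd.
  by rewrite !e_eq0 ?add0r//; exact: dS4_opp.
move=> xdS; apply: (solution_eq0 se xdS) => J a b.
have mF := solution_maxwell (pairs J [ffun=> o0]) se.
apply: (maxwell_magnetic0 mF _ _ a b xdS) => [c d y ydS|c d e y c0 d0 e0 ydS].
  exact: even_part_even.
apply: (dual3_of_mag (mx_anti mF ydS)) => // j.
(* The Levi-Civita tensor of dS_4 changes sign under the antipodal map, so the magnetic part of the
   even part of [phi] is the odd part of its magnetic part. *)
transitivity (2^-1 * magnetic phi (upd J ord0 j) y - 2^-1 * magnetic phi (upd J ord0 j) (- y)); last first.
  by rewrite Be// subrr.
rewrite /magnetic /mag upd_eq.
rewrite [X in _ = X - _]mulrCA [X in _ = _ - X]mulrCA -mulrBr; congr (_ * _).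
rewrite !mulr_sumr -sumrB; apply: eq_bigr => r _; rewrite !mulr_sumr -sumrB; apply: eq_bigr => s _.
rewrite pairs_updF setp_updF eqxx.
have -> : eps4ll (- y) j o0 r s = - eps4ll y j o0 r s.
  rewrite /eps4ll /eps4 -mulrN -sumrN; congr (_ * _).
  by apply: eq_bigr => l _; rewrite xlowN mulrN.
by rewrite /even_part /comb_field /reflect_field; ring.
Qed.

End Converse.

(* Spin s = n.+1 >= 1; phi b is the real (b = true) / imaginary (b = false)
   part of the complex field strength. *)
Theorem theorem2 (R : realType) (n : nat) (phi : cfield R n) :
  csolution phi ->
  [/\
    (* the limits defining the boundary data on I^+ and I^- exist *)
    (forall (b : bool) (w : V R) (u : 'I_n.+1 -> V R),
       S3 w -> (forall k, tangentS3 w (u k)) ->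
       [/\ cvg (Eq (phi b) w u @ at_right 0), cvg (Eq (phi b) w u @ at_left 0),
           cvg (Bq (phi b) w u @ at_right 0) & cvg (Bq (phi b) w u @ at_left 0)]),
    (* the solution space is the direct sum of even and odd solutions *)
    (exists phie phio : cfield R n,
       [/\ csolution phie, csolution phio, cantipodally_even phie,
           cantipodally_odd phio &
           forall b x, dS4 x -> forall J, phi b J x = phie b J x + phio b J x])
    /\ (forall psi : cfield R n, csolution psi -> cantipodally_even psi ->
          cantipodally_odd psi -> forall b x, dS4 x -> forall J, psi b J x = 0),
    (* (1) antipodally even => purely magnetic *)
    (cantipodally_even phi ->
       forall (b : bool) (w : V R) (u : 'I_n.+1 -> V R),
         S3 w -> (forall k, tangentS3 w (u k)) ->
         bdryE_plus (phi b) w u = 0 /\ bdryE_minus (phi b) w u = 0),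
    (* (2) antipodally odd => purely electric *)
    (cantipodally_odd phi ->
       forall (b : bool) (w : V R) (u : 'I_n.+1 -> V R),
         S3 w -> (forall k, tangentS3 w (u k)) ->
         bdryB_plus (phi b) w u = 0 /\ bdryB_minus (phi b) w u = 0) &
    (* converses, from the data on I^- *)
    ((forall (b : bool) (w : V R) (u : 'I_n.+1 -> V R),
        S3 w -> (forall k, tangentS3 w (u k)) -> bdryE_minus (phi b) w u = 0) ->
       cantipodally_even phi)
    /\
    ((forall (b : bool) (w : V R) (u : 'I_n.+1 -> V R),
        S3 w -> (forall k, tangentS3 w (u k)) -> bdryB_minus (phi b) w u = 0) ->
       cantipodally_odd phi)].
Proof.
move=> sol; split.
- move=> b w u wS _; have [E1 E2] := Eq_cvg (sol b) u wS; have [B1 B2] := Bq_cvg (sol b) u wS.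
  by split.
- split.
    exists (fun b => even_part (phi b)), (fun b => odd_part (phi b)); split.
    - by move=> b; exact: solution_even_part.
    - by move=> b; exact: solution_odd_part.
    - by move=> b; apply/evenE => x _ J; exact: even_part_even.
    - by move=> b; apply/oddE => x _ J; exact: odd_part_odd.
    by move=> b x _ J; exact: parts_add.
  move=> psi _ pe po b x xdS J.
  have := (evenE (psi b)).1 (pe b) x xdS J; rewrite ((oddE (psi b)).1 (po b) x xdS J) => H; lra.
- by move=> pe b w u wS _; exact: even_magnetic.
- by move=> po b w u wS _; exact: odd_electric.
split=> H b.
  by apply: (even_of_electric (sol b)); apply: (electric_even (sol b)) => w u; exact: H.
by apply: (odd_of_magnetic (sol b)); apply: (magnetic_even (sol b)) => w u; exact: H.
Qed.
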